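(* Let $\varrho_0\in\varDelta^+$ and $r_0=e(\varrho_0,\cdot)$. Then the unique classical solution $r_t$ of the Vlasov hierarchy $$\frac{d}{dt}r_t=L_Vr_t,\qquad r_t|_{t=0}=r_0,$$ exists for all $t>0$ and is given by $$r_t(\eta)=e(\varrho_t,\eta)=\prod_{x\in\eta}\varrho_t(x),$$ where $\varrho_t\in\varDelta^+$ is the solution in $L^\infty(\mathbb{R}^d)$ of the kinetic equation $$\frac{d}{dt}\varrho_t(x)=(a\ast\varrho_t)(x)\exp\left[-(\varrho_t\ast\phi)(x)\right]-\varrho_t(x)\left(a\ast\exp(-\varrho_t\ast\phi)\right)(x),\qquad \varrho_t|_{t=0}=\varrho_0.$$ Moreover, this solution obeys $$r_t(\eta)\le r_0(\eta)\exp(\alpha|\eta|t).$$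
   Context: Data. $a:\mathbb{R}^d\to[0,+\infty)$ and $\phi:\mathbb{R}^d\to[0,+\infty)$ are measurable, $a(x)=a(-x)$, $\phi(x)=\phi(-x)$, $\alpha:=\int_{\mathbb{R}^d}a(x)\,dx<\infty$, and $\phi\in L^1(\mathbb{R}^d)$. $\ast$ is convolution on $\mathbb{R}^d$. $\varDelta^+=\{\varrho\in L^\infty(\mathbb{R}^d):\varrho(x)\ge0\text{ for a.a. }x\}$. Finite configurations. $\Gamma_0=\bigsqcup_{n\ge 0}\Gamma^{(n)}$, where $\Gamma^{(0)}=\{\emptyset\}$ and $\Gamma^{(n)}=\{\eta\subset\mathbb{R}^d:|\eta|=n\}$, with the Borel $\sigma$-field of the disjoint union topology ($\Gamma^{(n)}$ is identified with the symmetrization of $\{(x_1,\dots,x_n):x_i\ne x_j,\ i\neq j\}$); $|\eta|$ is the number of points of $\eta$. A measurable $k:\Gamma_0\to\mathbb{R}$ is identified with a sequence of symmetric functions $k^{(n)}:(\mathbb{R}^d)^n\to\mathbb{R}$, $k(\{x_1,\dots,x_n\})=k^{(n)}(x_1,\dots,x_n)$, with $k^{(0)}$ constant. The Lebesgue-Poisson measure on $\Gamma_0$ is $\lambda=\delta_\emptyset+\sum_{n\ge1}\frac1{n!}m^{(n)}$, where $m^{(n)}$ is the restriction of $dx_1\cdots dx_n$ to $\Gamma^{(n)}$. Single points $x$ are also written for the configurations $\{x\}$. For $f:\mathbb{R}^d\to\mathbb{R}$, $e(f,\eta)=\prod_{x\in\eta}f(x)$, $e(f,\emptyset)=1$. Operator.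 $$(L_Vk)(\eta)=\sum_{y\in\eta}\int_{\mathbb{R}^d}a(x-y)\int_{\Gamma_0}e(-\phi(y-\cdot),\xi)\,k(\xi\cup x\cup\eta\setminus y)\,\lambda(d\xi)\,dx$$ $$\qquad-\int_{\Gamma_0}k(\xi\cup\eta)\sum_{x\in\eta}\int_{\mathbb{R}^d}a(x-y)\,e(-\phi(y-\cdot),\xi)\,dy\,\lambda(d\xi).$$ Spaces and solutions. For $\vartheta\in\mathbb{R}$, $\mathcal{K}_\vartheta$ is the Banach space of ($\lambda$-a.e. classes of) $k:\Gamma_0\to\mathbb{R}$ with $\|k\|_\vartheta=\sup_{n\ge0}e^{\vartheta n}\nu_n(k)<\infty$, $\nu_0(k)=|k^{(0)}|$, $\nu_n(k)=\|k^{(n)}\|_{L^\infty((\mathbb{R}^d)^n)}$. A classical solution of the Vlasov hierarchy in $\mathcal{K}_\vartheta$ on a time interval $I$ is a map $I\ni t\mapsto r_t\in\mathcal{K}_\vartheta$ which is continuous on $I$, continuously differentiable on the interior of $I$, takes values in $\{k\in\mathcal{K}_\vartheta:L_Vk\in\mathcal{K}_\vartheta\}$, and solves the problem. A classical solution for all $t>0$ means a map $t\mapsto r_t$, $t\in[0,+\infty)$, such that for every $\tau>0$ there is $\vartheta\in\mathbb{R}$ for which its restriction to $[0,\tau)$ is a classical solution in $\mathcal{K}_\vartheta$. The solution of the kinetic equation is understood as a classical one: a map $[0,+\infty)\ni t\mapsto\varrho_t\in L^\infty(\mathbb{R}^d)$, continuous, continuously differentiable for $t>0$, and solving the equation.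
   Formalization: The last bound is proved with r_0(η) replaced by the norm ν_{|η|}(r_0)=‖ϱ_0‖^{|η|}; the pointwise form fails, e.g. φ=0 and a, ϱ_0 both the indicator of the unit ball: ϱ_t>0 on 1<|x|<2, where ϱ_0=0. *)

(* Defs.v *)
From HB Require Import structures.
From mathcomp Require Import all_boot all_order all_algebra finmap.
From mathcomp Require Import all_classical all_reals all_analysis.
From mathcomp Require Import measurable_realfun.

Set Implicit Arguments.
Unset Strict Implicit.
Unset Printing Implicit Defensive.

Import Order.TTheory GRing.Theory Num.Theory.
Import numFieldNormedType.Exports.

Local Open Scope classical_set_scope.
Local Open Scope ring_scope.

Section tuple_measure.
Context d (T : measurableType d) (R : realType).
Local Open Scope ereal_scope.

Definition tcons n (p : T * n.-tuple T) : n.+1.-tuple T :=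
  [tuple of p.1 :: p.2].

Lemma measurable_tcons n : measurable_fun [set: T * n.-tuple T] (@tcons n).
Proof. exact: measurable_cons. Qed.

Section cons_measure.
Variables (mu : {sigma_finite_measure set T -> \bar R}) (n : nat).
Variable nu : {sigma_finite_measure set (n.-tuple T) -> \bar R}.

Definition cons_measure (A : set (n.+1.-tuple T)) : \bar R :=
  (mu \x nu) (@tcons n @^-1` A).

Let cons_measure0 : cons_measure set0 = 0.
Proof. by rewrite /cons_measure preimage_set0 measure0. Qed.

Let cons_measure_ge0 A : 0 <= cons_measure A.
Proof. exact: measure_ge0. Qed.

Let mpre (A : set (n.+1.-tuple T)) :
  measurable A -> measurable (@tcons n @^-1` A).
Proof. by move=> mA; rewrite -[X in measurable X]setTI; exact: measurable_tcons. Qed.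

Let cons_measure_sigma_additive : semi_sigma_additive cons_measure.
Proof.
move=> F mF tF mUF; rewrite /cons_measure preimage_bigcup.
apply: measure_semi_sigma_additive.
- by move=> i; exact: mpre.
- apply/trivIsetP => /= i j _ _ ij; rewrite -preimage_setI.
  by move/trivIsetP : tF => /(_ _ _ _ _ ij) ->//; rewrite preimage_set0.
- by rewrite -preimage_bigcup; exact: mpre.
Qed.

HB.instance Definition _ := isMeasure.Build _ _ _
  cons_measure cons_measure0 cons_measure_ge0 cons_measure_sigma_additive.

Let cons_measure_sigma_finite : sigma_finite setT cons_measure.
Proof.
have /sigma_finiteP[F [TF ndF Foo]] := sigma_finiteT mu.
have /sigma_finiteP[G [TG ndG Goo]] := sigma_finiteT nu.
pose U (t : n.+1.-tuple T) : T * n.-tuple T := (thead t, [tuple of behead t]).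
have KU p : U (tcons p) = p.
  by case: p => x t; rewrite /U /tcons theadE; congr pair; exact: val_inj.
have mU : measurable_fun setT U.
  apply: measurable_fun_pair; first exact: measurable_tnth.
  exact: measurable_behead.
exists (fun k => U @^-1` (F k `*` G k)).
  rewrite -preimage_bigcup (_ : \bigcup_k _ = setT) ?preimage_setT//.
  rewrite -subTset => -[x y] _.
  have : [set: T] x by []. rewrite TF => -[k _ Fkx].
  have : [set: n.-tuple T] y by []. rewrite TG => -[l _ Gly].
  exists (maxn k l) => //; split => /=.
    by move: Fkx; exact/subsetPset/ndF/leq_maxl.
  by move: Gly; exact/subsetPset/ndG/leq_maxr.
move=> k; have [mF Fkoo] := Foo k; have [mG Gkoo] := Goo k; split.
  by rewrite -[X in measurable X]setTI; apply: mU => //; exact: measurableX.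
rewrite /cons_measure (_ : _ @^-1` _ = F k `*` G k).
  by rewrite product_measure1E// lte_mul_pinfty// ge0_fin_numE.
by apply/seteqP; split => p; rewrite /preimage /mkset KU.
Qed.

HB.instance Definition _ := Measure_isSigmaFinite.Build _ _ _
  cons_measure cons_measure_sigma_finite.

End cons_measure.

Fixpoint tuple_measure (mu : {sigma_finite_measure set T -> \bar R}) (n : nat) :
    {sigma_finite_measure set (n.-tuple T) -> \bar R} :=
  match n with
  | 0 => [the {sigma_finite_measure set (0.-tuple T) -> \bar R} of
           \d_([tuple] : 0.-tuple T)]
  | n'.+1 => [the {sigma_finite_measure set (n'.+1.-tuple T) -> \bar R} of
           cons_measure mu (tuple_measure mu n')]
  end.

End tuple_measure.

Notation Rvec R d := (d.-tuple (measurableTypeR R)).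

Section points.
Context (R : realType) (d : nat).
Implicit Types x y : Rvec R d.

Definition vsub x y : Rvec R d := [tuple (tnth x i - tnth y i : R) | i < d].

Definition vopp x : Rvec R d := [tuple (- tnth x i : R) | i < d].

Definition leb : {sigma_finite_measure set (Rvec R d) -> \bar R} :=
  tuple_measure lebesgue_measure d.

Definition conv (f g : Rvec R d -> R) (x : Rvec R d) : R :=
  \int[leb]_y (f (vsub x y) * g y).

End points.

Section configurations.
Context (R : realType) (d : nat).

Definition config := {fset Rvec R d}.

HB.instance Definition _ := Choice.on config.
HB.instance Definition _ := isPointed.Build config fset0.

Definition config_of n (t : n.-tuple (Rvec R d)) : config := [fset x in tval t]%fset.

Definition distinct n : set (n.-tuple (Rvec R d)) := [set t | uniq t].

Lemma measurable_distinct n : measurable (@distinct n).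
Proof.
pose E (i j : 'I_n) := \bigcap_(l in [set: 'I_d])
  [set t : n.-tuple (Rvec R d) | tnth (tnth t i) l == tnth (tnth t j) l].
have mE i j : measurable (E i j).
  apply: fin_bigcap_measurable => [|l _]; first exact: finite_finset.
  have mc k : measurable_fun [set: n.-tuple (Rvec R d)]
      (fun t => tnth (tnth t k) l : R).
    apply: (@measurableT_comp _ _ _ _ _ _ (fun x : Rvec R d => tnth x l)).
      exact: measurable_tnth.
    exact: measurable_tnth.
  rewrite -[X in measurable X]setTI.
  have := @measurable_fun_eqr _ _ R setT _ _ (mc i) (mc j) measurableT [set true].
  by apply.
rewrite (_ : @distinct n = \bigcap_(ij in [set ij : 'I_n * 'I_n | ij.1 != ij.2])
    ~` E ij.1 ij.2).
  by apply: fin_bigcap_measurable => [|ij _];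
    [exact: finite_finset|apply: measurableC; exact: mE].
apply/seteqP; split => t /=.
  move=> /tuple_uniqP tU [i j] /= /negP ij Eij; apply/ij/eqP/tU/eq_from_tnth => l.
  by apply/eqP; exact: Eij.
move=> tE; apply/tuple_uniqP => i j tij; apply/eqP/negPn/negP => ij.
by apply: (tE (i, j)) => //= l _ /=; rewrite tij.
Qed.

(* The Borel sigma-algebra of the disjoint union of the quotients Gamma^(n) of
   the off-diagonal parts of (R^d)^n by permutations: a set is Borel iff its
   preimage in each off-diagonal part is. *)
Definition config_measurable (A : set config) : Prop :=
  forall n, measurable (@config_of n @^-1` A `&` @distinct n).

Let config_measurable0 : config_measurable set0.
Proof. by move=> n; rewrite preimage_set0 set0I. Qed.

Let config_measurableC A : config_measurable A -> config_measurable (~` A).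
Proof.
move=> mA n; rewrite preimage_setC.
rewrite (_ : _ `&` _ = @distinct n `\` (@config_of n @^-1` A `&` @distinct n)).
  by apply: measurableD; [exact: measurable_distinct|exact: mA].
by rewrite setDIr setDv setU0 setIC.
Qed.

Let config_measurable_bigcup (F : (set config)^nat) :
  (forall i, config_measurable (F i)) -> config_measurable (\bigcup_i F i).
Proof.
move=> mF n; rewrite preimage_bigcup setI_bigcupl.
by apply: bigcupT_measurable => i; exact: mF.
Qed.

HB.instance Definition _ := @isMeasurable.Build default_measure_display config
  config_measurable config_measurable0 config_measurableC
  config_measurable_bigcup.

(* the measure m^(n), extended by 0 from Gamma^(n) to Gamma_0 *)
Definition level_measure n (A : set config) : \bar R :=
  tuple_measure (leb R d) n (@config_of n @^-1` A `&` @distinct n).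

Section level_measure.
Variable n : nat.
Local Open Scope ereal_scope.

Let level_measure0 : level_measure n set0 = 0.
Proof. by rewrite /level_measure preimage_set0 set0I measure0. Qed.

Let level_measure_ge0 A : 0 <= level_measure n A.
Proof. exact: measure_ge0. Qed.

Let level_measure_sigma_additive : semi_sigma_additive (level_measure n).
Proof.
move=> F mF tF mUF; rewrite /level_measure preimage_bigcup setI_bigcupl.
apply: measure_semi_sigma_additive.
- by move=> i; exact: mF.
- apply/trivIsetP => /= i j _ _ ij; rewrite setIACA -preimage_setI.
  by move/trivIsetP : tF => /(_ _ _ _ _ ij) ->//; rewrite preimage_set0 set0I.
- by rewrite -setI_bigcupl -preimage_bigcup; exact: mUF.
Qed.

HB.instance Definition _ := isMeasure.Build _ _ _ (level_measure n)
  level_measure0 level_measure_ge0 level_measure_sigma_additive.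

End level_measure.

Definition lebesgue_poisson : {measure set config -> \bar R} :=
  mseries (fun n => mscale (n`!%:R^-1)%:nng (level_measure n)) 0.

End configurations.

Section classical_solution.
Context d (X : measurableType d) (R : realType).
Variables (mu : {measure set X -> \bar R}) (V D : set (X -> R)).
Variables (N : (X -> R) -> \bar R) (F : (X -> R) -> (X -> R)).

Definition continuous_on (I : set R) (u : R -> X -> R) : Prop :=
  forall t, I t -> N (u s \- u t) @[s --> within I (nbhs t)] --> 0%E.

Definition derivative_on (I : set R) (u v : R -> X -> R) : Prop :=
  forall t, I t ->
    N (fun x => (u (t + h) x - u t x) / h - v t x) @[h --> 0^'] --> 0%E.

(* The elements of the Banach space are represented by functions in V, modulo
   mu-a.e. equality; N is its norm and D the domain of the operator F. *)
Definition classical_solution (I : set R) (u : R -> X -> R) : Prop :=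
  [/\ forall t, I t -> D (u t),
      continuous_on I u &
      exists v : R -> X -> R,
        [/\ forall t, I° t -> V (v t),
            derivative_on I° u v,
            continuous_on I° v &
            forall t, I° t -> v t = F (u t) %[ae mu]]].

End classical_solution.

Section kinetic.
Context (R : realType) (d : nat).
Variables a phi : Rvec R d -> R.

Definition Linfty : set (Rvec R d -> R) := [set f | f \in Lfun (leb R d) +oo%E].

Definition Delta_plus : set (Rvec R d -> R) :=
  [set f | Linfty f /\ {ae leb R d, forall x, 0 <= f x}].

Definition kinetic_rhs (rho : Rvec R d -> R) (x : Rvec R d) : R :=
  conv a rho x * expR (- conv rho phi x)
  - rho x * conv a (fun y => expR (- conv rho phi y)) x.

Definition kinetic_solution (rho0 : Rvec R d -> R)
    (rho : R -> Rvec R d -> R) : Prop :=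
  classical_solution (leb R d) Linfty Linfty
    (fun f => 'N[leb R d]_+oo[EFin \o f]%E) kinetic_rhs `[0, +oo[ rho /\
  rho 0 = rho0 %[ae leb R d].

End kinetic.

Section vlasov.
Context (R : realType) (d : nat).
Local Notation LP := (lebesgue_poisson R d).

Definition config_exp (f : Rvec R d -> R) (eta : config R d) : R :=
  \prod_(x <- eta) f x.

Definition vlasov_op (a phi : Rvec R d -> R) (k : config R d -> R)
    (eta : config R d) : R :=
  \sum_(y <- eta) \int[leb R d]_x (a (vsub x y) *
    \int[LP]_xi (config_exp (fun z => - phi (vsub y z)) xi *
                 k (xi `|` (x |` (eta `\ y)))%fset))
  - \int[LP]_xi (k (xi `|` eta)%fset *
      \sum_(x <- eta) \int[leb R d]_y (a (vsub x y) *
        config_exp (fun z => - phi (vsub y z)) xi)).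

Definition nu (n : nat) (k : config R d -> R) : \bar R :=
  'N[tuple_measure (leb R d) n]_+oo[EFin \o (k \o @config_of R d n)]%E.

Definition Knorm (theta : R) (k : config R d -> R) : \bar R :=
  ereal_sup [set ((expR (theta * n%:R))%:E * nu n k)%E | n in [set: nat]].

Definition Kspace (theta : R) : set (config R d -> R) :=
  [set k | measurable_fun setT k /\ (Knorm theta k < +oo)%E].

Definition vlasov_solution_on (a phi : Rvec R d -> R) (theta : R) (I : set R)
    (r : R -> config R d -> R) : Prop :=
  classical_solution LP (Kspace theta)
    [set k | Kspace theta k /\ Kspace theta (vlasov_op a phi k)]
    (Knorm theta) (vlasov_op a phi) I r.

Definition vlasov_solution (a phi : Rvec R d -> R) (r0 : config R d -> R)
    (r : R -> config R d -> R) : Prop :=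
  (forall tau, 0 < tau ->
     exists theta, vlasov_solution_on a phi theta `[0, tau[ r) /\
  r 0 = r0 %[ae LP].

(* The bound r_t(eta) <= r_0(eta) exp(alpha |eta| t) holds on the level of the
   norms nu_n and not with the value r_0(eta) itself: for phi = 0 and a > 0 near
   the origin, mass enters the region where rho_0 = 0 immediately. *)
Definition level_bound (alpha t : R) (r0 rt : config R d -> R) : Prop :=
  {ae LP, forall eta : config R d,
    ((rt eta)%:E <= nu #|` eta| r0 * (expR (alpha * #|` eta|%:R * t))%:E)%E}.

End vlasov.

(* Main.v *)
Require Import Defs.
From HB Require Import structures.
From mathcomp Require Import all_boot all_order all_algebra finmap.
From mathcomp Require Import all_classical all_reals all_analysis.
From mathcomp Require Import measurable_realfun.
From mathcomp Require Import ess_sup_inf ring lra.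

Set Implicit Arguments.
Unset Strict Implicit.
Unset Printing Implicit Defensive.

Import Order.TTheory GRing.Theory Num.Theory.
Import numFieldNormedType.Exports.

Local Open Scope classical_set_scope.
Local Open Scope ring_scope.

Local Notation conv := (@Defs.conv _ _).

(** Product functions stay product functions along the hierarchy.  For bounded
[rho >= 0] the exponential formula
[\int e(- h, xi) lambda(d xi) = exp(- \int h)] evaluates the integrals over [xi]
in the operator, and the points of a configuration decouple:
[L_V e(rho, .) (eta) = \sum_(y in eta) kinetic_rhs rho y * e(rho, eta minus y)]
([vlasov_op_config_exp]).  The right-hand side is the product rule for the time
derivative of [e(rho_t, eta)] if [rho_t] solves the kinetic equation, so the
existence of [r_t] is reduced to that of [rho_t].

The kinetic equation is an ordinary differential equation in the space of
bounded functions, with a vector field that is Lipschitz on bounded sets only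
([kinetic_rhs_lipschitz]).  Let [c] be the essential supremum of [rho_0].  The
field is first precomposed with the truncation to the band
[0 <= u <= c exp(alpha t)], which makes it globally Lipschitz on bounded time
intervals, and [picard] gives a global solution.  At the value [0] the loss term
vanishes and the gain term is nonnegative; inside the band the gain term is at
most [alpha c exp(alpha t)], the slope of the upper edge.  Comparison with the
edges ([barrier]) therefore keeps the solution in the band, where the truncation
does nothing ([kinetic_exists]).  The upper edge is also the a priori bound on
[r_t], because the n-th level of [e(rho_0, .)] has norm [c ^ n]
([nu_config_exp_ge]).

Differentiability of [e(rho_t, .)] in the norms with weights [exp(theta n)]
costs a factor [n ^ 2] on the n-th level: a product of [n] factors bounded by
[M] has a Taylor remainder of at most [n ^ 2 * M ^ n] times the remainder of one
factor ([normr_prod_taylor]).  With [exp(theta) = 1 / (4 M)] the geometric weight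
absorbs it ([vlasov_solution_config_exp]).

Uniqueness for the hierarchy rests on the fact that the operator is unbounded
only through a factor [n]: if [|k^(n)| <= G q ^ n] for all [n], then
[|(L_V k)^(n)| <= n * 2 alpha exp(Phi q) * G q ^ n], with [Phi] the integral of
[phi] ([adjoin_bounded_vlasov_op]).  For the difference [w] of two solutions that
agree at time [s0], the ansatz [q ^ n * exp(n K (s - s0))] produces the factor
[n K] under differentiation, and for large [K] an induction on [j] gives
[|w_s^(n)| <= 2^-j * q ^ n * exp(n K (s - s0))] on a time interval of length
[1 / K] ([hierarchy_local_unique]).  Hence [w] vanishes there, and
[real_induction] carries this to all times.  The comparison of a differentiable
family with a scalar majorant in the essential supremum norm is [ess_growth]; it
gives uniqueness for the kinetic equation as well. *)

(** * Null sets of products and of powers of a measure *)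

Section ae_product.
Context d1 d2 (T1 : measurableType d1) (T2 : measurableType d2) (R : realType).
Variables (m1 : {sigma_finite_measure set T1 -> \bar R}).
Variables (m2 : {sigma_finite_measure set T2 -> \bar R}).
Local Open Scope ereal_scope.

Let indic_ge0 (N : set (T1 * T2)) z : 0 <= (\1_N z : R)%:E.
Proof. by rewrite lee_fin. Qed.

Let mindic (N : set (T1 * T2)) : measurable N ->
  measurable_fun setT (fun z => (\1_N z : R)%:E).
Proof. by move=> mN; exact/measurable_EFinP/measurable_indic. Qed.

Let null_integral d (T : measurableType d) (m : {measure set T -> \bar R})
    (f : T -> \bar R) : measurable_fun setT f -> (forall x, 0 <= f x) ->
  \int[m]_x f x = 0 -> {ae m, forall x, f x = 0}.
Proof.
move=> mf f0 If; have := (ae_eq_integral_abs m measurableT mf).1.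
under eq_integral do rewrite gee0_abs//.
by move=> /(_ If); apply: filterS => x /(_ I).
Qed.

(** Tonelli for the indicator function of a null set: the measures of the sections
have integral zero, so almost all of them vanish. *)
Lemma ae_prod1 (P : T1 * T2 -> Prop) : {ae m1 \x m2, forall z, P z} ->
  {ae m1, forall x, {ae m2, forall y, P (x, y)}}.
Proof.
move=> [N [mN N0 PN]].
have := fubini_tonelli1 (m1 := m1) (m2 := m2) _ (mindic mN) (@indic_ge0 N).
rewrite integral_indic// setIT => /esym; rewrite [X in _ = X -> _]N0.
move=> /null_integral.
have mF := measurable_fun_fubini_tonelli_F (m2 := m2) _ (mindic mN) (@indic_ge0 N).
move=> /(_ mF) /(_ (fun x => integral_ge0 _ (fun y _ => indic_ge0 N (x, y)))).
apply: filterS => x Ix.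
have mx : measurable_fun setT (fun y => (\1_N (x, y) : R)%:E).
  exact: (measurableT_comp (mindic mN)).
have := null_integral mx (fun y => indic_ge0 N (x, y)) Ix.
apply: filterS => y [] /eqP; rewrite indicE pnatr_eq0 eqb0 notin_setE => Nxy.
by apply: contrapT => Pxy; apply: Nxy; exact: PN.
Qed.

Lemma ae_prod2 (P : T1 * T2 -> Prop) : {ae m1 \x m2, forall z, P z} ->
  {ae m2, forall y, {ae m1, forall x, P (x, y)}}.
Proof.
move=> [N [mN N0 PN]].
have := fubini_tonelli2 (m1 := m1) (m2 := m2) _ (mindic mN) (@indic_ge0 N).
rewrite integral_indic// setIT => /esym; rewrite [X in _ = X -> _]N0.
move=> /null_integral.
have mF := measurable_fun_fubini_tonelli_G (m1 := m1) _ (mindic mN) (@indic_ge0 N).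
move=> /(_ mF) /(_ (fun y => integral_ge0 _ (fun x _ => indic_ge0 N (x, y)))).
apply: filterS => y Iy.
have my : measurable_fun setT (fun x => (\1_N (x, y) : R)%:E).
  exact: (measurableT_comp (mindic mN)).
have := null_integral my (fun x => indic_ge0 N (x, y)) Iy.
apply: filterS => x [] /eqP; rewrite indicE pnatr_eq0 eqb0 notin_setE => Nxy.
by apply: contrapT => Pxy; apply: Nxy; exact: PN.
Qed.

Lemma null_prod1 (N : set (T1 * T2)) : measurable N ->
  {ae m1, forall x, {ae m2, forall y, ~ N (x, y)}} -> (m1 \x m2) N = 0.
Proof.
move=> mN Nae; rewrite -[N]setIT -integral_indic//.
rewrite (fubini_tonelli1 _ (mindic mN) (@indic_ge0 N)).
have mF := measurable_fun_fubini_tonelli_F (m2 := m2) _ (mindic mN) (@indic_ge0 N).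
rewrite (ae_eq_integral (cst 0)) ?integral0//.
apply: filterS Nae => x Nx _; rewrite /fubini_F (ae_eq_integral (cst 0)) ?integral0//.
  exact: (measurableT_comp (mindic mN)).
by apply: filterS Nx => y Nxy _; rewrite indicE memNset.
Qed.

Lemma null_prod2 (N : set (T1 * T2)) : measurable N ->
  {ae m2, forall y, {ae m1, forall x, ~ N (x, y)}} -> (m1 \x m2) N = 0.
Proof.
move=> mN Nae; rewrite -[N]setIT -integral_indic//.
rewrite (fubini_tonelli2 _ (mindic mN) (@indic_ge0 N)).
have mF := measurable_fun_fubini_tonelli_G (m1 := m1) _ (mindic mN) (@indic_ge0 N).
rewrite (ae_eq_integral (cst 0)) ?integral0//.
apply: filterS Nae => y Ny _; rewrite /fubini_G (ae_eq_integral (cst 0)) ?integral0//.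
  exact: (measurableT_comp (mindic mN)).
by apply: filterS Ny => x Nxy _; rewrite indicE memNset.
Qed.

End ae_product.

Section tuple_measure_theory.
Context d (T : measurableType d) (R : realType).
Variable mu : {sigma_finite_measure set T -> \bar R}.
Local Open Scope ereal_scope.
Local Notation mun n := (tuple_measure mu n).

Lemma tuple_measure_pushforward n (F : n.+1.-tuple T -> \bar R) :
  measurable_fun setT F -> (forall t, 0 <= F t) ->
  \int[mun n.+1]_t F t = \int[mu \x mun n]_p F (tcons p).
Proof.
move=> mF F0.
rewrite -(ge0_integral_pushforward (@measurable_tcons _ T n) _ measurableT mF)//.
Qed.

Lemma measurable_fun_tcons n d' (X : measurableType d') (f : X -> T)
    (g : X -> n.-tuple T) : measurable_fun setT f -> measurable_fun setT g ->
  measurable_fun setT (fun x => tcons (f x, g x)).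
Proof.
move=> mf mg; apply: (measurableT_comp (@measurable_tcons _ T n)).
exact: measurable_fun_pair.
Qed.

Lemma ge0_integral_tcons1 n (F : n.+1.-tuple T -> \bar R) :
  measurable_fun setT F -> (forall t, 0 <= F t) ->
  \int[mun n.+1]_t F t = \int[mu]_x \int[mun n]_s F (tcons (x, s)).
Proof.
move=> mF F0; rewrite tuple_measure_pushforward// fubini_tonelli1//.
exact: (measurableT_comp mF (@measurable_tcons _ T n)).
Qed.

Let ae_tcons n (P : n.+1.-tuple T -> Prop) : {ae mun n.+1, forall t, P t} ->
  {ae mu \x mun n, forall p, P (tcons p)}.
Proof.
move=> [N [mN N0 PN]]; exists (@tcons _ T n @^-1` N); split => //.
  by rewrite -[X in measurable X]setTI; exact: measurable_tcons.
by move=> p /= Pp; exact: PN.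
Qed.

Lemma ae_tcons1 n (P : n.+1.-tuple T -> Prop) : {ae mun n.+1, forall t, P t} ->
  {ae mu, forall x, {ae mun n, forall s, P (tcons (x, s))}}.
Proof. by move=> /ae_tcons/ae_prod1. Qed.

Lemma ae_tcons2 n (P : n.+1.-tuple T -> Prop) : {ae mun n.+1, forall t, P t} ->
  {ae mun n, forall s, {ae mu, forall x, P (tcons (x, s))}}.
Proof. by move=> /ae_tcons/ae_prod2. Qed.

Lemma null_tcons1 n (N : set (n.+1.-tuple T)) : measurable N ->
  {ae mu, forall x, {ae mun n, forall s, ~ N (tcons (x, s))}} ->
  mun n.+1 N = 0.
Proof.
move=> mN Nae; apply: (null_prod1 (N := @tcons _ T n @^-1` N)) => //.
by rewrite -[X in measurable X]setTI; exact: measurable_tcons.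
Qed.

Lemma null_tcons2 n (N : set (n.+1.-tuple T)) : measurable N ->
  {ae mun n, forall s, {ae mu, forall x, ~ N (tcons (x, s))}} ->
  mun n.+1 N = 0.
Proof.
move=> mN Nae; apply: (null_prod2 (N := @tcons _ T n @^-1` N)) => //.
by rewrite -[X in measurable X]setTI; exact: measurable_tcons.
Qed.

End tuple_measure_theory.

Section tuple_measure_null.
Context d (T : measurableType d) (R : realType).
Variable mu : {sigma_finite_measure set T -> \bar R}.
Local Open Scope ereal_scope.
Local Notation mun n := (tuple_measure mu n).

Lemma tcons_surj n (t : n.+1.-tuple T) : exists x s, t = tcons (x, s).
Proof.
by exists (thead t), [tuple of behead t]; rewrite [LHS]tuple_eta; exact: val_inj.
Qed.

Lemma tuple0_eq (s : 0.-tuple T) : s = [tuple].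
Proof. by apply: val_inj; case: s => -[]. Qed.

Definition tdel n (i : 'I_n.+1) (t : n.+1.-tuple T) : n.-tuple T :=
  [tuple tnth t (lift i j) | j < n].

Lemma measurable_tdel n (i : 'I_n.+1) : measurable_fun setT (tdel i).
Proof.
apply/measurable_fun_tnthP => j /=.
rewrite (_ : _ \o _ = (@tnth _ T)^~ (lift i j)); first exact: measurable_tnth.
by apply/funext => t /=; rewrite tnth_mktuple.
Qed.

Lemma tdel_ord0 n (x : T) (s : n.-tuple T) : tdel ord0 (tcons (x, s)) = s.
Proof.
by apply: eq_from_tnth => j; rewrite tnth_mktuple tnthS.
Qed.

Lemma tdel_lift n (i : 'I_n.+1) (x : T) (s : n.+1.-tuple T) :
  tdel (lift ord0 i) (tcons (x, s)) = tcons (x, tdel i s).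
Proof.
apply: eq_from_tnth => j; rewrite tnth_mktuple.
have [->|j0] := eqVneq j ord0.
  by rewrite (_ : lift (lift ord0 i) (ord0 : 'I_n.+1) = ord0 :> 'I_n.+2)//; exact: val_inj.
case: (unliftP ord0 j) => [k ->|]; last by move/eqP; rewrite (negbTE j0).
rewrite (_ : lift (lift ord0 i) (lift ord0 k) = lift ord0 (lift i k)).
  by rewrite !tnthS /= tnth_mktuple.
by apply: val_inj; rewrite /= /bump !add1n ltnS addnS.
Qed.

(** Coordinates are peeled off from the front until the deleted one comes first;
the preimage is then a cylinder over a null set. *)
Lemma null_tdel n (i : 'I_n.+1) (N : set (n.-tuple T)) : measurable N ->
  mun n N = 0 -> mun n.+1 (tdel i @^-1` N) = 0.
Proof.
have mdel m (j : 'I_m.+1) M : measurable M -> measurable (tdel j @^-1` M).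
  by move=> mM; rewrite -[X in measurable X]setTI; exact: measurable_tdel.
elim: n => [|n IH] in i N *; move=> mN N0.
  apply: null_tcons1; first exact: mdel.
  apply: aeW => x; exists N; split => // s /=.
  by rewrite (ord1 i) tdel_ord0 => /contrapT.
case: (unliftP ord0 i) => [j ->|->]; last first.
  apply: null_tcons1; first exact: mdel.
  apply: aeW => x; exists N; split => // s /=.
  by rewrite tdel_ord0 => /contrapT.
apply: null_tcons1; first exact: mdel.
have /ae_tcons1 : {ae mun n.+1, forall t, ~ N t}.
  by exists N; split => // t /= /contrapT.
apply: filterS => x [M [mM M0 NM]].
exists (tdel j @^-1` M); split; [exact: mdel|exact: IH|].
by move=> s /= /contrapT; rewrite tdel_lift => Ns; apply: NM => /=; exact.
Qed.

Lemma ae_tdel n (i : 'I_n.+1) (P : n.-tuple T -> Prop) :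
  {ae mun n, forall s, P s} -> {ae mun n.+1, forall t, P (tdel i t)}.
Proof.
move=> [N [mN N0 PN]]; exists (tdel i @^-1` N); split.
- by rewrite -[X in measurable X]setTI; exact: measurable_tdel.
- exact: null_tdel.
- by move=> t /= Pt; exact: PN.
Qed.

Definition tcat m n (s : m.-tuple T) (t : n.-tuple T) : (m + n).-tuple T :=
  [tuple of s ++ t].

Lemma tcat_tcons m n (x : T) (s : m.-tuple T) (t : n.-tuple T) :
  tcat (tcons (x, s)) t = tcons (x, tcat s t).
Proof. exact: val_inj. Qed.

Lemma measurable_fun_tcat m n d' (X : measurableType d') (f : X -> m.-tuple T)
    (g : X -> n.-tuple T) : measurable_fun setT f -> measurable_fun setT g ->
  measurable_fun setT (fun x => tcat (f x) (g x)).
Proof.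
elim: m => [|m IH] in f *; move=> mf mg.
  rewrite (_ : (fun x => _) = g)//.
  by apply/funext => x; rewrite (tuple0_eq (f x)); exact: val_inj.
rewrite (_ : (fun x => _) = (fun x => tcons (tnth (f x) ord0,
    tcat [tuple of behead (f x)] (g x)))).
  apply: measurable_fun_tcons.
    exact: (measurableT_comp (@measurable_tnth _ T _ ord0) mf).
  apply: IH => //.
  exact: (measurableT_comp (@measurable_behead _ T _) mf).
apply/funext => x; case: (tcons_surj (f x)) => y [s ->].
rewrite tcat_tcons; congr tcons; congr (_, tcat _ _); exact: val_inj.
Qed.

(** The tail [t] is fixed first because the operator integrates over the added
points for a given configuration. *)
Lemma ae_tcat m n (P : (m + n).-tuple T -> Prop) :
  {ae mun (m + n), forall u, P u} ->
  {ae mun n, forall t, {ae mun m, forall s, P (tcat s t)}}.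
Proof.
elim: m => [|m IH] in P *.
  apply: filterS => t Pt; exists set0; split => //.
  move=> s /=; apply: contra_notP => _; rewrite (tuple0_eq s).
  by rewrite (_ : tcat _ _ = t)//; exact: val_inj.
move=> [N [mN N0 PN]].
have /ae_tcons2/IH : {ae mun (m + n).+1, forall u, ~ N u}.
  by exists N; split => // u /= /contrapT.
apply: filterS => t Nt.
pose M : set (m.+1.-tuple T) := (fun s => tcat s t) @^-1` N.
have mM : measurable M.
  rewrite -[X in measurable X]setTI.
  by apply: (measurable_fun_tcat (f := id) (g := cst t)).
exists M; split => //; last by move=> s /= Ps; exact: PN.
apply: null_tcons2 => //; apply: filterS Nt => s.
by apply: filterS => x; rewrite /M /= tcat_tcons.
Qed.

Lemma ae_all_tuple n (P : T -> Prop) : {ae mu, forall x, P x} ->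
  {ae mun n, forall t, forall i, P (tnth t i)}.
Proof.
move=> [N [mN N0 PN]].
suff : {ae mun n, forall t, forall i, ~ N (tnth t i)}.
  by apply: filterS => t Nt i; apply: contrapT => /PN; exact: Nt.
elim: n => [|n IH]; first by apply: aeW => t [].
pose M : set (n.+1.-tuple T) := \bigcup_(i in [set: 'I_n.+1]) (@tnth _ T)^~ i @^-1` N.
have mM : measurable M.
  apply: fin_bigcup_measurable; first exact: finite_finset.
  by move=> i _; rewrite -[X in measurable X]setTI; exact: measurable_tnth.
exists M; split => //; last first.
  by move=> t /= /existsNP[i /contrapT Ni]; exists i.
apply: null_tcons2 => //; apply: filterS IH => s Ns.
exists N; split => // x /= /contrapT[i _] /=.
case: (unliftP ord0 i) => [j ->|->//].
by rewrite tnthS => /Ns.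
Qed.

(** A product measure is invariant under coordinatewise maps that preserve the
factors. *)
Lemma ge0_integral_tmap n (tau : 'I_n -> T -> T) (F : n.-tuple T -> \bar R) :
  (forall i, measurable_fun setT (tau i)) ->
  (forall i f, measurable_fun setT f -> (forall x, 0 <= f x) ->
    \int[mu]_x f (tau i x) = \int[mu]_x f x) ->
  measurable_fun setT F -> (forall t, 0 <= F t) ->
  \int[mun n]_t F [tuple tau i (tnth t i) | i < n] = \int[mun n]_t F t.
Proof.
have mtmap k (sg : 'I_k -> T -> T) : (forall i, measurable_fun setT (sg i)) ->
    measurable_fun setT (fun t : k.-tuple T => [tuple sg i (tnth t i) | i < k]).
  move=> msg; apply/measurable_fun_tnthP => j /=.
  rewrite (_ : _ \o _ = sg j \o (@tnth _ T)^~ j).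
    by apply: measurableT_comp => //; exact: measurable_tnth.
  by apply/funext => t /=; rewrite tnth_mktuple.
elim: n => [|n IH] in tau F *; move=> mtau tauE mF F0.
  by apply: eq_integral => t _; congr F; apply: eq_from_tnth => -[].
rewrite !ge0_integral_tcons1//; last exact: (measurableT_comp mF (mtmap _ _ mtau)).
under eq_integral => x _.
  under eq_integral => s _.
    rewrite (_ : [tuple _ | _ < _] = tcons (tau ord0 x,
      [tuple tau (lift ord0 i) (tnth s i) | i < n])); last first.
      apply: eq_from_tnth => i; rewrite tnth_mktuple.
      by case: (unliftP ord0 i) => [j ->|->//]; rewrite !tnthS tnth_mktuple.
    over.
  rewrite (IH (fun i => tau (lift ord0 i)) (fun s => F (tcons (tau ord0 x, s))))//; last first.
    by apply: (measurableT_comp mF); exact: measurable_fun_tcons.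
  by move=> i f; exact: tauE.
  over.
rewrite (tauE ord0 (fun x => \int[mun n]_s F (tcons (x, s))))//.
  apply: (measurable_fun_fubini_tonelli_F (fun p => F (tcons p))) => //.
  exact: (measurableT_comp mF (@measurable_tcons _ T n)).
by move=> x; exact: integral_ge0.
Qed.

End tuple_measure_null.

(** * Reflections preserve Lebesgue measure *)

Section lebesgue_invariance.
Context (R : realType).
Local Open Scope ereal_scope.
Local Notation mR := (measurableTypeR R).
Local Notation lam := (@lebesgue_measure R).

(** Lebesgue measure is determined by its values on half-open intervals. *)
Let lebesgue_transfer (tau : mR -> mR) : measurable_fun setT tau ->
  (forall a b : R, (a < b)%R -> lam (tau @^-1` `]a, b]%classic) = (b - a)%:E) ->
  forall f, measurable_fun setT f -> (forall x, 0 <= f x) ->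
    \int[lam]_x f (tau x) = \int[lam]_x f x.
Proof.
move=> mtau tauE f mf f0.
pose tau' : {mfun mR >-> mR} := HB.pack tau (isMeasurableFun.Build _ _ _ _ _ mtau).
rewrite -(ge0_integral_pushforward mtau lam measurableT mf)//.
apply: eq_measure_integral => A mA _ /=; symmetry.
apply: (lebesgue_measure_unique (mu := pushforward lam tau')) => // X [[a b] _ <-].
rewrite /= /pushforward lebesgue_measure_itv /= lte_fin.
have [ab|ba] := ltP a b; first by rewrite [RHS]tauE.
by rewrite set_itv_ge ?preimage_set0 ?measure0// -leNgt bnd_simp.
Qed.

Lemma lebesgue_subl (c : R) (f : mR -> \bar R) : measurable_fun setT f ->
  (forall x, 0 <= f x) -> \int[lam]_x f (c - x)%R = \int[lam]_x f x.
Proof.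
apply: (lebesgue_transfer (tau := fun x => (c - x)%R)).
  by apply: measurable_funB.
move=> a b ab; rewrite (_ : _ @^-1` _ = `[c - b, c - a[%classic)%R.
  rewrite lebesgue_measure_itv /= lte_fin ltrD2l ltrN2 ab -EFinD; congr EFin; ring.
apply/seteqP; split => x /=; rewrite !in_itv /= => /andP[h1 h2]; apply/andP; split; lra.
Qed.

Section leb.
Variable d : nat.
Local Notation leb := (leb R d).

Lemma leb_vsubl (x : Rvec R d) (F : Rvec R d -> \bar R) :
  measurable_fun setT F -> (forall t, 0 <= F t) ->
  \int[leb]_y F (vsub x y) = \int[leb]_y F y.
Proof.
move=> mF F0; apply: (ge0_integral_tmap (mu := lam) (F := F)
  (tau := fun (i : 'I_d) (u : mR) => (tnth x i - u)%R : mR)) => //.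
  by move=> i; apply: measurable_funB.
by move=> i f mf f0; exact: lebesgue_subl.
Qed.

Lemma measurable_fun_vsub d' (X : measurableType d') (f g : X -> Rvec R d) :
  measurable_fun setT f -> measurable_fun setT g ->
  measurable_fun setT (fun z => vsub (f z) (g z)).
Proof.
move=> mf mg; apply/measurable_fun_tnthP => i /=.
rewrite (_ : _ \o _ = fun z => (tnth (f z) i - tnth (g z) i : R)%R).
  apply: measurable_funB.
    exact: (measurableT_comp (@measurable_tnth _ _ _ i) mf).
  exact: (measurableT_comp (@measurable_tnth _ _ _ i) mg).
by apply/funext => z /=; rewrite tnth_mktuple.
Qed.

Lemma vsub_vsub (x y : Rvec R d) : vsub x (vsub x y) = y.
Proof.
by apply: eq_from_tnth => i; rewrite !tnth_mktuple opprB addrC subrK.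
Qed.

Lemma vopp_vsub (x y : Rvec R d) : vopp (vsub x y) = vsub y x.
Proof. by apply: eq_from_tnth => i; rewrite !tnth_mktuple opprB. Qed.

(** For [d = 0] the space is a single point of mass [1]: it is here that the
dimension must be positive. *)
Lemma leb_set1 (x : Rvec R d) : (0 < d)%N ->
  measurable [set x] /\ leb [set x] = 0.
Proof.
move=> d0.
have mx : measurable [set x].
  rewrite (_ : [set x] = \bigcap_(i in [set: 'I_d]) (@tnth _ mR)^~ i @^-1` [set tnth x i]).
    apply: fin_bigcap_measurable => [|i _]; first exact: finite_finset.
    by rewrite -[X in measurable X]setTI; exact: measurable_tnth.
  apply/seteqP; split => [y -> i//|y /= yx].
  by apply: eq_from_tnth => i; exact: yx.
split => //; rewrite /Defs.leb.
case: d => [//|n] in x mx d0 *.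
apply: null_tcons2 => //; apply: aeW => s.
exists [set tnth x ord0]; split => //; first exact: lebesgue_measure_set1.
by move=> y /= /contrapT <-.
Qed.

End leb.
End lebesgue_invariance.

(** * Configurations as tuples of distinct points *)

Section configurations_measure.
Context (R : realType) (d : nat).
Hypothesis d_gt0 : (0 < d)%N.
Local Notation mun n := (tuple_measure (leb R d) n).
Local Notation LP := (lebesgue_poisson R d).

(** On the diagonals, which are null, points of the tuple coincide and
[config_of] drops below level [n]; a constant value there makes measurability
immediate from the definition of the sigma-algebra. *)
Definition cfg n (t : n.-tuple (Rvec R d)) : config R d :=
  if uniq t then config_of t else fset0.

Lemma mem_config_of n (t : n.-tuple (Rvec R d)) x : (x \in config_of t) = (x \in tval t).
Proof. by rewrite in_fset. Qed.

Lemma cfgE n (t : n.-tuple (Rvec R d)) : uniq t -> cfg t = config_of t.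
Proof. by rewrite /cfg => ->. Qed.

Lemma uniq_tcons n (x : Rvec R d) (s : n.-tuple (Rvec R d)) :
  uniq (tcons (x, s)) = (x \notin tval s) && uniq s.
Proof. by []. Qed.

Lemma cfg_tcons n (x : Rvec R d) (s : n.-tuple (Rvec R d)) :
  uniq (tcons (x, s)) -> cfg (tcons (x, s)) = (x |` cfg s)%fset.
Proof.
move=> /[dup] us; rewrite uniq_tcons => /andP[xs us'].
rewrite !cfgE//; apply/fsetP => y.
by rewrite in_fset1U !mem_config_of inE.
Qed.

Lemma measurable_uniq n :
  measurable_fun setT (fun t : n.-tuple (Rvec R d) => uniq t : bool).
Proof.
apply: (measurable_fun_bool true); rewrite setTI.
rewrite (_ : _ @^-1` _ = @distinct R d n); first exact: measurable_distinct.
by apply/seteqP; split => t.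
Qed.

Lemma measurable_cfg n : measurable_fun setT (@cfg n).
Proof.
move=> _ A mA; rewrite setTI.
rewrite (_ : _ @^-1` _ = (@config_of R d n @^-1` A `&` @distinct R d n) `|`
    ((cst (fset0 : config R d) @^-1` A) `&` ~` @distinct R d n)); last first.
  apply/seteqP; split => t; rewrite /preimage /distinct /cfg /=.
    by case: (uniq t) => h; [left|right].
  by case: (uniq t) => -[] [].
apply: measurableU; first exact: (mA n).
apply: measurableI; last by apply: measurableC; exact: measurable_distinct.
have [h|h] := pselect (A fset0); first by rewrite (_ : _ @^-1` _ = setT)//;
  apply/seteqP; split.
by rewrite (_ : _ @^-1` _ = set0)//; apply/seteqP; split => t.
Qed.

Lemma measurable_config_fun d' (Y : measurableType d') (f : config R d -> Y) :
  (forall n, measurable_fun setT (fun t : n.-tuple (Rvec R d) => f (cfg t))) ->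
  measurable_fun setT f.
Proof.
move=> mf _ B mB; rewrite setTI.
suff : config_measurable (f @^-1` B) by [].
move=> n.
rewrite (_ : _ `&` _ = ((fun t : n.-tuple _ => f (cfg t)) @^-1` B) `&` @distinct R d n).
  apply: measurableI; last exact: measurable_distinct.
  by rewrite -[X in measurable X]setTI; exact: mf.
apply/seteqP; split => t [] /= ft ut; split => //.
  by rewrite cfgE.
by rewrite -cfgE.
Qed.

Lemma ae_notin n (s : n.-tuple (Rvec R d)) :
  {ae leb R d, forall x, x \notin tval s}.
Proof.
have : {ae leb R d, forall x, forall k : nat,
    (fun k y => y <> nth y (in_tuple (tval s)) k \/ (n <= k)%N) k x}.
  apply: ae_foralln => k.
  have [nk|kn] := leqP n k; first by apply: aeW => x; right.
  have [m0 l0] := leb_set1 (tnth s (Ordinal kn)) d_gt0.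
  exists [set tnth s (Ordinal kn)]; split => // x /=.
  move=> /not_orP[/contrapT -> _] /=.
  by rewrite (tnth_nth x).
apply: filterS => x xs; apply/negP => /(nthP x)[k]; rewrite size_tuple => kn xk.
by have [|] := xs k; [rewrite /= xk|rewrite leqNgt kn].
Qed.

(** A further point almost surely avoids the finitely many earlier ones. *)
Lemma ae_uniq n : {ae mun n, forall t : n.-tuple (Rvec R d), uniq t}.
Proof.
elim: n => [|n IH]; first by apply: aeW => t; rewrite (tuple0_eq t).
exists (~` @distinct R d n.+1); split => //.
  by apply: measurableC; exact: measurable_distinct.
apply: null_tcons2; first by apply: measurableC; exact: measurable_distinct.
apply: filterS IH => s us; apply: filterS (ae_notin s) => x xs.
by apply; rewrite /distinct /mkset uniq_tcons xs us.
Qed.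

(** Each level of the Lebesgue-Poisson measure is thus an image measure, so that
its integrals become integrals over tuples. *)
Lemma level_measureE n (A : set (config R d)) : measurable A ->
  level_measure n A = mun n (@cfg n @^-1` A).
Proof.
move=> mA; have mB : measurable (@cfg n @^-1` A).
  by rewrite -[X in measurable X]setTI; exact: measurable_cfg.
rewrite /level_measure (_ : _ `&` _ = @cfg n @^-1` A `&` @distinct R d n); last first.
  apply/seteqP; split => t [] /= ft ut; split => //.
    by rewrite cfgE.
  by rewrite -cfgE.
have mD := @measurable_distinct R d n.
rewrite -[X in _ = mun n X](setDUK (@subIsetl _ (@cfg n @^-1` A) (@distinct R d n))).
rewrite measureU//; [|exact: measurableI|apply: measurableD => //; exact: measurableI|].
  rewrite [X in (_ + X)%E](_ : _ = 0%E) ?adde0//.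
  have [N [mN N0 uN]] := ae_uniq n.
  apply: (subset_measure0 _ mN _ N0); first by apply: measurableD => //; exact: measurableI.
  by move=> t [At] /= nAt; apply: uN => /= ut; apply: nAt.
by apply/seteqP; split => t // [] h [].
Qed.

Lemma ge0_integral_LP (f : config R d -> \bar R) : measurable_fun setT f ->
  (forall eta, 0 <= f eta)%E ->
  (\int[LP]_eta f eta =
    \sum_(0 <= n <oo) (n`!%:R^-1)%:E * \int[mun n]_t f (cfg t))%E.
Proof.
move=> mf f0; rewrite /lebesgue_poisson ge0_integral_measure_series//.
apply: eq_eseriesr => n _; rewrite ge0_integral_mscale//=; congr (_ * _)%E.
rewrite -(ge0_integral_pushforward (@measurable_cfg n) _ measurableT mf)//.
apply: eq_measure_integral => [|mc A mA _]; first exact: measurable_cfg.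
exact: level_measureE.
Qed.

Lemma LP_eq0 (A : set (config R d)) : measurable A ->
  LP A = 0%E <-> forall n, mun n (@cfg n @^-1` A) = 0%E.
Proof.
move=> mA.
have lvlE n : mscale (n`!%:R^-1)%:nng (level_measure n) A =
    ((n`!%:R^-1)%:E * mun n (@cfg n @^-1` A))%E by rewrite -level_measureE.
rewrite /lebesgue_poisson /= /mseries; split => [A0 n|A0]; last first.
  by rewrite eseries0// => n _ _; rewrite [LHS]lvlE A0 mule0.
apply/eqP; rewrite eq_le measure_ge0 andbT.
have : ((n`!%:R^-1)%:E * mun n (@cfg n @^-1` A) <= 0)%E.
  rewrite -A0 (le_trans _ (nneseries_lim_ge (n.+1) _))//.
  by rewrite big_mkord big_ord_recr /= [X in (_ + X)%E]lvlE leeDr// sume_ge0.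
by rewrite pmule_rle0// lte_fin invr_gt0 ltr0n fact_gt0.
Qed.

Lemma ae_LP (P : config R d -> Prop) : {ae LP, forall eta, P eta} ->
  forall n, {ae mun n, forall t, P (cfg t)}.
Proof.
move=> [A [mA A0 PA]] n; exists (@cfg n @^-1` A); split => //.
- by rewrite -[X in measurable X]setTI; exact: measurable_cfg.
- exact: (LP_eq0 mA).1.
- by move=> t /= Pt; apply: PA.
Qed.

Lemma LP_ae (P : config R d -> Prop) : measurable [set eta | P eta] ->
  (forall n, {ae mun n, forall t, P (cfg t)}) -> {ae LP, forall eta, P eta}.
Proof.
move=> mP Pt; exists (~` [set eta | P eta]); split => //; first exact: measurableC.
apply/LP_eq0; first exact: measurableC.
move=> n; have [N [mN N0 PN]] := Pt n.
apply: (subset_measure0 _ mN _ N0) => //.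
by rewrite -[X in measurable X]setTI; apply: measurable_cfg => //; exact: measurableC.
Qed.

Lemma LP_ae_eq (f g : config R d -> R) : measurable_fun setT f ->
  measurable_fun setT g -> (forall n, {ae mun n, forall t, f (cfg t) = g (cfg t)}) ->
  f = g %[ae LP].
Proof.
move=> mf mg fg; suff : {ae LP, forall eta, f eta = g eta}.
  by move=> [N [mN N0 sN]]; exists N; split => // eta /= h; apply: sN => /= e; apply: h.
apply: LP_ae => //.
have m : measurable_fun setT (fun eta => f eta - g eta) by exact: measurable_funB.
rewrite (_ : [set _ | _] = (fun eta => f eta - g eta) @^-1` [set 0]).
  by rewrite -[X in measurable X]setTI; exact: m.
apply/seteqP; split => eta /=; first by move=> ->; rewrite subrr.
by move=> /eqP; rewrite subr_eq0 => /eqP.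
Qed.

Lemma perm_config_of n (t : n.-tuple (Rvec R d)) : uniq t ->
  perm_eq (enum_fset (config_of t)) t.
Proof.
by move=> ut; apply: uniq_perm => // x; exact: mem_config_of.
Qed.

Lemma card_cfg n (t : n.-tuple (Rvec R d)) : uniq t -> #|` cfg t| = n.
Proof. by move=> ut; rewrite cfgE// (perm_size (perm_config_of ut)) size_tuple. Qed.

Lemma config_exp_config_of f n (t : n.-tuple (Rvec R d)) : uniq t ->
  config_exp f (config_of t) = \prod_(i < n) f (tnth t i).
Proof.
by move=> ut; rewrite /config_exp (perm_big _ (perm_config_of ut))/= big_tuple.
Qed.

Lemma config_exp_cfg f n (t : n.-tuple (Rvec R d)) : uniq t ->
  config_exp f (cfg t) = \prod_(i < n) f (tnth t i).
Proof. by move=> ut; rewrite cfgE// config_exp_config_of. Qed.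

Lemma config_exp0 f : config_exp f (fset0 : config R d) = 1.
Proof. by rewrite /config_exp big_seq_fset0. Qed.

Lemma config_exp1U f x (eta : config R d) : x \notin eta ->
  config_exp f (x |` eta)%fset = f x * config_exp f eta.
Proof.
move=> xeta; rewrite /config_exp.
rewrite (perm_big (x :: enum_fset eta)) ?big_cons//.
apply: uniq_perm; rewrite ?fset_uniq//=; first by rewrite xeta fset_uniq.
by move=> y; rewrite in_fset1U inE.
Qed.

Lemma config_expU f (xi eta : config R d) : (forall x, x \in xi -> x \notin eta) ->
  config_exp f (xi `|` eta)%fset = config_exp f xi * config_exp f eta.
Proof.
move=> dis; rewrite /config_exp.
rewrite (perm_big (enum_fset xi ++ enum_fset eta)) ?big_cat//.
apply: uniq_perm; rewrite ?fset_uniq// ?cat_uniq ?fset_uniq ?andbT//=.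
  by apply/hasPn => x /= xe; apply/negP => /dis; rewrite xe.
by move=> y; rewrite in_fsetU mem_cat.
Qed.

Lemma measurable_fun_prod_tnth d' (X : measurableType d') n
    (f : X -> Rvec R d -> R) (t : X -> n.-tuple (Rvec R d)) :
  (forall i, measurable_fun setT (fun x => f x (tnth (t x) i))) ->
  measurable_fun setT (fun x => \prod_(i < n) f x (tnth (t x) i)).
Proof. by move=> mf; apply: measurable_prod => i _; exact: mf. Qed.

Lemma measurable_fun_config_exp (f : Rvec R d -> R) : measurable_fun setT f ->
  measurable_fun setT (config_exp f).
Proof.
move=> mf; apply: measurable_config_fun => n.
rewrite (_ : (fun t => _) =
  (fun t : n.-tuple _ => if uniq t then \prod_(i < n) f (tnth t i) else 1)).
  apply: measurable_fun_ifT => //; first exact: measurable_uniq.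
  apply: (measurable_fun_prod_tnth (f := fun=> f) (t := id)) => i.
  exact: (measurableT_comp mf (@measurable_tnth _ _ _ i)).
apply/funext => t; case: ifP => ut; first exact: config_exp_cfg.
by rewrite /cfg ut config_exp0.
Qed.

(** If [x] already occurs in [s], the union has one point less, so no single tuple
map represents it; the coincidence sets are treated separately. *)
Lemma measurable_fun_fset1U d' (X : measurableType d') d'' (Y : measurableType d'')
    n (k : config R d -> Y) (x : X -> Rvec R d) (s : X -> n.-tuple (Rvec R d)) :
  measurable_fun setT k -> measurable_fun setT x -> measurable_fun setT s ->
  measurable_fun setT (fun p => k (x p |` cfg (s p))%fset).
Proof.
move=> mk mx ms.
pose s1 p := tcons (x p, s p); pose s0 p := tcons (x p, [tuple]).
have ms1 : measurable_fun setT s1 by exact: measurable_fun_tcons.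
have ms0 : measurable_fun setT s0 by exact: measurable_fun_tcons.
have mkc m (u : X -> m.-tuple (Rvec R d)) : measurable_fun setT u ->
    measurable_fun setT (fun p => k (cfg (u p))).
  by move=> mu; exact: (measurableT_comp mk (measurableT_comp (@measurable_cfg m) mu)).
rewrite (_ : (fun p => _) = (fun p => if uniq (s1 p) then k (cfg (s1 p)) else
    if uniq (s p) then k (cfg (s p)) else k (cfg (s0 p)))).
  apply: measurable_fun_ifT; [|exact: mkc|].
    exact: (measurableT_comp (@measurable_uniq _) ms1).
  apply: measurable_fun_ifT; [|exact: mkc|exact: mkc].
  exact: (measurableT_comp (@measurable_uniq _) ms).
apply/funext => p; case: ifPn => [u1|]; first by rewrite cfg_tcons.
rewrite uniq_tcons negb_and negbK; case: ifPn => [us|us _].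
  rewrite orbF => xs; congr k; apply/fsetP => y; rewrite in_fset1U.
  case: eqVneq => [->|//]; by rewrite cfgE// mem_config_of xs.
rewrite /s0 cfg_tcons//; congr k; congr (_ |` _)%fset.
by rewrite /cfg (negbTE us) /=; apply/fsetP => y; rewrite mem_config_of.
Qed.

Lemma measurable_fun_fsetUr d'' (Y : measurableType d'') (k : config R d -> Y)
    (zeta : config R d) : measurable_fun setT k ->
  measurable_fun setT (fun xi : config R d => k (xi `|` zeta)%fset).
Proof.
elim/finSet_rect: zeta => zeta IH in k *; move=> mk.
(* The points of [zeta] are added one at a time. *)
have [->|[x xz]] := fset_0Vmem zeta.
  by rewrite (_ : (fun _ => _) = k)//; apply/funext => xi; rewrite fsetU0.
rewrite (_ : (fun _ => _) = (fun xi : config R d => (fun xi : config R d => k (x |` xi)%fset) (xi `|` (zeta `\ x))%fset)).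
  apply: (IH _ _ (fun xi : config R d => k (x |` xi)%fset)); first by rewrite fproperD1.
  apply: measurable_config_fun => n.
  by apply: (measurable_fun_fset1U (x := cst x) (s := id)).
by apply/funext => xi /=; rewrite fsetUCA fsetD1K.
Qed.

(** The event is measurable because it is the level set [1] of the product
function of the indicator of the complement of [zeta]. *)
Lemma ae_LP_disjoint (zeta : config R d) :
  {ae LP, forall xi, forall x, x \in xi -> x \notin zeta}.
Proof.
have mz : measurable_fun setT (config_exp (fun x => (x \notin zeta)%:R : R)).
  apply: measurable_fun_config_exp.
  apply: (@measurableT_comp _ _ _ _ _ _ (fun b : bool => b%:R : R)) => //.
  apply: (measurable_fun_bool true); rewrite setTI.
  rewrite (_ : _ @^-1` _ = \bigcap_(y in [set y | y \in zeta]) ~` [set y]).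
    apply: fin_bigcap_measurable; first exact: finite_seq.
    by move=> y _; apply: measurableC; exact: (leb_set1 y d_gt0).1.
  apply/seteqP; split => x /=.
    by move=> xz y /= yz xy; move: xz; rewrite xy yz.
  by move=> xz; apply/negP => /xz; exact.
have zP (xi : config R d) : (forall x, x \in xi -> x \notin zeta) <->
    config_exp (fun x => (x \notin zeta)%:R : R) xi = 1.
  rewrite /config_exp big_seq; split => [h|].
    by rewrite big1// => x /h ->.
  move=> + x xxi; apply: contra_eqN => xz.
  by rewrite -big_seq (big_rem x)//= xz mul0r eq_sym oner_neq0.
apply: LP_ae.
  rewrite (_ : [set xi | _] = config_exp (fun x => (x \notin zeta)%:R : R) @^-1` [set 1]).
    by rewrite -[X in measurable X]setTI; exact: mz.
  by apply/seteqP; split => xi /zP.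
move=> n; have := ae_all_tuple n (ae_notin (in_tuple (enum_fset zeta))).
apply: filterS => t tz x; rewrite /cfg; case: ifP => // ut; rewrite mem_config_of.
by move=> /tnthP[i ->]; exact: tz.
Qed.

End configurations_measure.

(** * Lebesgue-Poisson integrals as exponential series *)

Section parametric_integrals.
Context d1 d2 (T1 : measurableType d1) (T2 : measurableType d2) (R : realType).
Variable m2 : {sigma_finite_measure set T2 -> \bar R}.

Lemma measurable_fun_integral_param (f : T1 * T2 -> \bar R) :
  measurable_fun setT f ->
  measurable_fun setT (fun x => \int[m2]_y f (x, y))%E.
Proof.
move=> mf; rewrite (_ : (fun x => _) = (fun x =>
    \int[m2]_y f^\+ (x, y) - \int[m2]_y f^\- (x, y))%E); last first.
  apply/funext => x; rewrite [LHS]integralE.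
  by congr (_ - _)%E; apply: eq_integral => y _; rewrite ?funeposE ?funenegE.
apply: emeasurable_funB.
  apply: (measurable_fun_fubini_tonelli_F (f^\+)%E) => //.
  exact: measurable_funepos.
apply: (measurable_fun_fubini_tonelli_F (f^\-)%E) => //.
exact: measurable_funeneg.
Qed.

Lemma measurable_fun_Rintegral_param (f : T1 * T2 -> R) :
  measurable_fun setT f ->
  measurable_fun setT (fun x => \int[m2]_y f (x, y)).
Proof.
move=> mf; apply: (measurableT_comp (@fine_measurable _ setT measurableT)).
by apply: (measurable_fun_integral_param (f := EFin \o f)); exact/measurable_EFinP.
Qed.

End parametric_integrals.

Lemma nneseries_exp (R : realType) (x : R) : 0 <= x ->
  (\sum_(0 <= n <oo) ((n`!%:R)^-1 * x ^+ n)%:E = (expR x)%:E)%E.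
Proof.
move=> x0; apply/cvg_lim => //.
rewrite (_ : (fun n => _) = EFin \o series (exp_coeff x)).
  apply: cvg_EFin; first by apply: nearW.
  exact: is_cvg_series_exp_coeff.
apply/funext => n; rewrite /= /series /= -sumEFin.
by apply: eq_bigr => i _; rewrite exp_coeffE.
Qed.

Section tensor_integrals.
Context d (T : measurableType d) (R : realType).
Variable mu : {sigma_finite_measure set T -> \bar R}.
Local Notation mun n := (tuple_measure mu n).

Lemma integral_prod_tnth (h : T -> R) (c : R) n : measurable_fun setT h ->
  (forall x, 0 <= h x) -> (\int[mu]_x (h x)%:E = c%:E)%E ->
  (\int[mun n]_t (\prod_(i < n) h (tnth t i))%:E = (c ^+ n)%:E)%E.
Proof.
move=> mh h0 hc.
have mp k : measurable_fun setT (fun t : k.-tuple T => \prod_(i < k) h (tnth t i)).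
  apply: measurable_prod => i _.
  exact: (measurableT_comp mh (@measurable_tnth _ _ _ i)).
elim: n => [|n IH].
  rewrite integral_dirac//=; last by apply/measurable_EFinP; exact: mp.
  by rewrite diracT mul1e big_ord0 expr0.
have p0 k (t : k.-tuple T) : 0 <= \prod_(i < k) h (tnth t i) by exact: prodr_ge0.
have mpE k : measurable_fun setT (fun t : k.-tuple T => (\prod_(i < k) h (tnth t i))%:E).
  by apply/measurable_EFinP; exact: mp.
rewrite ge0_integral_tcons1//.
under eq_integral => x _.
  under eq_integral => s _.
    rewrite big_ord_recl (_ : tnth _ ord0 = x)//.
    under eq_bigr do rewrite tnthS.
    rewrite EFinM.
    over.
  rewrite (@ge0_integralZl _ _ _ (mun n) setT measurableT (fun s : n.-tuple T => (\prod_(i < n) h (tnth s i))%:E))//;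
    [|exact: mpE|by move=> s _; rewrite lee_fin|by rewrite lee_fin].
  rewrite IH.
  over.
have mhE : measurable_fun setT (EFin \o h) by exact/measurable_EFinP.
rewrite (@ge0_integralZr _ _ _ mu setT measurableT (EFin \o h))//.
  by rewrite hc -EFinM exprS.
- by move=> x _; rewrite lee_fin.
- rewrite lee_fin exprn_ge0// -lee_fin -hc.
  by apply: integral_ge0 => x _; rewrite lee_fin.
- by move=> t; rewrite lee_fin.
Qed.

End tensor_integrals.

Section LP_integrals.
Context (R : realType) (d : nat).
Hypothesis d_gt0 : (0 < d)%N.
Local Notation mun n := (tuple_measure (leb R d) n).
Local Notation LP := (lebesgue_poisson R d).

Lemma measurable_cfg_comp d' (Y : measurableType d') (f : config R d -> Y) n :
  measurable_fun setT f ->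
  measurable_fun setT (fun t : n.-tuple (Rvec R d) => f (cfg t)).
Proof. by move=> mf; exact: (measurableT_comp mf (@measurable_cfg R d n)). Qed.

Lemma measurable_fun_integral_LP d' (X : measurableType d')
    (F : X -> config R d -> R) :
  (forall n, measurable_fun setT (fun p : X * n.-tuple (Rvec R d) => F p.1 (cfg p.2))) ->
  measurable_fun setT (fun x => \int[LP]_xi F x xi).
Proof.
move=> mF.
have mFx x : measurable_fun setT (F x).
  apply: measurable_config_fun => n.
  exact: (measurableT_comp (mF n) (measurable_fun_pair (measurable_cst x) (@measurable_id _ _ _))).
have mI (G : X -> config R d -> \bar R) :
    (forall n, measurable_fun setT (fun p : X * n.-tuple (Rvec R d) => G p.1 (cfg p.2))) ->
    (forall x, measurable_fun setT (G x)) -> (forall x xi, 0 <= G x xi)%E ->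
    measurable_fun setT (fun x => \int[LP]_xi G x xi)%E.
  move=> mG mGx G0; rewrite (_ : (fun x => _) = (fun x =>
      \sum_(0 <= n <oo) (n`!%:R^-1)%:E * \int[mun n]_t G x (cfg t))%E); last first.
    by apply/funext => x; rewrite ge0_integral_LP.
  apply: ge0_emeasurable_sum.
    by move=> n x _ _; apply: mule_ge0 => //; exact: integral_ge0.
  move=> n _; apply: measurable_funeM.
  exact: (measurable_fun_integral_param (mun n) (mG n)).
apply: (measurableT_comp (@fine_measurable _ setT measurableT)).
rewrite (_ : (fun x => _) = (fun x => \int[LP]_xi (EFin \o F x)^\+ xi -
    \int[LP]_xi (EFin \o F x)^\- xi)%E); last first.
  by apply/funext => x; rewrite integralE.
apply: emeasurable_funB; apply: mI => //.
- move=> n; have mEF : measurable_fun setT (fun p : X * n.-tuple (Rvec R d) => (F p.1 (cfg p.2))%:E).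
    by apply/measurable_EFinP; exact: mF.
  rewrite (_ : (fun p => _) = (fun p : X * n.-tuple (Rvec R d) => (F p.1 (cfg p.2))%:E)^\+%E).
    exact: measurable_funepos.
  by apply/funext => p; rewrite !funeposE.
- by move=> x; apply: measurable_funepos; exact/measurable_EFinP.
- move=> n; have mEF : measurable_fun setT (fun p : X * n.-tuple (Rvec R d) => (F p.1 (cfg p.2))%:E).
    by apply/measurable_EFinP; exact: mF.
  rewrite (_ : (fun p => _) = (fun p : X * n.-tuple (Rvec R d) => (F p.1 (cfg p.2))%:E)^\-%E).
    exact: measurable_funeneg.
  by apply/funext => p; rewrite !funenegE.
- by move=> x; apply: measurable_funeneg; exact/measurable_EFinP.
Qed.

Lemma integral_LP_le (f : config R d -> \bar R) (G c : R) :
  measurable_fun setT f -> (forall xi, 0 <= f xi)%E -> 0 <= G -> 0 <= c ->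
  (forall n, \int[mun n]_t f (cfg t) <= (G * c ^+ n)%:E)%E ->
  (\int[LP]_xi f xi <= (G * expR c)%:E)%E.
Proof.
move=> mf f0 G0 c0 fb; rewrite ge0_integral_LP//.
rewrite EFinM -nneseries_exp// -nneseriesZl; last first.
  by move=> n _; rewrite lee_fin mulr_ge0// exprn_ge0.
apply: lee_nneseries => [n _ _|n _].
  by apply: mule_ge0 => //; exact: integral_ge0.
apply: (@le_trans _ _ ((n`!%:R^-1)%:E * (G * c ^+ n)%:E)%E).
  by rewrite lee_wpmul2l// lee_fin.
by rewrite -!EFinM lee_fin mulrCA.
Qed.

(** Positive and negative parts are summed separately; integrability keeps both
sums finite. *)
Lemma LP_Rintegral_series (f : config R d -> R) : LP.-integrable setT (EFin \o f) ->
  (fun N => \sum_(0 <= n < N) (n`!%:R^-1) * \int[mun n]_t f (cfg t)) @ \oo -->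
  \int[LP]_xi f xi.
Proof.
move=> intf.
have mf : measurable_fun setT f by apply/measurable_EFinP; exact: (measurable_int LP).
have cv (g : config R d -> \bar R) : measurable_fun setT g -> (forall xi, 0 <= g xi)%E ->
    (\int[LP]_xi g xi < +oo)%E ->
    (forall n, (\int[mun n]_t g (cfg t))%E \is a fin_num) /\
    (fun N => \sum_(0 <= n < N) (n`!%:R^-1) * fine (\int[mun n]_t g (cfg t))) @ \oo -->
     fine (\int[LP]_xi g xi).
  move=> mg g0; rewrite ge0_integral_LP// => goo.
  have I0 n : (0 <= \int[mun n]_t g (cfg t))%E by exact: integral_ge0.
  have t0 n : (0 <= (n`!%:R^-1)%:E * \int[mun n]_t g (cfg t))%E by exact: mule_ge0.
  have fin n : (\int[mun n]_t g (cfg t))%E \is a fin_num.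
    rewrite ge0_fin_numE//.
    have : ((n`!%:R^-1)%:E * \int[mun n]_t g (cfg t) < +oo)%E.
      apply: le_lt_trans goo; rewrite (le_trans _ (nneseries_lim_ge n.+1 _))//.
      by rewrite big_mkord big_ord_recr /= leeDr// sume_ge0.
    move=> h; rewrite ltey; apply: contraTN h => /eqP ->.
    by rewrite gt0_muley ?ltxx// lte_fin invr_gt0 ltr0n fact_gt0.
  split => //.
  have := @is_cvg_nneseries _ (fun n => ((n`!%:R^-1)%:E * \int[mun n]_t g (cfg t))%E)
    xpredT 0 (fun n _ _ => t0 n).
  move/cvg_ex => -[l cl].
  have E := cvg_lim (@ereal_hausdorff R) cl.
  have lf : l \is a fin_num.
    rewrite ge0_fin_numE -?E//; exact: nneseries_ge0.
  rewrite E; move: cl; rewrite -{1}(fineK lf) => /fine_cvgP[_].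
  apply: cvg_trans; apply: near_eq_cvg; near=> N => /=.
  under eq_bigr do rewrite -(fineK (fin _)) -EFinM.
  by rewrite sumEFin.
have /integrableP[_ foo] := intf.
have [fp cp] := cv (EFin \o f)^\+%E (measurable_funepos (measurable_int LP intf))
  (fun x => funepos_ge0 _ x) (integrable_lty measurableT (integrable_funepos measurableT intf)).
have [fn cn] := cv (EFin \o f)^\-%E (measurable_funeneg (measurable_int LP intf))
  (fun x => funeneg_ge0 _ x) (integrable_lty measurableT (integrable_funeneg measurableT intf)).
rewrite /Rintegral integralE fineB ?integrable_fin_num//; last 2 first.
- exact: integrable_funepos.
- exact: integrable_funeneg.
apply: cvg_trans (cvgB cp cn); apply: near_eq_cvg; near=> N => /=.
rewrite !fctE -sumrB; apply: eq_bigr => n _; rewrite -mulrBr; congr (_ * _).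
rewrite -fineB; [|exact: fp|exact: fn].
congr fine; rewrite [RHS]integralE.
by congr (_ - _)%E; apply: eq_integral => t _; rewrite ?funeposE ?funenegE.
Unshelve. all: by end_near. Qed.

(** Level [n] contributes [(- c) ^ n / n!]. *)
Lemma Rintegral_config_expN (h : Rvec R d -> R) (c : R) : measurable_fun setT h ->
  (forall x, 0 <= h x) -> (\int[leb R d]_x (h x)%:E = c%:E)%E ->
  LP.-integrable setT (EFin \o config_exp (fun x => - h x)) /\
  \int[LP]_xi config_exp (fun x => - h x) xi = expR (- c).
Proof.
move=> mh h0 hc.
have c0 : 0 <= c by rewrite -lee_fin -hc; apply: integral_ge0 => x _; rewrite lee_fin.
have mNh : measurable_fun setT (fun x => - h x) by exact: measurable_funN.
have mp n : measurable_fun setT (fun t : n.-tuple (Rvec R d) => \prod_(i < n) h (tnth t i)).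
  apply: measurable_prod => i _.
  exact: (measurableT_comp mh (@measurable_tnth _ _ _ i)).
have expE n : {ae mun n, forall t, config_exp (fun x => - h x) (cfg t) =
    (-1) ^+ n * \prod_(i < n) h (tnth t i)}.
  have := ae_uniq R d_gt0 n.
  apply: filterS => t ut; rewrite config_exp_cfg//.
  by rewrite prodrN card_ord.
have p0 n (t : n.-tuple (Rvec R d)) : 0 <= \prod_(i < n) h (tnth t i) by exact: prodr_ge0.
have mexp := measurable_fun_config_exp mNh.
have int : LP.-integrable setT (EFin \o config_exp (fun x => - h x)).
  apply/integrableP; split; first exact/measurable_EFinP.
  apply: le_lt_trans (ltry (1 * expR c)).
  apply: integral_LP_le => //.
    by apply: measurableT_comp => //; exact/measurable_EFinP.
  move=> n; rewrite mul1r -(integral_prod_tnth n mh h0 hc).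
  apply: ae_ge0_le_integral => //.
  - apply: measurableT_comp => //; apply/measurable_EFinP.
    exact: measurable_cfg_comp.
  - by move=> t _; rewrite lee_fin.
  - by apply/measurable_EFinP; exact: mp.
  apply: filterS (expE n) => t /= -> _.
  by rewrite lee_fin normrM normrX normrN1 expr1n mul1r ger0_norm ?p0 ?lexx.
split => //.
have := LP_Rintegral_series int.
rewrite (_ : (fun N => _) = series (exp_coeff (- c))).
  move=> h1; apply/esym/cvg_lim => //.
apply/funext => N; rewrite /series /=; apply: eq_bigr => n _.
rewrite exp_coeffE; congr (_ * _).
rewrite /Rintegral (ae_eq_integral (fun t => ((-1) ^+ n * \prod_(i < n) h (tnth t i))%:E))//.
- under eq_integral do rewrite EFinM.
  rewrite integralZl//.
    by rewrite (integral_prod_tnth n mh h0 hc) -EFinM /= -exprMn mulN1r.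
  apply/integrableP; split; first by apply/measurable_EFinP; exact: mp.
  under eq_integral do rewrite gee0_abs ?lee_fin//.
  by rewrite (integral_prod_tnth n mh h0 hc) ltry.
- by apply/measurable_EFinP; exact: measurable_cfg_comp.
- by apply/measurable_EFinP; apply: measurable_funM => //; exact: mp.
- by apply: filterS (expE n) => t -> _.
Qed.

End LP_integrals.

(** * The Vlasov operator on product functions *)

Section weighted_integrals.
Context d (T : measurableType d) (R : realType).
Variable mu : {measure set T -> \bar R}.

(** The form of the duality between integrable and bounded functions used
throughout: the weight is [a (x - .)] or [phi] and the bounded factor is only
controlled almost everywhere. *)
Lemma integrable_weight (g f : T -> R) (c M : R) :
  measurable_fun setT g -> measurable_fun setT f -> (forall x, 0 <= g x) ->
  (\int[mu]_x (g x)%:E = c%:E)%E -> 0 <= M -> {ae mu, forall x, `|f x| <= M} ->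
  mu.-integrable setT (EFin \o (fun x => g x * f x)) /\
  `|\int[mu]_x (g x * f x)| <= c * M.
Proof.
move=> mg mf g0 gc M0 fM.
have mgf : measurable_fun setT (fun x => g x * f x) by exact: measurable_funM.
have le : (\int[mu]_x `|(g x * f x)%:E| <= (c * M)%:E)%E.
  rewrite EFinM -gc -ge0_integralZr//; last 2 first.
  - exact/measurable_EFinP.
  - by move=> x _; rewrite lee_fin.
  apply: ae_ge0_le_integral => //.
  - by apply: measurableT_comp => //; exact/measurable_EFinP.
  - by move=> x _; rewrite mule_ge0// lee_fin.
  - by apply: emeasurable_funM => //; exact/measurable_EFinP.
  - apply: filterS fM => x fx _.
    by rewrite abse_EFin -EFinM lee_fin normrM ger0_norm// ler_wpM2l.
have int : mu.-integrable setT (EFin \o (fun x => g x * f x)).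
  apply/integrableP; split; first exact/measurable_EFinP.
  exact: le_lt_trans le (ltry _).
split => //.
by rewrite -lee_fin EFin_normr_Rintegral// (le_trans (le_abse_integral _ _ _))//;
  exact/measurable_EFinP.
Qed.

Lemma ae_eq_Rintegral (f g : T -> R) : measurable_fun setT f ->
  measurable_fun setT g -> {ae mu, forall x, f x = g x} ->
  \int[mu]_x f x = \int[mu]_x g x.
Proof.
move=> mf mg fg; congr fine; apply: ae_eq_integral => //.
- exact/measurable_EFinP.
- exact/measurable_EFinP.
- by apply: filterS fg => x -> _.
Qed.

Lemma ae_eq_integrable (f g : T -> R) : measurable_fun setT f ->
  measurable_fun setT g -> {ae mu, forall x, f x = g x} ->
  mu.-integrable setT (EFin \o f) -> mu.-integrable setT (EFin \o g).
Proof.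
move=> mf mg fg /integrableP[_ foo]; apply/integrableP; split.
  exact/measurable_EFinP.
rewrite (ae_eq_integral (fun x => `|(f x)%:E|%E))//.
- by apply: measurableT_comp => //; exact/measurable_EFinP.
- by apply: measurableT_comp => //; exact/measurable_EFinP.
- by apply: filterS fg => x -> _.
Qed.

Lemma Rintegral_EFin (f : T -> R) c : (\int[mu]_x (f x)%:E = c%:E)%E ->
  \int[mu]_x f x = c.
Proof. by rewrite /Rintegral => ->. Qed.

Lemma Rintegral_sum_seq (I : Type) (s : seq I) (f : I -> T -> R) :
  (forall i, mu.-integrable setT (EFin \o f i)) ->
  mu.-integrable setT (EFin \o (fun x => \sum_(i <- s) f i x)) /\
  \int[mu]_x (\sum_(i <- s) f i x) = \sum_(i <- s) \int[mu]_x f i x.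
Proof.
move=> intf; elim: s => [|i s [IHi IHe]].
  split.
    rewrite (_ : _ \o _ = cst 0%E); first exact: integrable0.
    by apply/funext => x /=; rewrite big_nil.
  rewrite big_nil (_ : (fun x => _) = cst 0) ?Rintegral_cst//= ?mul0r//.
  by apply/funext => x; rewrite big_nil.
have E : (fun x => \sum_(j <- i :: s) f j x) = (fun x => f i x + \sum_(j <- s) f j x).
  by apply/funext => x; rewrite big_cons.
rewrite E big_cons -IHe RintegralD//; split => //.
exact: integrableD (intf i) IHi.
Qed.

End weighted_integrals.

Lemma ge0_RintegralZl d (T : measurableType d) (R : realType)
    (mu : {measure set T -> \bar R}) (f : T -> R) (c : R) : measurable_fun setT f ->
  (forall x, 0 <= f x) -> 0 <= c -> \int[mu]_x (c * f x) = c * \int[mu]_x f x.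
Proof.
move=> mf f0 c0; rewrite /Rintegral; under eq_integral do rewrite EFinM.
rewrite ge0_integralZl//; last 2 first.
- exact/measurable_EFinP.
- by move=> x _; rewrite lee_fin.
have : (0 <= \int[mu]_x (f x)%:E)%E by apply: integral_ge0 => x _; rewrite lee_fin.
case: (\int[mu]_x (f x)%:E)%E => // _.
move: c0; rewrite le_eqVlt => /predU1P[<-|c0]; first by rewrite mul0e mul0r.
by rewrite gt0_muley ?lte_fin//= mulr0.
Qed.

Lemma ge0_Rintegral_signr d (T : measurableType d) (R : realType)
    (mu : {measure set T -> \bar R}) (f : T -> R) n : (forall x, 0 <= f x) ->
  \int[mu]_x ((-1) ^+ n * f x) = (-1) ^+ n * \int[mu]_x f x.
Proof.
move=> f0; rewrite -signr_odd; case: (odd n).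
  rewrite expr1 mulN1r /Rintegral.
  under eq_integral do rewrite mulN1r EFinN.
  by rewrite integral_ge0N ?fineN// => x _; rewrite lee_fin.
by rewrite expr0 mul1r; apply: eq_Rintegral => x _; rewrite mul1r.
Qed.

Lemma Rintegral_weight_cvg d (T : measurableType d) (R : realType)
    (mu : {measure set T -> \bar R}) (g f : T -> R) (f_ : nat -> T -> R) (c M : R) :
  measurable_fun setT g -> measurable_fun setT f ->
  (forall n, measurable_fun setT (f_ n)) -> (forall x, 0 <= g x) ->
  (\int[mu]_x (g x)%:E = c%:E)%E -> (forall n x, `|f_ n x| <= M) ->
  (forall x, f_ ^~ x @ \oo --> f x) ->
  (fun n => \int[mu]_x (g x * f_ n x)) @ \oo --> \int[mu]_x (g x * f x).
Proof.
move=> mg mf mf_ g0 gc fM cvf.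
have ig : mu.-integrable setT (EFin \o g).
  apply/integrableP; split; first exact/measurable_EFinP.
  by under eq_integral do rewrite gee0_abs ?lee_fin//; rewrite gc ltry.
have igM : mu.-integrable setT (fun x => (g x * M)%:E).
  rewrite (_ : (fun x => _) = (fun x => (g x)%:E * M%:E)%E); first exact: integrableZr.
  by apply/funext => x; rewrite EFinM.
have [|||||igf _ cv] := @dominated_convergence _ T R mu setT measurableT
  (fun n x => (g x * f_ n x)%:E) (fun x => (g x * f x)%:E) (fun x => (g x * M)%:E).
- by move=> n; apply/measurable_EFinP; exact: measurable_funM.
- by apply/measurable_EFinP; exact: measurable_funM.
- apply: aeW => x _; apply: cvg_EFin; first exact: nearW.
  exact: cvgMr (cvf x).
- exact: igM.
- by apply: aeW => x n _; rewrite lee_fin normrM ger0_norm// ler_wpM2l.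
have gcf : (\int[mu]_x (g x * f x)%:E)%E \is a fin_num by exact: integrable_fin_num igf.
by move: cv; rewrite -(fineK gcf) => /fine_cvgP[].
Qed.

Section Rintegral_iterated.
Context d1 d2 (T1 : measurableType d1) (T2 : measurableType d2) (R : realType).
Variables (m1 : {sigma_finite_measure set T1 -> \bar R}).
Variables (m2 : {sigma_finite_measure set T2 -> \bar R}).

(** The inner integral may be infinite on a null set, where its real-valued version
is [0]; this does not affect the outer integral. *)
Lemma ge0_Rintegral_iterated (G : T1 * T2 -> R) (c : R) : measurable_fun setT G ->
  (forall p, 0 <= G p) -> (\int[m2]_y \int[m1]_x (G (x, y))%:E = c%:E)%E ->
  (\int[m1]_x (\int[m2]_y G (x, y))%:E = c%:E)%E.
Proof.
move=> mG G0; have mGE : measurable_fun setT (EFin \o G) by exact/measurable_EFinP.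
have GE0 p : (0 <= (EFin \o G) p)%E by rewrite lee_fin.
rewrite -(fubini_tonelli (EFin \o G))// => Gc.
have mF := measurable_fun_integral_param m2 mGE.
have fin : {ae m1, forall x, (\int[m2]_y (G (x, y))%:E)%E \is a fin_num}.
  suff /(integrable_ae measurableT) : m1.-integrable setT
      (fun x => \int[m2]_y (G (x, y))%:E)%E by apply: filterS => x /(_ I).
  apply/integrableP; split; first exact: mF.
  rewrite (eq_integral (fun x => \int[m2]_y (G (x, y))%:E)%E) ?Gc ?ltry// => x _.
  by rewrite gee0_abs//; apply: integral_ge0 => y _; exact: GE0.
rewrite -Gc; apply: ae_eq_integral => //.
- by apply/measurable_EFinP; exact: measurable_fun_Rintegral_param.
- by apply: filterS fin => x fx _; rewrite /Rintegral fineK.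
Qed.

End Rintegral_iterated.

Section vlasov_exponential.
Context (R : realType) (d : nat).
Hypothesis d_gt0 : (0 < d)%N.
Local Notation mun n := (tuple_measure (leb R d) n).
Local Notation LP := (lebesgue_poisson R d).
Local Notation Rd := (Rvec R d).
Variables (a phi : Rd -> R) (alpha Phi : R).
Hypothesis (ma : measurable_fun setT a) (mphi : measurable_fun setT phi).
Hypothesis (a_ge0 : forall x, 0 <= a x) (phi_ge0 : forall x, 0 <= phi x).
Hypothesis a_sym : forall x, a x = a (vopp x).
Hypothesis a_int : (\int[leb R d]_x (a x)%:E = alpha%:E)%E.
Hypothesis phi_int : (\int[leb R d]_x (phi x)%:E = Phi%:E)%E.

Lemma a_vsubC x y : a (vsub x y) = a (vsub y x).
Proof. by rewrite a_sym vopp_vsub. Qed.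

Lemma alpha_ge0 : 0 <= alpha.
Proof. by rewrite -lee_fin -a_int; apply: integral_ge0 => x _; rewrite lee_fin. Qed.

Lemma Phi_ge0 : 0 <= Phi.
Proof. by rewrite -lee_fin -phi_int; apply: integral_ge0 => x _; rewrite lee_fin. Qed.

Lemma measurable_fun_comp_vsub d' (X : measurableType d') (f : Rd -> R) (u v : X -> Rd) :
  measurable_fun setT f -> measurable_fun setT u -> measurable_fun setT v ->
  measurable_fun setT (fun p => f (vsub (u p) (v p))).
Proof. by move=> mf mu mv; apply: (measurableT_comp mf); exact: measurable_fun_vsub. Qed.

Lemma int_a_vsubl x : (\int[leb R d]_y (a (vsub x y))%:E = alpha%:E)%E.
Proof.
rewrite -a_int (leb_vsubl x (F := EFin \o a))//; exact/measurable_EFinP.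
Qed.

Lemma int_a_vsubr y : (\int[leb R d]_x (a (vsub x y))%:E = alpha%:E)%E.
Proof. by under eq_integral do rewrite a_vsubC; exact: int_a_vsubl. Qed.

Lemma int_phi_vsubl x : (\int[leb R d]_y (phi (vsub x y))%:E = Phi%:E)%E.
Proof.
rewrite -phi_int (leb_vsubl x (F := EFin \o phi))//; exact/measurable_EFinP.
Qed.

Lemma measurable_fun_conv (f g : Rd -> R) : measurable_fun setT f ->
  measurable_fun setT g -> measurable_fun setT (conv f g).
Proof.
move=> mf mg; apply: (measurable_fun_Rintegral_param (leb R d)
  (f := fun p : Rd * Rd => f (vsub p.1 p.2) * g p.2)).
apply: measurable_funM; first exact: measurable_fun_comp_vsub.
exact: measurableT_comp.
Qed.

Lemma measurable_fun_config_exp2 d' (X : measurableType d') n (g : X -> Rd -> R)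
    (s : X -> n.-tuple Rd) :
  measurable_fun setT (fun p : X * Rd => g p.1 p.2) -> measurable_fun setT s ->
  measurable_fun setT (fun p => config_exp (g p) (cfg (s p))).
Proof.
move=> mg ms; rewrite (_ : (fun p => _) =
  (fun p => if uniq (s p) then \prod_(i < n) g p (tnth (s p) i) else 1)).
  apply: measurable_fun_ifT => //.
    exact: (measurableT_comp (@measurable_uniq R d n) ms).
  apply: measurable_fun_prod_tnth => i.
  rewrite -[X in measurable_fun _ X]/((fun p : X * Rd => g p.1 p.2) \o (fun p => (p, tnth (s p) i))).
  apply: measurableT_comp => //; apply: measurable_fun_pair => //.
  exact: (measurableT_comp (@measurable_tnth _ _ _ i) ms).
apply/funext => p; case: ifP => ut; first exact: config_exp_cfg.
by rewrite /cfg ut config_exp0.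
Qed.

Local Notation E y := (config_exp (fun z => - phi (vsub y z))).

Lemma measurable_fun_Ephi d' (X : measurableType d') n (y : X -> Rd)
    (s : X -> n.-tuple Rd) : measurable_fun setT y -> measurable_fun setT s ->
  measurable_fun setT (fun p => E (y p) (cfg (s p))).
Proof.
move=> my ms; apply: (measurable_fun_config_exp2 (g := fun p z => - phi (vsub (y p) z))) => //.
apply: measurable_funN; apply: measurable_fun_comp_vsub => //.
exact: measurableT_comp.
Qed.

Lemma measurable_Ephi y : measurable_fun setT (E y).
Proof.
by apply: measurable_config_fun => n; apply: (measurable_fun_Ephi (y := cst y) (s := id)).
Qed.

(** The contribution of the point [x] to the sum in the loss term of
[vlasov_op]. *)
Definition loss_weight (x : Rd) (xi : config R d) : R :=
  \int[leb R d]_y (a (vsub x y) * E y xi).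

Lemma measurable_loss_weight x : measurable_fun setT (loss_weight x).
Proof.
apply: measurable_config_fun => n.
apply: (measurable_fun_Rintegral_param (leb R d)
  (f := fun p : n.-tuple Rd * Rd => a (vsub x p.2) * E p.2 (cfg p.1))).
apply: measurable_funM.
  by apply: (measurable_fun_comp_vsub (u := cst x)).
exact: measurable_fun_Ephi.
Qed.

Section exponential.
Variables (rho : Rd -> R) (M : R).
Hypothesis mrho : measurable_fun setT rho.
Hypothesis rho_ge0 : forall x, 0 <= rho x.
Hypothesis rho_le : forall x, rho x <= M.

Let M_ge0 : 0 <= M.
Proof. by have x0 : Rd := [tuple (0 : measurableTypeR R) | i < d]; exact: le_trans (rho_le x0). Qed.

Let rho_norm x : `|rho x| <= M. Proof. by rewrite ger0_norm. Qed.

Local Notation kappa := (conv rho phi).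

(** The reflection [z -> y - z] turns the integral of [phi (y - z) * rho z] into
the convolution [(rho * phi) y] as it is written in the kinetic equation. *)
Lemma int_phi_rho y :
  (\int[leb R d]_z (phi (vsub y z) * rho z)%:E = (kappa y)%:E)%E /\
  0 <= kappa y <= M * Phi.
Proof.
have m1 : measurable_fun setT (fun z => phi (vsub y z)).
  exact: (measurable_fun_comp_vsub (u := cst y)).
have [h1 h2] := integrable_weight m1 mrho (fun z => phi_ge0 _) (int_phi_vsubl y) M_ge0
  (aeW _ rho_norm).
have e : (\int[leb R d]_z (phi (vsub y z) * rho z)%:E = (kappa y)%:E)%E.
  rewrite /conv /Rintegral.
  rewrite -(leb_vsubl y (F := fun z => (rho (vsub y z) * phi z)%:E)).
  - under [in RHS]eq_integral do rewrite vsub_vsub mulrC.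
    by rewrite fineK//; exact: integrable_fin_num h1.
  - apply/measurable_EFinP; apply: measurable_funM => //.
    exact: (measurable_fun_comp_vsub (u := cst y)).
  - by move=> t; rewrite lee_fin mulr_ge0.
split => //; apply/andP; split.
  by rewrite -lee_fin -e; apply: integral_ge0 => z _; rewrite lee_fin mulr_ge0.
have := Rintegral_EFin e => <-.
by rewrite mulrC (le_trans _ h2)// ler_norm.
Qed.

(** Almost every [xi] is disjoint from [zeta], so the product over the union
factors, and the exponential formula applies to [phi (y - .) * rho]. *)
Lemma Rintegral_E_rho y zeta :
  LP.-integrable setT (EFin \o (fun xi => E y xi * config_exp rho (xi `|` zeta)%fset)) /\
  \int[LP]_xi (E y xi * config_exp rho (xi `|` zeta)%fset) =
    expR (- kappa y) * config_exp rho zeta.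
Proof.
have m1 : measurable_fun setT (fun z => phi (vsub y z) * rho z).
  by apply: measurable_funM => //; exact: (measurable_fun_comp_vsub (u := cst y)).
have [I1 I2] := Rintegral_config_expN d_gt0 m1
  (fun z => mulr_ge0 (phi_ge0 _) (rho_ge0 z)) (int_phi_rho y).1.
have mexp : measurable_fun setT (config_exp (fun z => - (phi (vsub y z) * rho z))).
  by apply: measurable_fun_config_exp; exact: measurable_funN.
have mE1 : measurable_fun setT (fun xi => E y xi * config_exp rho (xi `|` zeta)%fset).
  apply: measurable_funM; first exact: measurable_Ephi.
  by apply: measurable_fun_fsetUr; exact: measurable_fun_config_exp.
have mE2 : measurable_fun setT (fun xi =>
    config_exp (fun z => - (phi (vsub y z) * rho z)) xi * config_exp rho zeta).
  by apply: measurable_funM.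
have ae : {ae LP, forall xi, config_exp (fun z => - (phi (vsub y z) * rho z)) xi *
    config_exp rho zeta = E y xi * config_exp rho (xi `|` zeta)%fset}.
  have [N [mN N0 sN]] := ae_LP_disjoint d_gt0 zeta.
  exists N; split => // xi /= nP; apply: sN => /= dis; apply: nP.
  rewrite config_expU// mulrA; congr (_ * _).
  by rewrite /config_exp -big_split /=; apply: eq_bigr => z _; rewrite mulNr.
have I3 : LP.-integrable setT (EFin \o (fun xi =>
    config_exp (fun z => - (phi (vsub y z) * rho z)) xi * config_exp rho zeta)).
  apply: eq_integrable (integrableZr measurableT (config_exp rho zeta) I1) => //.
split; first exact: ae_eq_integrable ae I3.
by rewrite -(ae_eq_Rintegral mE2 mE1 ae) RintegralZr// I2.
Qed.

Lemma Rintegral_a_E_rho y zeta :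
  \int[leb R d]_x (a (vsub x y) *
    \int[LP]_xi (E y xi * config_exp rho (xi `|` (x |` zeta))%fset)) =
  conv a rho y * expR (- kappa y) * config_exp rho zeta.
Proof.
under eq_Rintegral => x _ do rewrite (Rintegral_E_rho y _).2.
have m1 : measurable_fun setT (fun x => a (vsub x y)).
  exact: (measurable_fun_comp_vsub (v := cst y)).
have m2 : measurable_fun setT (fun x => config_exp rho (x |` zeta)%fset).
  have := measurable_fun_fset1U (k := fun xi : config R d => config_exp rho (xi `|` zeta)%fset)
    (x := @id Rd) (s := cst ([tuple] : 0.-tuple Rd)).
  move=> /(_ (measurable_fun_fsetUr zeta (measurable_fun_config_exp mrho))).
  move=> /(_ (@measurable_id _ _ _) (measurable_cst _)).
  congr measurable_fun; apply/funext => x; congr config_exp.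
  apply/fsetP => z; rewrite !in_fsetU !in_fset1 /cfg /= mem_config_of in_nil.
  by rewrite orbF.
have [I1 _] := integrable_weight m1 mrho (fun x => a_ge0 _) (int_a_vsubr y) M_ge0
  (aeW _ rho_norm).
transitivity (\int[leb R d]_x (a (vsub x y) * rho x * (expR (- kappa y) * config_exp rho zeta))).
  apply: ae_eq_Rintegral.
  - by apply: measurable_funM => //; exact: measurable_funM.
  - by apply: measurable_funM => //; exact: measurable_funM.
  apply: filterS (ae_notin d_gt0 (in_tuple (enum_fset zeta))) => x xz.
  by rewrite config_exp1U//; ring.
rewrite RintegralZr// mulrA; congr (_ * _ * _).
by apply: eq_Rintegral => x _; rewrite a_vsubC.
Qed.

Lemma int_kappa x n :
  (\int[leb R d]_y (a (vsub x y) * kappa y ^+ n)%:E =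
    (\int[leb R d]_y (a (vsub x y) * kappa y ^+ n))%:E)%E /\
  0 <= \int[leb R d]_y (a (vsub x y) * kappa y ^+ n) <= alpha * (M * Phi) ^+ n.
Proof.
have kn y : `|kappa y ^+ n| <= (M * Phi) ^+ n.
  have /andP[k0 k1] := (int_phi_rho y).2.
  by rewrite normrX ger0_norm// lerXn2r// nnegrE (le_trans k0).
have [I1 I2] := integrable_weight (measurable_fun_comp_vsub ma (measurable_cst x)
  (@measurable_id _ _ _)) (measurable_funX n (measurable_fun_conv mrho mphi))
  (fun y => a_ge0 _) (int_a_vsubl x) (exprn_ge0 n (mulr_ge0 M_ge0 Phi_ge0)) (aeW _ kn).
split; first by rewrite /Rintegral fineK//; exact: integrable_fin_num I1.
rewrite (le_trans _ I2) ?ler_norm// andbT.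
apply: Rintegral_ge0 => y _; rewrite mulr_ge0// exprn_ge0//.
by have /andP[] := (int_phi_rho y).2.
Qed.

Lemma integrable_kappa x n :
  (leb R d).-integrable setT (EFin \o (fun y => a (vsub x y) * kappa y ^+ n)).
Proof.
apply/integrableP; split.
  apply/measurable_EFinP; apply: measurable_funM.
    exact: (measurable_fun_comp_vsub (u := cst x)).
  by apply: measurable_funX; exact: measurable_fun_conv.
rewrite (eq_integral (fun y => (a (vsub x y) * kappa y ^+ n)%:E)).
  by rewrite (int_kappa x n).1 ltry.
move=> y _; rewrite gee0_abs// lee_fin mulr_ge0// exprn_ge0//.
by have /andP[] := (int_phi_rho y).2.
Qed.

(** Up to the sign [(-1) ^ n], the integrand of the loss term on level [n], seen
as a function of the added points and of the jump target. *)
Let Gn x n (p : n.-tuple Rd * Rd) :=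
  a (vsub x p.2) * \prod_(i < n) (phi (vsub p.2 (tnth p.1 i)) * rho (tnth p.1 i)).

Let mGn x n : measurable_fun setT (@Gn x n).
Proof.
apply: measurable_funM; first by apply: (measurable_fun_comp_vsub (u := cst x)).
apply: (measurable_fun_prod_tnth (f := fun (p : n.-tuple Rd * Rd) z => phi (vsub p.2 z) * rho z)
  (t := fst)) => i.
have mt : measurable_fun setT (fun p : n.-tuple Rd * Rd => tnth p.1 i).
  exact: (measurableT_comp (@measurable_tnth _ _ _ i)).
apply: measurable_funM; first exact: measurable_fun_comp_vsub.
exact: (measurableT_comp mrho mt).
Qed.

Let Gn_ge0 x n p : 0 <= @Gn x n p.
Proof. by rewrite mulr_ge0// prodr_ge0// => i _; rewrite mulr_ge0. Qed.

Let int_Gn x n : (\int[mun n]_t (\int[leb R d]_y @Gn x n (t, y))%:E =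
  (\int[leb R d]_y (a (vsub x y) * kappa y ^+ n))%:E)%E.
Proof.
apply: ge0_Rintegral_iterated => //; first exact: mGn.
rewrite -(int_kappa x n).1; apply: eq_integral => y _.
rewrite /Gn /=.
have mp : measurable_fun setT (fun z => phi (vsub y z) * rho z).
  by apply: measurable_funM => //; exact: (measurable_fun_comp_vsub (u := cst y)).
have p0 z : 0 <= phi (vsub y z) * rho z by rewrite mulr_ge0.
under eq_integral do rewrite EFinM.
rewrite ge0_integralZl//.
- by rewrite (integral_prod_tnth n mp p0 (int_phi_rho y).1) -EFinM.
- apply/measurable_EFinP; apply: measurable_prod => i _.
  exact: (measurableT_comp mp (@measurable_tnth _ _ _ i)).
- by move=> t _; rewrite lee_fin prodr_ge0.
- by rewrite lee_fin.
Qed.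

Let loss_weight_cfg x n (t : n.-tuple Rd) : uniq t ->
  config_exp rho (cfg t) * loss_weight x (cfg t) = (-1) ^+ n * \int[leb R d]_y @Gn x n (t, y).
Proof.
move=> ut; rewrite config_exp_cfg//.
pose h y := a (vsub x y) * \prod_(i < n) phi (vsub y (tnth t i)).
have mh : measurable_fun setT h.
  apply: measurable_funM; first exact: (measurable_fun_comp_vsub (u := cst x)).
  by apply: measurable_prod => i _; exact: (measurable_fun_comp_vsub (v := cst _)).
have h0 y : 0 <= h y by rewrite mulr_ge0// prodr_ge0.
have -> : loss_weight x (cfg t) = (-1) ^+ n * \int[leb R d]_y h y.
  rewrite -ge0_Rintegral_signr//; apply: eq_Rintegral => y _.
  by rewrite /h config_exp_cfg// prodrN card_ord mulrCA.
rewrite mulrCA -ge0_RintegralZl//; last exact: prodr_ge0.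
congr (_ * _); apply: eq_Rintegral => y _.
by rewrite /Gn /h /= big_split /=; ring.
Qed.

Lemma int_normr_rho_loss_weight x n :
  (\int[mun n]_t `|config_exp rho (cfg t) * loss_weight x (cfg t)|%:E <=
    (alpha * (M * Phi) ^+ n)%:E)%E.
Proof.
apply: (@le_trans _ _ (\int[leb R d]_y (a (vsub x y) * kappa y ^+ n))%:E); last first.
  by rewrite lee_fin; have /andP[] := (int_kappa x n).2.
rewrite -int_Gn; apply: ae_ge0_le_integral => //.
- apply/measurable_EFinP; apply: measurableT_comp => //.
  apply: (measurable_cfg_comp (f := fun xi => config_exp rho xi * loss_weight x xi)).
  by apply: measurable_funM; [exact: measurable_fun_config_exp|exact: measurable_loss_weight].
- by move=> t _; rewrite lee_fin Rintegral_ge0.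
- by apply/measurable_EFinP; apply: measurable_fun_Rintegral_param; exact: mGn.
have := ae_uniq R d_gt0 n; apply: filterS => t ut _; rewrite lee_fin loss_weight_cfg//.
by rewrite normrM normrX normrN1 expr1n mul1r ger0_norm ?Rintegral_ge0.
Qed.

(** The order of the integrations over [xi] and [y] is exchanged on each level,
where the integral over the added points is [kappa y ^ n]; the exponential
series is then summed under the integral over [y] by dominated convergence. *)
Lemma Rintegral_rho_loss_weight x :
  LP.-integrable setT (EFin \o (fun xi => config_exp rho xi * loss_weight x xi)) /\
  \int[LP]_xi (config_exp rho xi * loss_weight x xi) =
    conv a (fun y => expR (- kappa y)) x.
Proof.
have mk : measurable_fun setT kappa by exact: measurable_fun_conv.
have maxy : measurable_fun setT (fun y => a (vsub x y)).
  exact: (measurable_fun_comp_vsub (u := cst x)).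
have mf : measurable_fun setT (fun xi => config_exp rho xi * loss_weight x xi).
  by apply: measurable_funM; [exact: measurable_fun_config_exp|exact: measurable_loss_weight].
have mG n : measurable_fun setT (fun t : n.-tuple Rd => \int[leb R d]_y @Gn x n (t, y)).
  by apply: measurable_fun_Rintegral_param; exact: mGn.
have G0 n (t : n.-tuple Rd) : 0 <= \int[leb R d]_y @Gn x n (t, y).
  exact: Rintegral_ge0.
have ae n : {ae mun n, forall t, config_exp rho (cfg t) * loss_weight x (cfg t) =
    (-1) ^+ n * \int[leb R d]_y @Gn x n (t, y)}.
  by have := ae_uniq R d_gt0 n; apply: filterS => t ut; exact: loss_weight_cfg.
have int : LP.-integrable setT (EFin \o (fun xi => config_exp rho xi * loss_weight x xi)).
  apply/integrableP; split; first exact/measurable_EFinP.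
  apply: le_lt_trans (ltry (alpha * expR (M * Phi))).
  apply: integral_LP_le => //.
  - by apply: measurableT_comp => //; exact/measurable_EFinP.
  - exact: alpha_ge0.
  - exact: mulr_ge0 M_ge0 Phi_ge0.
  by move=> n; exact: int_normr_rho_loss_weight.
split => //.
have := LP_Rintegral_series d_gt0 int.
rewrite (_ : (fun N => _) = (fun N => \int[leb R d]_y (a (vsub x y) *
    series (exp_coeff (- kappa y)) N))); last first.
  apply/funext => N.
  have intc n : (leb R d).-integrable setT (EFin \o (fun y => a (vsub x y) * kappa y ^+ n)).
    exact: (integrable_kappa x n).
  have intk n : (leb R d).-integrable setT (EFin \o (fun y => a (vsub x y) *
      exp_coeff (- kappa y) n)).
    rewrite (_ : _ \o _ = (fun y => (n`!%:R^-1 * (-1) ^+ n)%:E *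
        (a (vsub x y) * kappa y ^+ n)%:E)%E); last first.
      apply/funext => y /=; rewrite -EFinM exp_coeffE (exprNn (kappa y)) /=.
      by congr (_%:E); rewrite [LHS]mulrCA -[RHS]mulrA; congr (_ * _); rewrite mulrCA.
    exact: integrableZl (intc n).
  rewrite [LHS](eq_bigr (fun n => \int[leb R d]_y (a (vsub x y) * exp_coeff (- kappa y) n))).
    rewrite -(Rintegral_sum_seq _ intk).2.
    by apply: eq_Rintegral => y _; rewrite /series /= mulr_sumr.
  move=> n _; rewrite (ae_eq_Rintegral _ _ (ae n)); last 2 first.
  - by apply: (measurable_cfg_comp (f := fun xi => config_exp rho xi * loss_weight x xi)).
  - by apply: measurable_funM => //; exact: mG.
  rewrite ge0_Rintegral_signr// (Rintegral_EFin (int_Gn x n)) mulrA.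
  rewrite -(RintegralZl _ measurableT (intc n)).
  by apply: eq_Rintegral => y _; rewrite exp_coeffE (exprNn (kappa y)) /=; ring.
move=> cv1; apply/esym/(cvg_unique _ _ cv1); first exact: Rhausdorff.
apply: (Rintegral_weight_cvg (c := alpha) (M := expR (M * Phi))) => //.
- by apply: measurableT_comp => //; exact: measurable_funN.
- move=> N; rewrite /series /=; apply: measurable_sum => n.
  under eq_fun do rewrite exp_coeffE.
  by apply: measurable_funM => //; apply: measurable_funX; exact: measurable_funN.
- exact: int_a_vsubl.
- move=> N y; have /andP[k0 k1] := (int_phi_rho y).2.
  apply: le_trans (ler_norm_sum _ _ _) _.
  rewrite (eq_bigr (fun n => exp_coeff (kappa y) n)); last first.
    move=> n _; rewrite !exp_coeffE normrM normfV normrX normrN.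
    by rewrite (ger0_norm k0) ger0_norm.
  apply: (@le_trans _ _ (expR (kappa y))); last by rewrite ler_expR.
  apply: nondecreasing_cvgn_le; last exact: is_cvg_series_exp_coeff.
  apply: nondecreasing_series => n _ _.
  by rewrite exp_coeffE mulr_ge0// ?invr_ge0// exprn_ge0.
- by move=> y; exact: is_cvg_series_exp_coeff.
Qed.

(** The gain term of the point [y] contains [(a * rho) y], its loss term
[rho y * (a * exp(- kappa)) y]; the remaining points only contribute the common
factor [e(rho, eta minus y)]. *)
Lemma vlasov_op_config_exp eta :
  vlasov_op a phi (config_exp rho) eta =
  \sum_(y <- eta) kinetic_rhs a phi rho y * config_exp rho (eta `\ y)%fset.
Proof.
rewrite /vlasov_op.
have -> : \int[LP]_xi (config_exp rho (xi `|` eta)%fset * \sum_(x <- eta) loss_weight x xi) =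
    config_exp rho eta * \sum_(x <- eta) conv a (fun y => expR (- kappa y)) x.
  have intx x := (Rintegral_rho_loss_weight x).1.
  rewrite (_ : \sum_(x <- eta) _ = \sum_(x <- eta) \int[LP]_xi (config_exp rho xi * loss_weight x xi)).
    have [I1 I2] := Rintegral_sum_seq (enum_fset eta) intx.
    rewrite -I2 -RintegralZl//.
    have mrE := measurable_fun_config_exp mrho.
    have mS : measurable_fun setT (fun xi => \sum_(x <- eta) loss_weight x xi).
      by apply: measurable_sum => x; exact: measurable_loss_weight.
    apply: ae_eq_Rintegral.
    - by apply: measurable_funM => //; exact: measurable_fun_fsetUr.
    - apply: measurable_funM => //; apply: measurable_sum => x.
      by apply: measurable_funM => //; exact: measurable_loss_weight.
    have [N [mN N0 sN]] := ae_LP_disjoint d_gt0 eta.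
    exists N; split => // xi /= nP; apply: sN => /= dis; apply: nP.
    by rewrite config_expU// -mulr_sumr; ring.
  by apply: eq_bigr => x _; rewrite (Rintegral_rho_loss_weight x).2.
rewrite mulr_sumr -sumrB big_seq [RHS]big_seq; apply: eq_bigr => y yeta.
rewrite Rintegral_a_E_rho /kinetic_rhs.
have -> : config_exp rho eta = rho y * config_exp rho (eta `\ y)%fset.
  by rewrite -config_exp1U ?fsetD1K// in_fsetD1 eqxx.
by ring.
Qed.

End exponential.
End vlasov_exponential.

(** * Growth of differentiable families in the essential supremum norm *)

Lemma is_derive_expR_affine (R : realType) (B K a c t : R) :
  is_derive t (1 : R) (fun t => B * expR (K * (t - a) + c))
    (B * K * expR (K * (t - a) + c)).
Proof.
have h1 := is_deriveB (is_derive_id t (1 : R)) (is_derive_cst a t (1 : R)).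
have h2 := is_deriveD (is_deriveZ K h1) (is_derive_cst c t (1 : R)).
have h3 := is_deriveZ B (is_derive1_comp (is_derive_expR _) h2).
apply: (is_derive_eq h3); rewrite subr0 addr0.
rewrite -[K *: 1]/(K * 1) mulr1 -[_ *: _]/(B * _) -[RHS]mulrA; congr (_ * _).
by rewrite mulrC.
Qed.

Lemma half_pow_le (R : realType) (C e : R) : 0 <= C -> 0 < e -> exists n, C / 2 ^+ n <= e.
Proof.
move=> C0 e0; have := @cvg_geometric R C (1 / 2).
rewrite ger0_norm ?divr_ge0// => /(_ _)/cvgrPdist_le.
move=> /(_ _ e e0)[]; first by lra.
move=> N _ /(_ N (leqnn N)); rewrite sub0r normrN /geometric /= => h.
exists N; apply: le_trans (ler_norm _) _; move: h.
by rewrite expr_div_n expr1n mul1r.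
Qed.

Section real_induction.
Context (R : realType).

(** The supremum of the times up to which [P] holds is attained, by closure from
the left, and cannot be smaller than a time in the interval, by the local
step. *)
Lemma real_induction (a T : R) (P : R -> Prop) : P a ->
  (forall t, a <= t < T -> (forall s, a <= s <= t -> P s) ->
    exists2 del, 0 < del & forall s, t < s < t + del -> s < T -> P s) ->
  (forall t, a < t < T -> (forall s, a <= s < t -> P s) -> P t) ->
  forall t, a <= t < T -> P t.
Proof.
move=> Pa Pr Pl t0 /andP[at0 t0T]; apply: contrapT => nPt0.
pose S := [set t | a <= t <= t0 /\ forall s, a <= s <= t -> P s].
have Sa : S a.
  split; first by rewrite lexx.
  by move=> s; rewrite -eq_le => /eqP <-.
have ubS : ubound S t0 by move=> t [/andP[]].
have hS : has_sup S by split; [exists a|exists t0].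
pose m := sup S.
have am : a <= m by apply: sup_upper_bound.
have mt0 : m <= t0 by apply: ge_sup => //; exists a.
have Pm' s : a <= s < m -> P s.
  move=> /andP[as_ sm].
  have ms : 0 < m - s by rewrite subr_gt0.
  have [t [_ Pt] st] := sup_adherent ms hS.
  by rewrite subKr in st; apply: Pt; rewrite as_ ltW.
have Pm : P m.
  move: am; rewrite le_eqVlt => /predU1P[<-//|am].
  by apply: Pl => //; rewrite am (le_lt_trans mt0).
have Pm'' s : a <= s <= m -> P s.
  by case/andP => as_; rewrite le_eqVlt => /predU1P[->//|sm]; apply: Pm'; rewrite as_.
have mt0' : m < t0.
  by rewrite lt_neqAle mt0 andbT; apply: contra_notN nPt0 => /eqP <-.
have mT : a <= m < T by rewrite am (lt_trans mt0').
have [del del0 Pd] := Pr m mT Pm''.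
pose s := Num.min t0 (m + del / 2).
have ms : m < s by rewrite /s lt_min mt0' ltrDl divr_gt0.
have : S s.
  split; first by rewrite (le_trans am (ltW ms)) /s ge_min lexx.
  move=> r /andP[ar rs]; have [rm|mr] := leP r m; first by apply: Pm''; rewrite ar.
  have rt0 : r <= t0 by rewrite (le_trans rs)// /s ge_min lexx.
  apply: Pd; last by rewrite (le_lt_trans rt0).
  rewrite mr /= (le_lt_trans rs)// /s gt_min ltrD2l.
  by apply/orP; right; lra.
move=> /(sup_upper_bound hS); rewrite -/m; lra.
Qed.

Definition eps_continuous_on (a T : R) (g : R -> R) :=
  forall t, a <= t < T -> forall e, 0 < e -> exists2 del, 0 < del &
    forall s, a <= s < T -> `|s - t| < del -> `|g s - g t| <= e.

Lemma is_derive_eps (f : R -> R) (t df : R) : is_derive t 1 f df ->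
  forall e, 0 < e -> exists2 del, 0 < del & forall h, `|h| < del ->
    `|f (t + h) - f t - h * df| <= e * `|h|.
Proof.
move=> [dvf dfE] e e0.
have : h^-1 *: (f (h *: 1 + t) - f t) @[h --> 0^'] --> df by rewrite -dfE; exact: dvf.
move=> /cvgrPdist_le /(_ e e0); rewrite near_withinE => -[del /= del0 Hd].
exists del => // h hd; have [->|h0] := eqVneq h 0.
  by rewrite addr0 subrr mul0r subrr normr0 mulr0.
have := Hd h; rewrite /= sub0r normrN => /(_ hd h0).
rewrite /= -[h *: 1]/(h * 1) mulr1 -[_ *: _]/(_ * _) => H.
rewrite [X in f X]addrC.
have -> : f (h + t) - f t - h * df = - (h * (df - h^-1 * (f (h + t) - f t))).
  by field.
by rewrite normrN normrM mulrC ler_wpM2r.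
Qed.

Lemma is_derive_eps_continuous (f : R -> R) (t df : R) : is_derive t (1 : R) f df ->
  forall e, 0 < e -> exists2 del, 0 < del &
    forall s, `|s - t| < del -> `|f s - f t| <= e.
Proof.
move=> dft e e0; have [d1 d10 H] := is_derive_eps dft ltr01.
exists (Num.min d1 (e / (1 + `|df|))).
  by rewrite lt_min d10 divr_gt0// ltr_pwDl.
move=> s; rewrite lt_min => /andP[/H]; rewrite (addrC t) subrK mul1r => H1.
rewrite ltr_pdivlMr ?ltr_pwDl// mulrDr mulr1 => H2.
rewrite -(subrK ((s - t) * df) (f s - f t)) (le_trans (ler_normD _ _))//.
rewrite normrM; apply: le_trans (ltW H2); exact: lerD.
Qed.

(** Where [g] touches [f + e (1 + t - a)] it exceeds [f], so its growth rate is at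
most that of [f] plus [e / 2] and it cannot cross.  A growth condition restricted
to the region [f < g] is what an invariant band requires: the field has the right
sign outside the band only. *)
Lemma barrier (a T : R) (g f f' : R -> R) : eps_continuous_on a T g ->
  (forall t : R, is_derive t (1 : R) f (f' t)) ->
  (forall t, a < t < T -> f t < g t -> forall e, 0 < e -> exists2 del, 0 < del &
    forall h, 0 < h < del -> t + h < T -> g (t + h) <= g t + h * (f' t + e)) ->
  g a <= f a -> forall t, a <= t < T -> g t <= f t.
Proof.
move=> cg df dini ga.
have cf t := is_derive_eps_continuous (df t).
(* The margin is positive already at [t = a] and has slope [e]. *)
suff H e : 0 < e -> forall t, a <= t < T -> g t <= f t + e * (1 + (t - a)).
  move=> t tT; apply/ler_addgt0Pr => e e0.
  have pos : 0 < 1 + (t - a) by move/andP : tT => [at_ _]; lra.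
  have := H (e / (1 + (t - a))) (divr_gt0 e0 pos) t tT.
  by rewrite divfK ?gt_eqF.
move=> e0; apply: real_induction.
- by rewrite subrr addr0 mulr1; lra.
- move=> t tT Pt; have /andP[at_ tT'] := tT.
  have [lt|ge] := ltP (g t) (f t + e * (1 + (t - a))).
    pose eta := (f t + e * (1 + (t - a)) - g t) / 2.
    have eta0 : 0 < eta by rewrite divr_gt0// subr_gt0.
    have [d1 d10 H1] := cg t tT eta eta0; have [d2 d20 H2] := cf t eta eta0.
    exists (Num.min d1 d2); first by rewrite lt_min d10.
    move=> s /andP[ts sd] sT.
    have st : `|s - t| = s - t by rewrite ger0_norm// subr_ge0 ltW.
    have sd' : `|s - t| < Num.min d1 d2 by rewrite st; lra.
    move: sd'; rewrite lt_min => /andP[sd1 sd2].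
    have := H1 s; rewrite sT (le_trans at_ (ltW ts)) => /(_ isT sd1).
    rewrite ler_norml => /andP[_ h1].
    have := H2 s sd2; rewrite ler_norml => /andP[h2 _].
    have h3 : e * (1 + (t - a)) <= e * (1 + (s - a)) by rewrite ler_pM2l//; lra.
    by rewrite /eta in h1 h2; lra.
  have fg : f t < g t.
    apply: lt_le_trans ge; rewrite ltrDl mulr_gt0//; lra.
  have lt_at : a < t.
    by rewrite lt_neqAle at_ andbT; apply/eqP => at'; move: fg; rewrite -at'; lra.
  have e20 : 0 < e / 2 by rewrite divr_gt0.
  have [d1 d10 H1] := dini t (introT andP (conj lt_at tT')) fg _ e20.
  have [d2 d20 H2] := is_derive_eps (df t) e20.
  exists (Num.min d1 d2); first by rewrite lt_min d10.
  move=> s /andP[ts sd] sT.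
  have h0 : 0 < s - t by rewrite subr_gt0.
  have : s - t < Num.min d1 d2 by lra.
  rewrite lt_min => /andP[sd1 sd2].
  have := H1 (s - t); rewrite h0 sd1 subrKC => /(_ isT sT) h1.
  have := H2 (s - t); rewrite subrKC ger0_norm ?(ltW h0)// => /(_ sd2).
  rewrite ler_norml => /andP[h2 _].
  have gt : g t <= f t + e * (1 + (t - a)) by apply: Pt; rewrite at_ lexx.
  have -> : e * (1 + (s - a)) = e * (1 + (t - a)) + e * (s - t) by ring.
  have h3 : (s - t) * (f' t + e / 2) = (s - t) * f' t + e * (s - t) / 2 by field.
  by rewrite h3 in h1; lra.
- move=> t /andP[at_ tT] H; rewrite leNgt; apply/negP => lt.
  pose eta := (g t - (f t + e * (1 + (t - a)))) / 3.
  have eta0 : 0 < eta by rewrite divr_gt0// subr_gt0.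
  have tT' : a <= t < T by rewrite (ltW at_).
  have [d1 d10 H1] := cg t tT' eta eta0; have [d2 d20 H2] := cf t eta eta0.
  have m0 : 0 < Num.min d1 d2 by rewrite lt_min d10.
  pose s := Num.max a (t - Num.min d1 d2 / 2).
  have sa : a <= s by rewrite /s le_max lexx.
  have st : s < t by rewrite /s gt_max at_ /=; lra.
  have sd : `|s - t| < Num.min d1 d2.
    rewrite distrC ger0_norm ?subr_ge0 ?(ltW st)//.
    have : t - Num.min d1 d2 / 2 <= s by rewrite /s le_max lexx orbT.
    by lra.
  move: sd; rewrite lt_min => /andP[sd1 sd2].
  have := H1 s; rewrite sa (lt_trans st tT) => /(_ isT sd1).
  rewrite ler_norml => /andP[h1 _].
  have := H2 s sd2; rewrite ler_norml => /andP[_ h2].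
  have := H s; rewrite sa st => /(_ isT) h3.
  have h4 : e * (1 + (s - a)) <= e * (1 + (t - a)) by rewrite ler_pM2l//; lra.
  by rewrite /eta in h1 h2; lra.
Qed.

End real_induction.

Section ess_norm.
Context d (X : measurableType d) (R : realType).
Variable mu : {measure set X -> \bar R}.

Lemma Lnorm_inftyP (f : X -> R) (c : R) : 0 <= c ->
  ('N[mu]_+oo[EFin \o f] <= c%:E)%E <-> {ae mu, forall x, `|f x| <= c}.
Proof.
move=> c0; rewrite unlock; case: ifPn => [_|]; last first.
  rewrite -leNgt measure_le0 => /eqP mu0; split => _; first exact: measure0_ae.
  by rewrite lee_fin.
split.
  move=> /ess_supP; apply: filterS => x /=.
  by rewrite lee_fin.
by move=> fc; apply/ess_supP; apply: filterS fc => x /=; rewrite lee_fin.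
Qed.

Lemma Lnorm_infty_fin (f : X -> R) (c : R) : {ae mu, forall x, `|f x| <= c} -> 0 <= c ->
  'N[mu]_+oo[EFin \o f]%E \is a fin_num.
Proof.
move=> fc c0; rewrite ge0_fin_numE ?Lnorm_ge0//.
by apply: le_lt_trans (ltry c); apply/Lnorm_inftyP.
Qed.

Lemma Linfty_ae_bounded (f : X -> R) : ('N[mu]_+oo[EFin \o f] < +oo)%E ->
  exists2 c, 0 <= c & {ae mu, forall x, `|f x| <= c}.
Proof.
move=> foo.
have f0 : (0 <= 'N[mu]_+oo[EFin \o f])%E by exact: Lnorm_ge0.
have ffin : 'N[mu]_+oo[EFin \o f]%E \is a fin_num by rewrite ge0_fin_numE.
exists (fine 'N[mu]_+oo[EFin \o f]%E); first exact: fine_ge0.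
by apply/Lnorm_inftyP; [exact: fine_ge0|rewrite fineK].
Qed.

Definition ess_continuous (a T : R) (u : R -> X -> R) :=
  forall t, a <= t < T -> forall e, 0 < e -> exists2 del, 0 < del &
    forall s, a <= s < T -> `|s - t| < del -> {ae mu, forall x, `|u s x - u t x| <= e}.

(** Forward difference quotients are all that a comparison from the left endpoint
needs. *)
Definition ess_derivative (a T : R) (u v : R -> X -> R) :=
  forall t, a < t < T -> forall e, 0 < e -> exists2 del, 0 < del &
    forall h, 0 < h < del -> t + h < T ->
      {ae mu, forall x, `|(u (t + h) x - u t x) / h - v t x| <= e}.

(** [barrier] applied to the essential supremum norm of [u t], whose forward growth
rate is at most the norm of [v t]. *)
Lemma ess_growth (u v : R -> X -> R) (a T : R) (f f' : R -> R) :
  (forall t, a <= t < T -> exists2 M, 0 <= M & {ae mu, forall x, `|u t x| <= M}) ->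
  ess_continuous a T u -> ess_derivative a T u v ->
  (forall t, a < t < T -> {ae mu, forall x, `|v t x| <= f' t}) ->
  (forall t : R, is_derive t (1 : R) f (f' t)) -> (forall t, 0 <= f' t) ->
  0 <= f a -> {ae mu, forall x, `|u a x| <= f a} ->
  forall t, a <= t < T -> {ae mu, forall x, `|u t x| <= f t}.
Proof.
move=> ub uc uv vf df f'0 fa0 ua t tT.
pose N s := fine 'N[mu]_+oo[EFin \o u s]%E.
have N0 s : 0 <= N s by apply: fine_ge0; exact: Lnorm_ge0.
have NP s c : a <= s < T -> 0 <= c -> N s <= c <-> {ae mu, forall x, `|u s x| <= c}.
  move=> sT c0; have [M M0 uM] := ub s sT.
  rewrite -Lnorm_inftyP// -lee_fin /N fineK//.
  exact: Lnorm_infty_fin uM M0.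
have Nae s : a <= s < T -> {ae mu, forall x, `|u s x| <= N s}.
  by move=> sT; apply/NP.
have at_ : a <= t by case/andP : tT.
have aT : a <= a < T by move/andP : tT => [h1 h2]; rewrite lexx (le_lt_trans h1 h2).
have key : N t <= f t.
  move: t tT {at_}; apply: (barrier (f' := f')) => //.
  - move=> t tT e e0; have [del del0 H] := uc t tT e e0.
    exists del => // s sT st; have Hs := H s sT st.
    have le1 : N t <= N s + e.
      apply/(NP _ _ tT); first by rewrite addr_ge0// ltW.
      move: (Nae s sT) Hs; apply: filterS2 => x h1 h2.
      rewrite -[u t x](subrK (u s x)) (le_trans (ler_normD _ _))// addrC lerD//.
      by rewrite distrC.
    have le2 : N s <= N t + e.
      apply/(NP _ _ sT); first by rewrite addr_ge0// ltW.
      move: (Nae t tT) Hs; apply: filterS2 => x h1 h2.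
      by rewrite -[u s x](subrK (u t x)) (le_trans (ler_normD _ _))// addrC lerD.
    by rewrite ler_norml; apply/andP; split; lra.
  - move=> t tT _ e e0; have [del del0 H] := uv t tT e e0.
    exists del => // h hd thT.
    have /andP[h0 _] := hd; have /andP[at_ tT'] := tT.
    apply/NP.
    + by rewrite thT andbT (le_trans (ltW at_))// lerDl ltW.
    + by rewrite addr_ge0// mulr_ge0 ?ltW// ltr_wpDl.
    have tT2 : a <= t < T by rewrite (ltW at_).
    move: (Nae t tT2) (vf t tT) (H h hd thT); apply: filterS3 => x h1 h2 h3.
    have -> : u (t + h) x = u t x + h * (v t x + ((u (t + h) x - u t x) / h - v t x)).
      by field; rewrite gt_eqF.
    rewrite (le_trans (ler_normD _ _))// lerD// normrM gtr0_norm// ler_pM2l//.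
    by rewrite (le_trans (ler_normD _ _))// lerD.
  - by apply/NP.
apply/NP => //; exact: le_trans key.
Qed.

Lemma ae_le0 (f : X -> R) (C : R) : 0 <= C ->
  (forall n : nat, {ae mu, forall x, `|f x| <= C / 2 ^+ n}) ->
  {ae mu, forall x, `|f x| <= 0}.
Proof.
move=> C0 H.
have : {ae mu, forall x, forall n : nat, `|f x| <= C / 2 ^+ n} by exact: ae_foralln.
apply: filterS => x Hx; apply/ler_addgt0Pr => e e0; rewrite add0r.
by have [n Hn] := half_pow_le C0 e0; exact: le_trans (Hx n) Hn.
Qed.

Lemma ess_continuous_sub a T u1 u2 : ess_continuous a T u1 -> ess_continuous a T u2 ->
  ess_continuous a T (fun t x => u1 t x - u2 t x).
Proof.
move=> c1 c2 t tT e e0; have e20 : 0 < e / 2 by rewrite divr_gt0.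
have [d1 d10 H1] := c1 t tT _ e20; have [d2 d20 H2] := c2 t tT _ e20.
exists (Num.min d1 d2); first by rewrite lt_min d10.
move=> s sT; rewrite lt_min => /andP[s1 s2].
move: (H1 s sT s1) (H2 s sT s2); apply: filterS2 => x h1 h2.
have -> : u1 s x - u2 s x - (u1 t x - u2 t x) = (u1 s x - u1 t x) - (u2 s x - u2 t x) by ring.
by apply: le_trans (ler_normB _ _) _; lra.
Qed.

Lemma ess_derivative_sub a T u1 u2 v1 v2 : ess_derivative a T u1 v1 ->
  ess_derivative a T u2 v2 ->
  ess_derivative a T (fun t x => u1 t x - u2 t x) (fun t x => v1 t x - v2 t x).
Proof.
move=> c1 c2 t tT e e0; have e20 : 0 < e / 2 by rewrite divr_gt0.
have [d1 d10 H1] := c1 t tT _ e20; have [d2 d20 H2] := c2 t tT _ e20.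
exists (Num.min d1 d2); first by rewrite lt_min d10.
move=> h /andP[h0]; rewrite lt_min => /andP[s1 s2] thT.
move: (H1 h (introT andP (conj h0 s1)) thT) (H2 h (introT andP (conj h0 s2)) thT).
apply: filterS2 => x h1 h2.
have -> : (u1 (t + h) x - u2 (t + h) x - (u1 t x - u2 t x)) / h - (v1 t x - v2 t x) =
  ((u1 (t + h) x - u1 t x) / h - v1 t x) - ((u2 (t + h) x - u2 t x) / h - v2 t x) by ring.
by apply: le_trans (ler_normB _ _) _; lra.
Qed.

Lemma ess_continuous_sub_itv a T a' T' u : a <= a' -> T' <= T ->
  ess_continuous a T u -> ess_continuous a' T' u.
Proof.
move=> aa TT c t /andP[t1 t2] e e0.
have tT : a <= t < T by rewrite (le_trans aa) // (lt_le_trans t2).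
have [del del0 H] := c t tT e e0.
exists del => // s /andP[s1 s2]; apply: H.
by rewrite (le_trans aa) // (lt_le_trans s2).
Qed.

Lemma ess_derivative_sub_itv a T a' T' u v : a <= a' -> T' <= T ->
  ess_derivative a T u v -> ess_derivative a' T' u v.
Proof.
move=> aa TT c t /andP[t1 t2] e e0.
have tT : a < t < T by rewrite (le_lt_trans aa) // (lt_le_trans t2).
have [del del0 H] := c t tT e e0.
exists del => // h hd th; apply: H => //; exact: lt_le_trans th TT.
Qed.

Lemma ess_vanish_left a T t u : a < t < T -> ess_continuous a T u ->
  (forall s, a <= s < t -> {ae mu, forall x, `|u s x| <= 0}) ->
  {ae mu, forall x, `|u t x| <= 0}.
Proof.
move=> /andP[at_ tT] c u0; apply: (ae_le0 ler01) => n.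
have e0 : 0 < 1 / 2 ^+ n :> R by rewrite divr_gt0// exprn_gt0.
have tT' : a <= t < T by rewrite (ltW at_).
have [del del0 H] := c t tT' _ e0.
pose s := Num.max a (t - del / 2).
have sa : a <= s by rewrite /s le_max lexx.
have st : s < t by rewrite /s gt_max at_ /=; lra.
have sd : `|s - t| < del.
  rewrite distrC ger0_norm ?subr_ge0 ?(ltW st)//.
  have : t - del / 2 <= s by rewrite /s le_max lexx orbT.
  by lra.
have sT : a <= s < T by rewrite sa (lt_trans st).
move: (H s sT sd) (u0 s (introT andP (conj sa st))); apply: filterS2 => x h1.
by rewrite normr_le0 => /eqP h2; move: h1; rewrite h2 sub0r normrN.
Qed.

(** If [|u| <= B / 2 ^ n * exp(2 L (t - a))], then [|v|] is at most [L] times this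
bound, which is the derivative of the bound with [n + 1] in place of [n]. *)
Lemma ess_gronwall (u v : R -> X -> R) (a T B L : R) : 0 <= B -> 0 <= L ->
  (forall t, a <= t < T -> {ae mu, forall x, `|u t x| <= B}) ->
  ess_continuous a T u -> ess_derivative a T u v ->
  (forall t N, a < t < T -> 0 <= N -> {ae mu, forall x, `|u t x| <= N} ->
    {ae mu, forall x, `|v t x| <= L * N}) ->
  {ae mu, forall x, `|u a x| <= 0} ->
  forall t, a <= t < T -> {ae mu, forall x, `|u t x| <= 0}.
Proof.
move=> B0 L0 ub uc uv vL ua t tT.
pose f n t := B / 2 ^+ n * expR ((2 * L) * (t - a) + 0).
have f0 n s : 0 <= f n s.
  by rewrite mulr_ge0 ?expR_ge0// divr_ge0// exprn_ge0.
have H n : forall t, a <= t < T -> {ae mu, forall x, `|u t x| <= f n t}.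
  elim: n => [|n IH].
    move=> s sT; apply: filterS (ub s sT) => x ux; apply: le_trans ux _.
    rewrite /f expr0 divr1 ler_peMr// -expR0 ler_expR addr0 !mulr_ge0//.
    by rewrite subr_ge0; case/andP: sT.
  apply: (ess_growth (v := v) (f := f n.+1) (f' := fun t => L * f n t)) => //.
  - by move=> s sT; exists B => //; exact: ub.
  - by move=> s sT; apply: vL => //; apply: IH; case/andP: sT => /ltW -> ->.
  - move=> s; apply: (is_derive_eq (is_derive_expR_affine _ _ _ _ _)).
    by rewrite /f exprSr; field; rewrite expf_neq0.
  - by move=> s; rewrite mulr_ge0.
  - by apply: filterS ua => x; move/le_trans; exact.
apply: (ae_le0 (C := B * expR ((2 * L) * (t - a) + 0))) => [|n].
  by rewrite mulr_ge0 ?expR_ge0.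
by apply: filterS (H n t tT) => x; rewrite /f mulrAC.
Qed.

End ess_norm.

Section eps_delta.
Context d (X : measurableType d) (R : realType).
Variable N : (X -> R) -> \bar R.
Hypothesis N_ge0 : forall f, (0 <= N f)%E.

Lemma ge0_cvge0P (T : Type) (F : set_system T) {FF : Filter F} (g : T -> \bar R) :
  (forall x, 0 <= g x)%E ->
  g @ F --> 0%E <-> forall e : R, 0 < e -> \forall x \near F, (g x <= e%:E)%E.
Proof.
move=> g0; split => [/fine_cvgP[fin cv] e e0|H].
  move/cvgrPdist_le : cv => /(_ e e0); move: fin; apply: filterS2 => x fx.
  rewrite /= sub0r normrN => h; rewrite -(fineK fx) lee_fin.
  exact: le_trans (ler_norm _) h.
apply/fine_cvgP; split.
  apply: filterS (H 1 ltr01) => x gx; rewrite ge0_fin_numE//.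
  exact: le_lt_trans gx (ltry _).
apply/cvgrPdist_le => e e0; apply: filterS (H e e0) => x gx /=.
rewrite sub0r normrN ger0_norm ?fine_ge0//.
by rewrite -lee_fin fineK// ge0_fin_numE// (le_lt_trans gx)// ltry.
Qed.

Lemma continuous_onP (I : set R) (u : R -> X -> R) : continuous_on N I u <->
  forall t, I t -> forall e, 0 < e -> exists2 del, 0 < del &
    forall s, I s -> `|s - t| < del -> (N (fun x => u s x - u t x)%R <= e%:E)%E.
Proof.
split=> H t It; have g0 s : (0 <= N (u s \- u t)%R)%E by exact: N_ge0.
  move=> e e0; have /(ge0_cvge0P g0) /(_ e e0) := H t It. rewrite near_withinE => -[del /= del0 Hd].
  by exists del => // s Is st; apply: Hd => //=; rewrite distrC.
apply/ge0_cvge0P => // e e0; have [del del0 Hd] := H t It e e0.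
rewrite near_withinE; exists del => //= s st Is; apply: Hd => //.
by rewrite distrC.
Qed.

Lemma derivative_onP (I : set R) (u v : R -> X -> R) : derivative_on N I u v <->
  forall t, I t -> forall e, 0 < e -> exists2 del, 0 < del &
    forall h, h != 0 -> `|h| < del ->
      (N (fun x => (u (t + h) x - u t x) / h - v t x)%R <= e%:E)%E.
Proof.
split=> H t It; have g0 h : (0 <= N (fun x => (u (t + h) x - u t x) / h - v t x)%R)%E
    by exact: N_ge0.
  move=> e e0; have /(ge0_cvge0P g0) /(_ e e0) := H t It. rewrite near_withinE => -[del /= del0 Hd].
  by exists del => // h h0 hd; apply: Hd => //=; rewrite sub0r normrN.
apply/ge0_cvge0P => // e e0; have [del del0 Hd] := H t It e e0.
rewrite near_withinE; exists del => //= h hd h0; apply: Hd => //.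
by move: hd; rewrite /= sub0r normrN.
Qed.

End eps_delta.

(** * Bounds on the Vlasov operator *)

Section vlasov_bounds.
Context (R : realType) (d : nat).
Hypothesis d_gt0 : (0 < d)%N.
Local Notation mun n := (tuple_measure (leb R d) n).
Local Notation LP := (lebesgue_poisson R d).
Local Notation Rd := (Rvec R d).
Variables (a phi : Rd -> R) (alpha Phi : R).
Hypothesis (ma : measurable_fun setT a) (mphi : measurable_fun setT phi).
Hypothesis (a_ge0 : forall x, 0 <= a x) (phi_ge0 : forall x, 0 <= phi x).
Hypothesis a_sym : forall x, a x = a (vopp x).
Hypothesis a_int : (\int[leb R d]_x (a x)%:E = alpha%:E)%E.
Hypothesis phi_int : (\int[leb R d]_x (phi x)%:E = Phi%:E)%E.
Local Notation E y := (config_exp (fun z => - phi (vsub y z))).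
Local Notation A := (loss_weight a phi).

Let alpha0 : 0 <= alpha. Proof. exact: alpha_ge0 a_ge0 a_int. Qed.
Let Phi0 : 0 <= Phi. Proof. exact: Phi_ge0 phi_ge0 phi_int. Qed.

Let mE y : measurable_fun setT (E y). Proof. exact: measurable_Ephi. Qed.

Lemma normr_E_cfg y n (s : n.-tuple Rd) : uniq s ->
  `|E y (cfg s)| = \prod_(i < n) phi (vsub y (tnth s i)).
Proof.
move=> us; rewrite config_exp_cfg// normr_prod; apply: eq_bigr => i _.
by rewrite normrN ger0_norm.
Qed.

(** Level [m] contributes at most [W * G * (Phi * q) ^ m / m!]. *)
Lemma LP_integrable_weight (w f : config R d -> R) (W G q : R) :
  measurable_fun setT w -> measurable_fun setT f -> 0 <= W -> 0 <= G -> 0 <= q ->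
  (forall m, \int[mun m]_s `|w (cfg s)|%:E <= (W * Phi ^+ m)%:E)%E ->
  (forall m, {ae mun m, forall s, `|f (cfg s)| <= G * q ^+ m}) ->
  LP.-integrable setT (EFin \o (fun xi => w xi * f xi)) /\
  `|\int[LP]_xi (w xi * f xi)| <= W * G * expR (Phi * q).
Proof.
move=> mw mf W0 G0 q0 wW fG.
have mwf : measurable_fun setT (fun xi => w xi * f xi) by exact: measurable_funM.
have mnw m : measurable_fun setT (fun s : m.-tuple Rd => `|w (cfg s)|%:E).
  by apply/measurable_EFinP; apply: measurableT_comp => //; exact: measurable_cfg_comp.
have le : (\int[LP]_xi `|(w xi * f xi)%:E| <= (W * G * expR (Phi * q))%:E)%E.
  apply: integral_LP_le => //.
  - by apply: measurableT_comp => //; exact/measurable_EFinP.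
  - exact: mulr_ge0.
  - exact: mulr_ge0.
  move=> m; have Gq0 : 0 <= G * q ^+ m by rewrite mulr_ge0// exprn_ge0.
  apply: (@le_trans _ _ (\int[mun m]_s (`|w (cfg s)|%:E * (G * q ^+ m)%:E))%E).
    apply: ae_ge0_le_integral => //.
    - apply: measurableT_comp => //; apply/measurable_EFinP.
      by apply: (measurable_cfg_comp (f := fun xi => w xi * f xi)).
    - by move=> s _; rewrite mule_ge0// lee_fin.
    - by apply: emeasurable_funM => //; exact: mnw.
    apply: filterS (fG m) => s fs _.
    by rewrite abse_EFin -EFinM lee_fin normrM ler_wpM2l.
  rewrite ge0_integralZr//; last exact: mnw.
  apply: (@le_trans _ _ ((W * Phi ^+ m)%:E * (G * q ^+ m)%:E)%E).
    by apply: lee_wpmul2r => //; rewrite lee_fin.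
  by rewrite -EFinM lee_fin exprMn [leLHS]mulrACA.
have int : LP.-integrable setT (EFin \o (fun xi => w xi * f xi)).
  apply/integrableP; split; first exact/measurable_EFinP.
  exact: le_lt_trans le (ltry _).
split => //.
by rewrite -lee_fin EFin_normr_Rintegral// (le_trans (le_abse_integral _ _ _))//;
  exact/measurable_EFinP.
Qed.

Lemma int_normr_E y m : (\int[mun m]_s `|E y (cfg s)|%:E <= (1 * Phi ^+ m)%:E)%E.
Proof.
have mp : measurable_fun setT (fun z => phi (vsub y z)).
  exact: (measurable_fun_comp_vsub (u := cst y)).
rewrite mul1r -(integral_prod_tnth m mp (fun=> phi_ge0 _) (int_phi_vsubl mphi phi_ge0 phi_int y)).
apply: ae_ge0_le_integral => //.
- apply/measurable_EFinP; apply: measurableT_comp => //.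
  exact: measurable_cfg_comp.
- by move=> s _; rewrite lee_fin prodr_ge0.
- apply/measurable_EFinP; apply: measurable_prod => i _.
  exact: (measurableT_comp mp (@measurable_tnth _ _ _ i)).
by have := ae_uniq R d_gt0 m; apply: filterS => s us _; rewrite normr_E_cfg.
Qed.

(** The case [rho = 1] of [int_normr_rho_loss_weight]. *)
Lemma int_normr_A x m : (\int[mun m]_s `|A x (cfg s)|%:E <= (alpha * Phi ^+ m)%:E)%E.
Proof.
have := int_normr_rho_loss_weight d_gt0 ma mphi a_ge0 phi_ge0 a_int phi_int
  (measurable_cst (1 : R)) (fun=> ler01) (fun=> lexx 1) x m.
rewrite mul1r; apply: le_trans; rewrite le_eqVlt; apply/orP; left; apply/eqP.
by apply: eq_integral => s _; rewrite /config_exp big1_eq mul1r.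
Qed.

Definition gain_kernel (k : config R d -> R) (y : Rd) (zeta : config R d) (x : Rd) : R :=
  \int[LP]_xi (E y xi * k (xi `|` (x |` zeta))%fset).

Lemma measurable_gain_kernel k y zeta : measurable_fun setT k ->
  measurable_fun setT (gain_kernel k y zeta).
Proof.
move=> mk; apply: measurable_fun_integral_LP => // n.
apply: measurable_funM.
  by apply: (measurable_fun_Ephi mphi (y := cst y)).
rewrite (_ : (fun p => _) = (fun p : Rd * n.-tuple Rd =>
    (fun xi : config R d => k (xi `|` zeta)%fset) (p.1 |` cfg p.2)%fset)).
  apply: (measurable_fun_fset1U (k := fun xi : config R d => k (xi `|` zeta)%fset)
    (x := fst) (s := snd)) => //.
  exact: measurable_fun_fsetUr.
by apply/funext => p /=; rewrite fsetUCA fsetUA.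
Qed.

(** The integrability of every integrand of [vlasov_op] at [eta]; it is what makes
the operator additive in [k] there. *)
Definition vlasov_integrable (k : config R d -> R) (eta : config R d) : Prop :=
  (forall y, y \in eta ->
    {ae leb R d, forall x, LP.-integrable setT (EFin \o
      (fun xi => E y xi * k (xi `|` (x |` (eta `\ y)))%fset))} /\
    (leb R d).-integrable setT
      (EFin \o (fun x => a (vsub x y) * gain_kernel k y (eta `\ y)%fset x))) /\
  LP.-integrable setT
    (EFin \o (fun xi => k (xi `|` eta)%fset * \sum_(x <- eta) A x xi)).

Lemma vlasov_op_sub k1 k2 eta : measurable_fun setT k1 -> measurable_fun setT k2 ->
  vlasov_integrable k1 eta -> vlasov_integrable k2 eta ->
  vlasov_op a phi (k1 \- k2) eta = vlasov_op a phi k1 eta - vlasov_op a phi k2 eta.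
Proof.
move=> mk1 mk2 [g1 h1] [g2 h2]; rewrite /vlasov_op.
rewrite [X in _ - X = _](_ : _ = \int[LP]_xi (k1 (xi `|` eta)%fset * \sum_(x <- eta) A x xi) -
    \int[LP]_xi (k2 (xi `|` eta)%fset * \sum_(x <- eta) A x xi)); last first.
  by rewrite -RintegralB//; apply: eq_Rintegral => xi _; rewrite mulrBl.
rewrite [X in X - _ = _](_ : _ =
    \sum_(y <- eta) \int[leb R d]_x (a (vsub x y) * gain_kernel k1 y (eta `\ y)%fset x) -
    \sum_(y <- eta) \int[leb R d]_x (a (vsub x y) * gain_kernel k2 y (eta `\ y)%fset x)).
  by rewrite /gain_kernel /loss_weight; ring.
rewrite -sumrB big_seq [RHS]big_seq; apply: eq_bigr => y yeta.
have [i1 j1] := g1 y yeta; have [i2 j2] := g2 y yeta.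
rewrite -RintegralB//; apply: ae_eq_Rintegral.
- apply: measurable_funM; first exact: (measurable_fun_comp_vsub (v := cst y)).
  by apply: (measurable_gain_kernel (k := k1 \- k2)); exact: measurable_funB.
- apply: measurable_funB; apply: measurable_funM.
  + exact: (measurable_fun_comp_vsub (v := cst y)).
  + exact: measurable_gain_kernel.
  + exact: (measurable_fun_comp_vsub (v := cst y)).
  + exact: measurable_gain_kernel.
move: i1 i2; apply: filterS2 => x i1 i2.
rewrite -mulrBr; congr (_ * _); rewrite /gain_kernel -RintegralB//.
by apply: eq_Rintegral => xi _; rewrite /= mulrBr.
Qed.

Section bound.
Variables (k : config R d -> R) (G q : R).
Hypotheses (mk : measurable_fun setT k) (G0 : 0 <= G) (q0 : 0 <= q).

(** Bounds on [k] at the two kinds of configurations over which [vlasov_op]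
integrates at [eta]: points are added, in the gain term after one point of [eta]
has been moved. *)
Definition adjoin_bounded (eta : config R d) : Prop :=
  (forall y, y \in eta -> {ae leb R d, forall x, forall m, {ae mun m, forall s,
    `|k (cfg s `|` (x |` (eta `\ y)))%fset| <= G * q ^+ m}}) /\
  (forall m, {ae mun m, forall s, `|k (cfg s `|` eta)%fset| <= G * q ^+ m}).

(** Each point of [eta] has a gain and a loss term, and both are at most
[alpha * G * exp(Phi * q)]; the sum over the points is the only source of
unboundedness. *)
Lemma adjoin_bounded_vlasov_op eta : adjoin_bounded eta ->
  vlasov_integrable k eta /\
  `|vlasov_op a phi k eta| <= #|` eta|%:R * (2 * alpha * G * expR (Phi * q)).
Proof.
move=> [B1 B2].
have mkU zeta : measurable_fun setT (fun xi : config R d => k (xi `|` zeta)%fset).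
  exact: measurable_fun_fsetUr.
have S1 y : y \in eta ->
    {ae leb R d, forall x, LP.-integrable setT (EFin \o
      (fun xi => E y xi * k (xi `|` (x |` (eta `\ y)))%fset)) /\
      `|gain_kernel k y (eta `\ y)%fset x| <= G * expR (Phi * q)}.
  move=> /B1; apply: filterS => x Bx.
  have := LP_integrable_weight (mE y) (mkU _) ler01 G0 q0 (int_normr_E y) Bx.
  by rewrite mul1r.
have S2 y : y \in eta -> (leb R d).-integrable setT
      (EFin \o (fun x => a (vsub x y) * gain_kernel k y (eta `\ y)%fset x)) /\
    `|\int[leb R d]_x (a (vsub x y) * gain_kernel k y (eta `\ y)%fset x)| <= alpha * (G * expR (Phi * q)).
  move=> yeta; apply: integrable_weight => //.
  - exact: (measurable_fun_comp_vsub (v := cst y)).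
  - exact: measurable_gain_kernel.
  - exact: (int_a_vsubr ma a_ge0 a_sym a_int).
  - by rewrite mulr_ge0// expR_ge0.
  - by apply: filterS (S1 y yeta) => x [].
have S3 x := LP_integrable_weight (measurable_loss_weight ma mphi x) (mkU eta) alpha0 G0 q0
  (int_normr_A x) B2.
have [I1 I2] := Rintegral_sum_seq (enum_fset eta) (fun x => (S3 x).1).
have E1 : (fun xi : config R d => k (xi `|` eta)%fset * \sum_(x <- eta) A x xi) =
    (fun xi : config R d => \sum_(x <- eta) A x xi * k (xi `|` eta)%fset).
  by apply/funext => xi; rewrite mulr_sumr; apply: eq_bigr => x _; rewrite mulrC.
split.
  split; last by rewrite E1.
  move=> y yeta; split; last exact: (S2 y yeta).1.
  by apply: filterS (S1 y yeta) => x [].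
rewrite /vlasov_op -/(loss_weight a phi).
rewrite [X in _ - X](_ : _ = \sum_(x <- eta) \int[LP]_xi (A x xi * k (xi `|` eta)%fset)); last first.
  by rewrite -I2; congr Rintegral; exact: E1.
rewrite (le_trans (ler_normB _ _))//.
have cst_sum c : \sum_(x <- eta) c = #|` eta|%:R * c :> R.
  by rewrite big_const_seq count_predT iter_addr addr0 mulr_natl.
apply: (@le_trans _ _ (\sum_(x <- eta) alpha * (G * expR (Phi * q)) +
    \sum_(x <- eta) alpha * G * expR (Phi * q))).
  apply: lerD; apply: le_trans (ler_norm_sum _ _ _) _; last first.
    by apply: ler_sum => x _; exact: (S3 x).2.
  rewrite big_seq [leRHS]big_seq; apply: ler_sum => y yeta; exact: (S2 y yeta).2.
by rewrite !cst_sum le_eqVlt; apply/orP; left; apply/eqP; ring.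
Qed.

End bound.

Lemma cfg_tcat m n (s : m.-tuple Rd) (u : n.-tuple Rd) : uniq (tcat s u) ->
  cfg (tcat s u) = (cfg s `|` cfg u)%fset.
Proof.
move=> /[dup] us; rewrite /= cat_uniq => /and3P[s1 _ u1].
rewrite !cfgE//; apply/fsetP => x.
by rewrite in_fsetU !mem_config_of mem_cat.
Qed.

Lemma cfg_tdel n (t : n.+1.-tuple Rd) (i : 'I_n.+1) : uniq t ->
  uniq (tdel i t) /\ (cfg t `\ tnth t i)%fset = cfg (tdel i t).
Proof.
move=> ut; have /tuple_uniqP inj := ut.
have ud : uniq (tdel i t).
  by apply/tuple_uniqP => j l; rewrite !tnth_mktuple => /inj/lift_inj.
split => //; rewrite !cfgE//; apply/fsetP => x.
rewrite in_fsetD1 !mem_config_of; apply/andP/idP.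
  move=> [xi /tnthP[j xj]]; apply/tnthP.
  have ij : i != j by apply: contraNneq xi => ->; rewrite xj.
  have [l jl _] := unlift_some ij; exists l.
  by rewrite tnth_mktuple -jl.
move=> /tnthP[j ->]; rewrite tnth_mktuple; split; last exact: mem_tnth.
by apply/eqP => /inj/eqP; rewrite eq_sym; apply/negP/neq_lift.
Qed.

(** Null sets on level [m + n] are sliced at the points of [eta]; for the gain term
one point of [eta] is deleted and the new one is integrated over. *)
Lemma ae_adjoin_bounded (k : config R d -> R) (G q : R) n : measurable_fun setT k ->
  (forall m, {ae mun m, forall t, `|k (cfg t)| <= G * q ^+ m}) ->
  {ae mun n, forall t, adjoin_bounded k (G * q ^+ n) q (cfg t)}.
Proof.
move=> mk kG.
have P1 l : {ae mun l, forall u, forall m, {ae mun m, forall s,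
    `|k (cfg s `|` cfg u)%fset| <= G * q ^+ l * q ^+ m}}.
  apply: ae_foralln => m.
  have : {ae mun (m + l), forall t : (m + l).-tuple Rd, uniq t /\ `|k (cfg t)| <= G * q ^+ (m + l)}.
    by have := ae_uniq R d_gt0 (m + l); move: (kG (m + l)%N); apply: filterS2.
  move=> /ae_tcat; apply: filterS => u; apply: filterS => s [us].
  by rewrite cfg_tcat// exprD (mulrC (q ^+ m)) mulrA.
case: n => [|n].
  apply: filterS (P1 0%N) => t Pt; split => // y.
  by rewrite (tuple0_eq t) cfgE// mem_config_of.
have P2 : {ae mun n, forall u, {ae leb R d, forall x, forall m, {ae mun m, forall s,
    `|k (cfg s `|` (x |` cfg u))%fset| <= G * q ^+ n.+1 * q ^+ m}}}.
  have : {ae mun n.+1, forall t : n.+1.-tuple Rd, uniq t /\ forall m, {ae mun m, forall s,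
      `|k (cfg s `|` cfg t)%fset| <= G * q ^+ n.+1 * q ^+ m}}.
    by have := ae_uniq R d_gt0 n.+1; move: (P1 n.+1); apply: filterS2.
  move=> /ae_tcons2; apply: filterS => u; apply: filterS => x [us].
  by rewrite cfg_tcons.
have P3 : {ae mun n.+1, forall t, forall i, {ae leb R d, forall x, forall m,
    {ae mun m, forall s, `|k (cfg s `|` (x |` cfg (tdel i t)))%fset| <=
      G * q ^+ n.+1 * q ^+ m}}}.
  have h i := ae_tdel i P2.
  have FF := ae_filter_ringOfSetsType (mun n.+1).
  exact: (filter_forall FF h).
have := ae_uniq R d_gt0 n.+1.
move: (P1 n.+1) P3; apply: filterS3 => t h1 h2 ut; split => // y.
rewrite {1}cfgE// mem_config_of => /tnthP[i ->].
by rewrite (cfg_tdel i ut).2.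
Qed.

End vlasov_bounds.

(** * Local Lipschitz continuity of the kinetic vector field *)

Section kinetic_field.
Context (R : realType) (d : nat).
Local Notation Rd := (Rvec R d).
Variables (a phi : Rd -> R) (alpha Phi : R).
Hypothesis (ma : measurable_fun setT a) (mphi : measurable_fun setT phi).
Hypothesis (a_ge0 : forall x, 0 <= a x) (phi_ge0 : forall x, 0 <= phi x).
Hypothesis a_int : (\int[leb R d]_x (a x)%:E = alpha%:E)%E.
Hypothesis phi_int : (\int[leb R d]_x (phi x)%:E = Phi%:E)%E.

Let alpha0 : 0 <= alpha. Proof. exact: alpha_ge0 a_ge0 a_int. Qed.
Let Phi0 : 0 <= Phi. Proof. exact: Phi_ge0 phi_ge0 phi_int. Qed.

Lemma ae_vsubl (P : Rd -> Prop) x : {ae leb R d, forall y, P y} ->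
  {ae leb R d, forall y, P (vsub x y)}.
Proof.
move=> [N [mN N0 PN]].
have mN' : measurable ((vsub x) @^-1` N).
  rewrite -[X in measurable X]setTI.
  by apply: (measurable_fun_vsub (f := cst x) (g := id)).
exists ((vsub x) @^-1` N); split => //; last by move=> y /= nP; exact: PN.
have mI (B : set Rd) : measurable B -> (\int[leb R d]_y (\1_B y)%:E = leb R d B)%E.
  by move=> mB; rewrite integral_indic// setIT.
rewrite -mI// -N0 -mI//.
rewrite -(leb_vsubl x (F := fun y => (\1_N y)%:E))//.
by apply/measurable_EFinP; exact: measurable_indic.
Qed.

Lemma conv_a_bound (f : Rd -> R) M x : measurable_fun setT f -> 0 <= M ->
  {ae leb R d, forall y, `|f y| <= M} ->
  (leb R d).-integrable setT (EFin \o (fun y => a (vsub x y) * f y)) /\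
  `|conv a f x| <= alpha * M.
Proof.
move=> mf M0 fM; apply: integrable_weight => //.
  exact: (measurable_fun_comp_vsub (u := cst x)).
exact: int_a_vsubl.
Qed.

Lemma conv_phi_bound (f : Rd -> R) M x : measurable_fun setT f -> 0 <= M ->
  {ae leb R d, forall y, `|f y| <= M} ->
  (leb R d).-integrable setT (EFin \o (fun y => f (vsub x y) * phi y)) /\
  `|conv f phi x| <= Phi * M.
Proof.
move=> mf M0 fM.
have E : (fun y => f (vsub x y) * phi y) = (fun y => phi y * f (vsub x y)).
  by apply/funext => y; rewrite mulrC.
rewrite /Defs.conv E; apply: integrable_weight => //.
- exact: (measurable_fun_comp_vsub (u := cst x)).
- exact: (ae_vsubl (P := fun y => `|f y| <= M)).
Qed.

Lemma conv_a_sub (f g : Rd -> R) M del x : measurable_fun setT f ->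
  measurable_fun setT g -> 0 <= M -> 0 <= del ->
  {ae leb R d, forall y, `|f y| <= M} -> {ae leb R d, forall y, `|g y| <= M} ->
  {ae leb R d, forall y, `|f y - g y| <= del} ->
  `|conv a f x - conv a g x| <= alpha * del.
Proof.
move=> mf mg M0 del0 fM gM fg.
have [I1 _] := conv_a_bound x mf M0 fM; have [I2 _] := conv_a_bound x mg M0 gM.
have [_ I3] := conv_a_bound x (measurable_funB mf mg) del0 fg.
rewrite -[X in `|X|]RintegralB//; apply: le_trans I3; rewrite le_eqVlt; apply/orP; left.
by apply/eqP; congr (`|_|); apply: eq_Rintegral => y _; rewrite /= mulrBr.
Qed.

Lemma conv_phi_sub (f g : Rd -> R) M del x : measurable_fun setT f ->
  measurable_fun setT g -> 0 <= M -> 0 <= del ->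
  {ae leb R d, forall y, `|f y| <= M} -> {ae leb R d, forall y, `|g y| <= M} ->
  {ae leb R d, forall y, `|f y - g y| <= del} ->
  `|conv f phi x - conv g phi x| <= Phi * del.
Proof.
move=> mf mg M0 del0 fM gM fg.
have [I1 _] := conv_phi_bound x mf M0 fM; have [I2 _] := conv_phi_bound x mg M0 gM.
have [_ I3] := conv_phi_bound x (measurable_funB mf mg) del0 fg.
rewrite -[X in `|X|]RintegralB//; apply: le_trans I3; rewrite le_eqVlt; apply/orP; left.
by apply/eqP; congr (`|_|); apply: eq_Rintegral => y _; rewrite /= mulrBl.
Qed.

(** Convexity of the exponential: [1 - exp(p - q) <= q - p]. *)
Lemma expRN_lipschitz (K p q : R) : `|p| <= K -> `|q| <= K ->
  `|expR (- p) - expR (- q)| <= expR K * `|p - q|.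
Proof.
have half (p1 q1 : R) : `|p1| <= K -> expR (- p1) - expR (- q1) <= expR K * `|p1 - q1|.
  move=> pK.
  have -> : expR (- q1) = expR (- p1) * expR (p1 - q1).
    by rewrite -expRD; congr expR; ring.
  rewrite -{1}[expR (- p1)]mulr1 -mulrBr.
  have h := expR_ge1Dx (p1 - q1).
  have h1 : 1 - expR (p1 - q1) <= `|p1 - q1|.
    by have := ler_norm (q1 - p1); rewrite distrC; lra.
  apply: (@le_trans _ _ (expR (- p1) * `|p1 - q1|)).
    by rewrite ler_wpM2l ?expR_ge0.
  rewrite ler_wpM2r// ler_expR.
  by move: pK; rewrite ler_norml => /andP[]; lra.
move=> pK qK; rewrite ler_norml half// andbT lerNl opprB distrC.
exact: half.
Qed.

Local Notation rhs := (kinetic_rhs a phi).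

Lemma measurable_expR_conv (u : Rd -> R) : measurable_fun setT u ->
  measurable_fun setT (fun y => expR (- conv u phi y)).
Proof.
move=> mu; apply: measurableT_comp => //; apply: measurable_funN.
exact: measurable_fun_conv.
Qed.

Lemma measurable_kinetic_rhs (u : Rd -> R) : measurable_fun setT u ->
  measurable_fun setT (rhs u).
Proof.
move=> mu; apply: measurable_funB; apply: measurable_funM => //.
- exact: measurable_fun_conv.
- exact: measurable_expR_conv.
- by apply: measurable_fun_conv => //; exact: measurable_expR_conv.
Qed.

Section bounds.
Variable M : R.
Hypothesis M0 : 0 <= M.
Let K := Phi * M.
Let K0 : 0 <= K. Proof. exact: mulr_ge0. Qed.

Lemma expR_conv_bound (u : Rd -> R) y : measurable_fun setT u ->
  {ae leb R d, forall y, `|u y| <= M} -> `|expR (- conv u phi y)| <= expR K.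
Proof.
move=> mu uM; rewrite ger0_norm ?expR_ge0// ler_expR.
have [_] := conv_phi_bound y mu M0 uM.
by rewrite ler_norml => /andP[+ _]; rewrite lerNl.
Qed.

Lemma conv_a_expR_bound (u : Rd -> R) y : measurable_fun setT u ->
  {ae leb R d, forall y, `|u y| <= M} ->
  `|conv a (fun y => expR (- conv u phi y)) y| <= alpha * expR K.
Proof.
move=> mu uM.
have [|//] := conv_a_bound y (measurable_expR_conv mu) (expR_ge0 K).
by apply: aeW => z; exact: expR_conv_bound.
Qed.

Lemma kinetic_rhs_bound (u : Rd -> R) x : measurable_fun setT u ->
  {ae leb R d, forall y, `|u y| <= M} -> `|u x| <= M ->
  `|rhs u x| <= 2 * alpha * M * expR K.
Proof.
move=> mu uM ux; rewrite /kinetic_rhs (le_trans (ler_normB _ _))// !normrM.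
have h1 := (conv_a_bound x mu M0 uM).2.
have h2 := expR_conv_bound x mu uM; have h3 := conv_a_expR_bound x mu uM.
have : `|conv a u x| * `|expR (- conv u phi x)| <= alpha * M * expR K by exact: ler_pM.
have : `|u x| * `|conv a (fun y => expR (- conv u phi y)) x| <= M * (alpha * expR K).
  exact: ler_pM.
by lra.
Qed.

Definition kinetic_lip := 2 * alpha * expR K * (1 + K).

Lemma kinetic_lip_ge0 : 0 <= kinetic_lip.
Proof. by rewrite /kinetic_lip !mulr_ge0 ?expR_ge0// addr_ge0. Qed.

Lemma kinetic_rhs_lipschitz (u v : Rd -> R) del x : measurable_fun setT u ->
  measurable_fun setT v -> 0 <= del ->
  {ae leb R d, forall y, `|u y| <= M} -> {ae leb R d, forall y, `|v y| <= M} ->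
  {ae leb R d, forall y, `|u y - v y| <= del} ->
  `|u x| <= M -> `|u x - v x| <= del ->
  `|rhs u x - rhs v x| <= kinetic_lip * del.
Proof.
move=> mu mv del0 uM vM uv ux uvx.
pose ex (w : Rd -> R) y := expR (- conv w phi y).
have exlip y : `|ex u y - ex v y| <= expR K * (Phi * del).
  apply: le_trans (expRN_lipschitz (K := K) _ _) _.
  - exact: (conv_phi_bound y mu M0 uM).2.
  - exact: (conv_phi_bound y mv M0 vM).2.
  - by rewrite ler_wpM2l ?expR_ge0//; exact: (conv_phi_sub y mu mv M0).
have -> : rhs u x - rhs v x = (conv a u x - conv a v x) * ex u x +
    conv a v x * (ex u x - ex v x) - ((u x - v x) * conv a (ex v) x +
    u x * (conv a (ex u) x - conv a (ex v) x)).
  have alg (cu cv pu pv u1 v1 au av : R) : cu * pu - u1 * au - (cv * pv - v1 * av) =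
      (cu - cv) * pu + cv * (pu - pv) - ((u1 - v1) * av + u1 * (au - av)) by ring.
  exact: alg.
have h1 : `|(conv a u x - conv a v x) * ex u x| <= alpha * del * expR K.
  rewrite normrM; apply: ler_pM => //; first exact: (conv_a_sub x mu mv M0).
  exact: expR_conv_bound.
have h2 : `|conv a v x * (ex u x - ex v x)| <= alpha * M * (expR K * (Phi * del)).
  by rewrite normrM; apply: ler_pM => //; exact: (conv_a_bound x mv M0 vM).2.
have h3 : `|(u x - v x) * conv a (ex v) x| <= del * (alpha * expR K).
  by rewrite normrM; apply: ler_pM => //; exact: conv_a_expR_bound.
have h4 : `|u x * (conv a (ex u) x - conv a (ex v) x)| <=
    M * (alpha * (expR K * (Phi * del))).
  rewrite normrM; apply: ler_pM => //.
  apply: (conv_a_sub (M := expR K)).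
  - exact: measurable_expR_conv.
  - exact: measurable_expR_conv.
  - exact: expR_ge0.
  - by rewrite !mulr_ge0 ?expR_ge0.
  - by apply: aeW => y; exact: expR_conv_bound.
  - by apply: aeW => y; exact: expR_conv_bound.
  - exact: aeW.
apply: (le_trans (ler_normB _ _)).
apply: (le_trans (lerD (ler_normD _ _) (ler_normD _ _))).
apply: (le_trans (lerD (lerD h1 h2) (lerD h3 h4))).
by rewrite /kinetic_lip /K le_eqVlt; apply/orP; left; apply/eqP; ring.
Qed.

End bounds.
End kinetic_field.

(** * Picard iteration *)

Section time_integrals.
Context (R : realType).
Local Notation lam := (@lebesgue_measure R).

Lemma Rintegral_expR (K t : R) : 0 <= t ->
  \int[lam]_(s in `[0, t]) (K * expR (K * s)) = expR (K * t) - 1.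
Proof.
rewrite le_eqVlt => /predU1P[<-|t0].
  by rewrite set_itv1 Rintegral_set1 mulr0 expR0 subrr.
have cF : continuous (fun s : R => expR (K * s)).
  move=> z; apply: continuous_comp; last exact: continuous_expR.
  by apply: continuousM => //; exact: cst_continuous.
have dF z : is_derive z (1 : R) (fun s : R => expR (K * s)) (K * expR (K * z)).
  have E : (fun s : R => expR (K * s)) = (fun s : R => 1 * expR (K * (s - 0) + 0)).
    by apply/funext => s; rewrite mul1r subr0 addr0.
  rewrite E; apply: (is_derive_eq (is_derive_expR_affine 1 K 0 0 z)).
  by rewrite mul1r subr0 addr0.
rewrite /Rintegral (continuous_FTC2 (F := fun s => expR (K * s)) t0).
- by rewrite -EFinB /= mulr0 expR0.
- apply: continuous_subspaceT => z; apply: cvgM; last exact: cF.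
  exact: cvg_cst.
- split.
  + move=> z _.
    by have [] := dF z.
  + by apply/cvg_at_right_filter; exact: cF.
  + by apply/cvg_at_left_filter; exact: cF.
- by move=> z _; rewrite derive1E; have [_ ->] := dF z.
Qed.

Lemma integrable_itv_bounded (g : R -> R) (a b B : R) : measurable_fun setT g ->
  (forall s, a <= s <= b -> `|g s| <= B) ->
  lam.-integrable `[a, b] (EFin \o g).
Proof.
move=> mg gB; apply: measurable_bounded_integrable => //.
- by rewrite /= lebesgue_measure_itv; case: ifP => _; rewrite /= -?EFinB ltry.
- exact: measurable_funS mg.
exists B; split; first exact: num_real.
by move=> x Bx s; rewrite /= in_itv /= => /gB h; exact: le_trans h (ltW Bx).
Qed.

Lemma Rintegral_itv_diff (g : R -> R) (T B t t' c e : R) : measurable_fun setT g ->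
  (forall s, 0 <= s <= T -> `|g s| <= B) -> 0 <= t -> t <= t' -> t' <= T ->
  (forall s, t <= s <= t' -> `|g s - c| <= e) ->
  `|\int[lam]_(s in `[0, t']) g s - \int[lam]_(s in `[0, t]) g s - (t' - t) * c| <=
    (t' - t) * e.
Proof.
move=> mg gB t0 tt' t'T gc.
have sub u v : 0 <= u -> v <= T -> lam.-integrable `[u, v] (EFin \o g).
  move=> u0 vT; apply: (integrable_itv_bounded (B := B)) => // s /andP[us sv].
  by apply: gB; rewrite (le_trans u0 us) (le_trans sv vT).
have int2 : lam.-integrable `]t, t'] (EFin \o g).
  apply: integrableS (sub t t' t0 t'T) => //; exact: subset_itv_oc_cc.
rewrite Rintegral_itvB ?bnd_simp//; last exact: sub.
rewrite Rintegral_itv_obnd_cbnd//.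
have cstE r : \int[lam]_(s in `[t, t']) r = (t' - t) * r.
  rewrite Rintegral_cst// /= lebesgue_measure_itv /= lte_fin.
  case: ltP => [_|h]; first by rewrite -EFinB /= mulrC.
  by rewrite (_ : t' = t) ?subrr ?mulr0 ?mul0r//; apply/eqP; rewrite eq_le h.
have intc r : lam.-integrable `[t, t'] (EFin \o cst r).
  by apply: (integrable_itv_bounded (B := `|r|)).
rewrite -cstE -RintegralB//; last 2 first.
- exact: sub.
- exact: (intc c).
have intgc : lam.-integrable `[t, t'] (EFin \o (fun s => g s - c)).
  apply: (integrable_itv_bounded (B := e)) => //.
  by apply: measurable_funB.
apply: le_trans (le_normr_Rintegral _ intgc) _ => //.
rewrite -cstE; apply: le_Rintegral => //.
- by apply: (integrable_itv_bounded (B := e)) => [|s /gc]; rewrite ?normr_id//;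
    apply: measurableT_comp => //; apply: measurable_funB.
- exact: intc.
Qed.

Lemma Rintegral_itv_le (g f : R -> R) (t : R) : 0 <= t -> measurable_fun setT g ->
  measurable_fun setT f -> lam.-integrable `[0, t] (EFin \o f) ->
  (forall s, 0 <= s <= t -> `|g s| <= f s) ->
  `|\int[lam]_(s in `[0, t]) g s| <= \int[lam]_(s in `[0, t]) f s.
Proof.
move=> t0 mg mf intf gf.
have intg : lam.-integrable `[0, t] (EFin \o g).
  apply: (le_integrable _ _ _ intf) => //.
  - by apply/measurable_EFinP; exact: measurable_funS mg.
  - move=> s /=; rewrite in_itv /= => /gf h; rewrite lee_fin.
    by apply: le_trans h _; exact: ler_norm.
apply: le_trans (le_normr_Rintegral _ intg) _ => //.
apply: le_Rintegral => //.
  rewrite (_ : _ \o _ = abse \o (EFin \o g))//; exact: integrable_abse.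
Qed.

(** The upper limit of integration is moved into the integrand, so that the integral
becomes one with a parameter over a fixed domain. *)
Lemma measurable_fun_time_integral d (X : measurableType d) (G : R * X -> R) :
  measurable_fun setT G ->
  measurable_fun setT (fun p : R * X => \int[lam]_(s in `[0, p.1]) G (s, p.2)).
Proof.
move=> mG.
rewrite (_ : (fun p => _) = (fun p : R * X =>
    \int[lam]_s (if (0 <= s) && (s <= p.1) then G (s, p.2) else 0))); last first.
  apply/funext => p; rewrite Rintegral_mkcond; apply: eq_Rintegral => s _.
  rewrite patchE; case: ifPn; case: ifPn => //.
    by move=> h; rewrite inE /= in_itv /= (negbTE h).
  by move=> h; rewrite notin_setE /= in_itv /= h => /(_ isT).
apply: (measurable_fun_Rintegral_param lam (f := fun q : (R * X) * R =>
  if (0 <= q.2) && (q.2 <= q.1.1) then G (q.2, q.1.2) else 0)).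
apply: measurable_fun_ifT => //.
  apply: measurable_and.
    by apply: measurable_fun_ler => //; exact: measurable_cst.
  by apply: measurable_fun_ler => //; exact: measurableT_comp.
apply: (measurableT_comp mG); apply: measurable_fun_pair => //.
exact: measurableT_comp.
Qed.

End time_integrals.

Section picard.
Context d (X : measurableType d) (R : realType).
Local Notation lam := (@lebesgue_measure R).
Variables (V : R -> (X -> R) -> X -> R) (u0 : X -> R).
Hypothesis mu0 : measurable_fun setT u0.
Hypothesis mV : forall sig : R * X -> R, measurable_fun setT sig ->
  measurable_fun setT (fun p : R * X => V p.1 (fun y => sig (p.1, y)) p.2).
Hypothesis bV : forall T, 0 <= T -> exists2 B, 0 <= B & forall s (u : X -> R) x, 0 <= s <= T ->
  measurable_fun setT u -> `|V s u x| <= B.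
Hypothesis lV : forall T, 0 <= T -> exists2 L, 0 < L & forall s (u v : X -> R) (del : R), 0 <= s <= T ->
  measurable_fun setT u -> measurable_fun setT v -> 0 <= del ->
  (forall y, `|u y - v y| <= del) -> forall x, `|V s u x - V s v x| <= L * del.

(** The field [V s] acts on whole functions of [x], nonlocally, so an iterate is a
jointly measurable function of time and space. *)
Definition picard_step (sig : R * X -> R) (p : R * X) : R :=
  u0 p.2 + \int[lam]_(s in `[0, p.1]) V s (fun y => sig (s, y)) p.2.

Fixpoint picard_iter n : R * X -> R :=
  if n is m.+1 then picard_step (picard_iter m) else fun p => u0 p.2.

Let mslice (sig : R * X -> R) s : measurable_fun setT sig ->
  measurable_fun setT (fun y => sig (s, y)).
Proof. by move=> ms; apply: (measurableT_comp ms); exact: measurable_fun_pair. Qed.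

Let mVt (sig : R * X -> R) x : measurable_fun setT sig ->
  measurable_fun setT (fun s => V s (fun y => sig (s, y)) x).
Proof.
move=> ms; apply: (measurableT_comp (mV ms) (g := fun s => (s, x))).
exact: measurable_fun_pair.
Qed.

Lemma measurable_picard_step sig : measurable_fun setT sig ->
  measurable_fun setT (picard_step sig).
Proof.
move=> ms; apply: measurable_funD; first exact: measurableT_comp.
apply: (measurable_fun_time_integral
  (G := fun q : R * X => V q.1 (fun y => sig (q.1, y)) q.2)).
exact: mV.
Qed.

Lemma measurable_picard_iter n : measurable_fun setT (picard_iter n).
Proof.
elim: n => [|n IH] /=; first exact: measurableT_comp.
exact: measurable_picard_step.
Qed.

Lemma picard_step_diff sig t t' x T B c e : measurable_fun setT sig ->
  (forall s (u : X -> R) x, 0 <= s <= T -> measurable_fun setT u -> `|V s u x| <= B) ->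
  0 <= t -> t <= t' -> t' <= T ->
  (forall s, t <= s <= t' -> `|V s (fun y => sig (s, y)) x - c| <= e) ->
  `|picard_step sig (t', x) - picard_step sig (t, x) - (t' - t) * c| <= (t' - t) * e.
Proof.
move=> ms HB t0 tt' t'T ec; rewrite /picard_step /= opprD addrACA subrr add0r.
apply: (Rintegral_itv_diff (T := T) (B := B)) => //; first exact: mVt.
by move=> s sT; apply: HB => //; exact: mslice.
Qed.

Lemma picard_step0 sig x : picard_step sig (0, x) = u0 x.
Proof. by rewrite /picard_step /= set_itv1 Rintegral_set1 addr0. Qed.

Lemma picard_step_neg sig t x : t < 0 -> picard_step sig (t, x) = u0 x.
Proof.
move=> t0; rewrite /picard_step /= set_itv_ge ?Rintegral_set0 ?addr0//.
by rewrite bnd_simp -ltNge.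
Qed.

Lemma picard_step_lipschitz sig t t' x T B : measurable_fun setT sig ->
  (forall s (u : X -> R) x, 0 <= s <= T -> measurable_fun setT u -> `|V s u x| <= B) ->
  0 <= t -> t <= t' -> t' <= T ->
  `|picard_step sig (t', x) - picard_step sig (t, x)| <= (t' - t) * B.
Proof.
move=> ms HB t0 tt' t'T.
have := @picard_step_diff sig t t' x T B 0 B ms HB t0 tt' t'T.
rewrite mulr0 subr0; apply => s /andP[ts st'].
rewrite subr0; apply: HB; last exact: mslice.
by rewrite (le_trans t0 ts) (le_trans st' t'T).
Qed.

(** With the weight [exp(2 L s)] one step halves the distance on the whole of
[[0, T]], however large [T] is. *)
Lemma picard_step_contract (sig tau : R * X -> R) (T B L C : R) : measurable_fun setT sig ->
  measurable_fun setT tau -> 0 < L -> 0 <= C ->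
  (forall s (u : X -> R) x, 0 <= s <= T -> measurable_fun setT u -> `|V s u x| <= B) ->
  (forall s (u v : X -> R) (del : R), 0 <= s <= T -> measurable_fun setT u -> measurable_fun setT v ->
    0 <= del -> (forall y, `|u y - v y| <= del) ->
    forall x, `|V s u x - V s v x| <= L * del) ->
  (forall s x, 0 <= s <= T -> `|sig (s, x) - tau (s, x)| <= C * expR (2 * L * s)) ->
  forall t x, 0 <= t <= T ->
    `|picard_step sig (t, x) - picard_step tau (t, x)| <= C / 2 * expR (2 * L * t).
Proof.
move=> ms mt L0 C0 HB HL H t x /andP[t0 tT].
have sT s : s \in `[0, t] -> 0 <= s <= T.
  by rewrite in_itv /= => /andP[-> st]; rewrite (le_trans st).
have intV sg : measurable_fun setT sg ->
    lam.-integrable `[0, t] (EFin \o (fun s => V s (fun y => sg (s, y)) x)).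
  move=> msg; apply: (integrable_itv_bounded (B := B)); first exact: mVt.
  by move=> s st; apply: HB; [apply: sT; rewrite in_itv|exact: mslice].
have mexp : measurable_fun setT (fun s : R => expR (2 * L * s)).
  by apply: measurableT_comp => //; apply: measurable_funM.
have intexp c : lam.-integrable `[0, t] (EFin \o (fun s => c * expR (2 * L * s))).
  apply: (integrable_itv_bounded (B := `|c| * expR (2 * L * t))).
    exact: measurable_funM.
  move=> s /andP[_ st]; rewrite normrM ler_wpM2l// ger0_norm ?expR_ge0//.
  by rewrite ler_expR ler_pM2l// mulr_gt0.
rewrite /picard_step /= opprD addrACA subrr add0r -RintegralB//; [|exact: intV|exact: intV].
apply: (@le_trans _ _ (\int[lam]_(s in `[0, t]) (C / 2 * (2 * L * expR (2 * L * s))))).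
  apply: Rintegral_itv_le => //.
  - by apply: measurable_funB; exact: mVt.
  - by do 2 apply: measurable_funM => //.
  - rewrite [X in _.-integrable _ X](_ : _ =
      EFin \o (fun s => C / 2 * (2 * L) * expR (2 * L * s))); first exact: intexp.
    by apply/funext => s /=; rewrite -!mulrA.
  move=> s st; have sT' := sT s; rewrite in_itv in sT'; have s0T := sT' st.
  rewrite (_ : C / 2 * _ = L * (C * expR (2 * L * s))); last by field.
  apply: HL => //; [exact: mslice|exact: mslice|by rewrite mulr_ge0 ?expR_ge0|].
  by move=> y; exact: H.
rewrite (RintegralZl (C / 2) _ (intexp (2 * L)))//.
rewrite Rintegral_expR// ler_wpM2l ?divr_ge0// lerBlDr lerDl.
exact: ler01.
Qed.

Lemma picard_iter_cauchy (T B L : R) : 0 <= T -> 0 <= B -> 0 < L ->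
  (forall s (u : X -> R) x, 0 <= s <= T -> measurable_fun setT u -> `|V s u x| <= B) ->
  (forall s (u v : X -> R) (del : R), 0 <= s <= T -> measurable_fun setT u ->
    measurable_fun setT v -> 0 <= del -> (forall y, `|u y - v y| <= del) ->
    forall x, `|V s u x - V s v x| <= L * del) ->
  forall n m t x, 0 <= t <= T ->
  `|picard_iter (n + m) (t, x) - picard_iter n (t, x)| <=
    T * B / 2 ^+ n * expR (2 * L * t).
Proof.
move=> T0 B0 L0 HB HL n; elim: n => [|n IH] m t x tT.
  rewrite add0n expr0 divr1.
  apply: (@le_trans _ _ (T * B)); last first.
    rewrite ler_peMr ?mulr_ge0// -expR0 ler_expR.
    by case/andP: tT => t0 _; rewrite !mulr_ge0// ltW.
  case: m => [|m] /=; first by rewrite subrr normr0 mulr_ge0.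
  have /andP[t0 tT'] := tT.
  have := picard_step_lipschitz x (measurable_picard_iter m) HB (lexx 0) t0 tT'.
  rewrite picard_step0 subr0 => /le_trans; apply.
  by rewrite ler_wpM2r.
rewrite addSn /= exprSr invfM mulrA.
apply: (picard_step_contract (T := T) (B := B)) => //.
- exact: measurable_picard_iter.
- exact: measurable_picard_iter.
- by rewrite divr_ge0// ?mulr_ge0// exprn_ge0.
- by move=> s y sT; exact: IH.
Qed.

Lemma picard : exists2 sig : R * X -> R, measurable_fun setT sig &
  forall t x, sig (t, x) = picard_step sig (t, x).
Proof.
pose w := fun p : R * X => fun n => picard_iter n p.
have cvw p : cvgn (w p).
  case: p => t x; have [t0|t0] := ltP t 0.
    apply/cvg_ex; exists (u0 x); apply: cvg_near_cst; apply: nearW => n.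
    by rewrite /w /=; case: n => //= n; rewrite picard_step_neg.
  have [B B0 HB] := bV t0; have [L L0 HL] := lV t0.
  (* [C] bounds the distance between the zeroth iterate and any later one. *)
  pose C := t * B; have C0 : 0 <= C by exact: mulr_ge0.
  have H := picard_iter_cauchy t0 B0 L0 HB HL.
  apply/cauchy_cvgP/cauchy_ballP => e e0.
  have C'0 : 0 <= C * expR (2 * L * t) by rewrite mulr_ge0 ?expR_ge0.
  have e30 : 0 < e / 3 by rewrite divr_gt0.
  have [N HN] := half_pow_le C'0 e30.
  have HN' n : (N <= n)%N -> `|w (t, x) n - w (t, x) N| <= e / 3.
    move=> Nn; apply: le_trans HN; rewrite /w -(subnKC Nn).
    by rewrite (le_trans (H _ _ _ _ _)) ?t0 ?lexx// mulrAC.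
  pose W := [set y : R | `|y - w (t, x) N| <= e / 3].
  have WN : (w (t, x) @ \oo) W by exists N => // n /HN'.
  exists (W, W) => // -[y z] /= [h1 h2]; rewrite /ball /=.
  have -> : y - z = (y - w (t, x) N) - (z - w (t, x) N) by ring.
  rewrite /W /= in h1 h2.
  by apply: le_lt_trans (ler_normB _ _) _; lra.
pose sig p := limn (w p).
have msig : measurable_fun setT sig.
  apply: (measurable_fun_cvg (h := picard_iter)); first exact: measurable_picard_iter.
  by move=> p _; exact: cvw.
exists sig => // t x; have [t0|t0] := ltP t 0.
  rewrite picard_step_neg// /sig; apply/cvg_lim => //.
  apply: cvg_near_cst; apply: nearW => n.
  by rewrite /w /=; case: n => //= n; rewrite picard_step_neg.
have [B B0 HB] := bV t0; have [L L0 HL] := lV t0.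
pose C := t * B; have C0 : 0 <= C by exact: mulr_ge0.
have H := picard_iter_cauchy t0 B0 L0 HB HL.
have lim n s y : 0 <= s <= t -> `|sig (s, y) - picard_iter n (s, y)| <=
    C / 2 ^+ n * expR (2 * L * s).
  move=> st; apply/ler_addgt0Pr => e e0.
  have /cvgrPdist_le /(_ e e0) [N _ HN] := cvw (s, y).
  have := HN (n + N)%N (leq_addl _ _); rewrite -/(sig _) => h1.
  have h2 := H n N s y st.
  rewrite -(subrK (picard_iter (n + N) (s, y)) (sig (s, y))) -addrA.
  by apply: le_trans (ler_normD _ _) _; rewrite [leLHS]addrC; exact: lerD h2 h1.
apply/eqP; rewrite -subr_eq0 -normr_le0; apply/ler_addgt0Pr => e e0.
rewrite add0r.
have C'0 : 0 <= C * expR (2 * L * t) by rewrite mulr_ge0 ?expR_ge0.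
have [n Hn] := half_pow_le C'0 e0.
have tt : 0 <= t <= t by rewrite t0 lexx.
have h1 := lim n.+1 t x tt.
have Cn0 : 0 <= C / 2 ^+ n by rewrite divr_ge0// exprn_ge0.
have h2 : `|picard_step sig (t, x) - picard_step (picard_iter n) (t, x)| <=
    C / 2 ^+ n / 2 * expR (2 * L * t).
  apply: (picard_step_contract (T := t) (B := B)) => //.
    exact: measurable_picard_iter.
  by move=> s y; exact: lim.
rewrite -(subrK (picard_iter n.+1 (t, x)) (sig (t, x))) -addrA.
apply: le_trans (ler_normD _ _) _; rewrite [X in _ + X]distrC.
apply: (le_trans (lerD h1 h2)); apply: le_trans Hn.
by rewrite exprSr le_eqVlt; apply/orP; left; apply/eqP; field.
Qed.

End picard.

(** * The kinetic equation *)

Section kinetic_existence.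
Context (R : realType) (d : nat).
Local Notation Rd := (Rvec R d).
Variables (a phi : Rd -> R) (alpha Phi : R).
Hypothesis (ma : measurable_fun setT a) (mphi : measurable_fun setT phi).
Hypothesis (a_ge0 : forall x, 0 <= a x) (phi_ge0 : forall x, 0 <= phi x).
Hypothesis a_int : (\int[leb R d]_x (a x)%:E = alpha%:E)%E.
Hypothesis phi_int : (\int[leb R d]_x (phi x)%:E = Phi%:E)%E.
Variables (rho0 : Rd -> R) (c : R).
Hypothesis mrho0 : measurable_fun setT rho0.
Hypothesis c0 : 0 <= c.
Hypothesis rho0_bound : forall x, 0 <= rho0 x <= c.
Local Notation rhs := (kinetic_rhs a phi).

Let alpha0 : 0 <= alpha. Proof. exact: alpha_ge0 a_ge0 a_int. Qed.

(** The upper edge [c * exp(alpha * s)] of the invariant band, in the shape that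
[is_derive_expR_affine] differentiates. *)
Definition envelope (s : R) := c * expR (alpha * (s - 0) + 0).

Lemma envelope_ge0 s : 0 <= envelope s.
Proof. by rewrite mulr_ge0 ?expR_ge0. Qed.

Lemma envelope_le s t : s <= t -> envelope s <= envelope t.
Proof. by move=> st; rewrite ler_wpM2l// ler_expR !subr0 !addr0 ler_wpM2l. Qed.

Definition truncate s (u : Rd -> R) y := Num.max 0 (Num.min (u y) (envelope s)).

Lemma truncate_bound s u y : 0 <= truncate s u y <= envelope s.
Proof.
by rewrite /truncate le_max lexx /= ge_max envelope_ge0 ge_min lexx orbT.
Qed.

Lemma truncate_diff s t u v y :
  `|truncate s u y - truncate t v y| <= `|u y - v y| + `|envelope s - envelope t|.
Proof.
rewrite /truncate; have es := envelope_ge0 s; have et := envelope_ge0 t.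
have h1 := ler_norm (u y - v y); have h2 := ler_norm (v y - u y).
have h3 := ler_norm (envelope s - envelope t); have h4 := ler_norm (envelope t - envelope s).
rewrite distrC in h2; rewrite distrC in h4.
rewrite ler_norml; apply/andP; split;
  case: (leP (u y) (envelope s)) => ?; case: (leP (v y) (envelope t)) => ?;
  rewrite ?(max_r es) ?(max_r et); case: (leP 0 (u y)) => ?; case: (leP 0 (v y)) => ?; lra.
Qed.

Lemma truncate_id s u y : 0 <= u y <= envelope s -> truncate s u y = u y.
Proof. by move=> /andP[h1 h2]; rewrite /truncate min_l// max_r. Qed.

Lemma measurable_truncate s u : measurable_fun setT u -> measurable_fun setT (truncate s u).
Proof.
move=> mu; apply: measurable_maxr; first exact: measurable_cst.
by apply: measurable_minr => //; exact: measurable_cst.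
Qed.

Definition truncated_rhs s u x := rhs (truncate s u) x.

Lemma measurable_fun_conv2 d' (Y : measurableType d') (f g : Y * Rd -> R) :
  measurable_fun setT f -> measurable_fun setT g ->
  measurable_fun setT (fun p : Y * Rd =>
    conv (fun y => f (p.1, y)) (fun y => g (p.1, y)) p.2).
Proof.
move=> mf mg; apply: (measurable_fun_Rintegral_param (leb R d)
  (f := fun q : (Y * Rd) * Rd => f (q.1.1, vsub q.1.2 q.2) * g (q.1.1, q.2))).
have m11 : measurable_fun setT (fun q : (Y * Rd) * Rd => q.1.1) by exact: measurableT_comp.
have m12 : measurable_fun setT (fun q : (Y * Rd) * Rd => q.1.2) by exact: measurableT_comp.
apply: measurable_funM.
  apply: (measurableT_comp mf); apply: measurable_fun_pair => //.
  exact: measurable_fun_vsub.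
by apply: (measurableT_comp mg); exact: measurable_fun_pair.
Qed.

Lemma measurable_truncated_rhs (sig : R * Rd -> R) : measurable_fun setT sig ->
  measurable_fun setT (fun p : R * Rd => truncated_rhs p.1 (fun y => sig (p.1, y)) p.2).
Proof.
move=> ms.
pose w (p : R * Rd) := truncate p.1 (fun y => sig (p.1, y)) p.2.
have mw : measurable_fun setT w.
  apply: measurable_maxr; first exact: measurable_cst.
  apply: measurable_minr.
    by rewrite (_ : (fun p => _) = sig)//; apply/funext => -[].
  apply: measurable_funM => //; apply: measurableT_comp => //.
  apply: measurable_funD => //; apply: measurable_funM => //.
  exact: measurable_funB.
pose ex (p : R * Rd) := expR (- conv (fun y => w (p.1, y)) phi p.2).
have mex : measurable_fun setT ex.
  apply: measurableT_comp => //; apply: measurable_funN.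
  apply: (measurable_fun_conv2 (f := w) (g := fun p => phi p.2)) => //.
  exact: measurableT_comp.
rewrite (_ : (fun p => _) = (fun p : R * Rd =>
    conv (fun y => a y) (fun y => w (p.1, y)) p.2 * ex p -
    w p * conv (fun y => a y) (fun y => ex (p.1, y)) p.2)); last first.
  by apply/funext => -[s x].
have ma2 : measurable_fun setT (fun p : R * Rd => a p.2) by exact: measurableT_comp.
apply: measurable_funB; apply: measurable_funM => //.
- exact: (measurable_fun_conv2 (f := fun p => a p.2) (g := w)).
- exact: (measurable_fun_conv2 (f := fun p => a p.2) (g := ex)).
Qed.

Let truncate_norm T s u y : s <= T -> `|truncate s u y| <= envelope T.
Proof.
move=> sT; have /andP[h1 h2] := truncate_bound s u y.
by rewrite ger0_norm// (le_trans h2)// envelope_le.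
Qed.

Let bnd T := 2 * alpha * envelope T * expR (Phi * envelope T).
Let lip T := kinetic_lip alpha Phi (envelope T) + 1.

Let bnd_ge0 T : 0 <= bnd T.
Proof. by rewrite !mulr_ge0 ?expR_ge0// envelope_ge0. Qed.

Let truncated_rhs_bound T s u x : 0 <= s <= T -> measurable_fun setT u ->
  `|truncated_rhs s u x| <= bnd T.
Proof.
move=> /andP[_ sT] mu; apply: (kinetic_rhs_bound ma mphi a_ge0 phi_ge0 a_int phi_int).
- exact: envelope_ge0.
- exact: measurable_truncate.
- by apply: aeW => y; exact: truncate_norm.
- exact: truncate_norm.
Qed.

Let truncated_rhs_diff (T s t : R) (u v : Rd -> R) (del : R) x : s <= T -> t <= T ->
  measurable_fun setT u -> measurable_fun setT v -> 0 <= del ->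
  (forall y, `|u y - v y| + `|envelope s - envelope t| <= del) ->
  `|truncated_rhs s u x - truncated_rhs t v x| <= lip T * del.
Proof.
move=> sT tT mu mv del0 uv.
have uv' y : `|truncate s u y - truncate t v y| <= del.
  exact: le_trans (truncate_diff _ _ _ _ _) (uv y).
apply: (@le_trans _ _ (kinetic_lip alpha Phi (envelope T) * del)); last first.
  by rewrite ler_wpM2r// lerDl.
apply: (kinetic_rhs_lipschitz ma mphi a_ge0 phi_ge0 a_int phi_int) => //.
- exact: envelope_ge0.
- exact: measurable_truncate.
- exact: measurable_truncate.
- by apply: aeW => y; exact: truncate_norm.
- by apply: aeW => y; exact: truncate_norm.
- exact: aeW.
- exact: truncate_norm.
Qed.

Let lip_gt0 T : 0 < lip T.
Proof. rewrite ltr_wpDl//; apply: (kinetic_lip_ge0 a_ge0 phi_ge0 a_int phi_int).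
exact: envelope_ge0. Qed.

(** The solution of the truncated equation never leaves the band, hence solves the
original equation.  All statements hold at every point [x], uniformly in [x],
which gives continuity and differentiability in every norm needed later. *)
Lemma kinetic_exists : exists rho : R -> Rd -> R,
  [/\ rho 0 = rho0,
      forall t, measurable_fun setT (rho t),
      forall t x, 0 <= t -> 0 <= rho t x <= c * expR (alpha * t),
      forall t, 0 <= t -> forall e, 0 < e -> exists2 del, 0 < del &
        forall s, 0 <= s -> `|s - t| < del -> forall x,
          `|rho s x - rho t x| <= e /\ `|rhs (rho s) x - rhs (rho t) x| <= e &
      forall t, 0 < t -> forall e, 0 < e -> exists2 del, 0 < del &
        forall h, `|h| < del -> 0 <= t + h /\ forall x,
          `|rho (t + h) x - rho t x - h * rhs (rho t) x| <= `|h| * e].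
Proof.
have [||sig msig sigE] := picard mrho0 measurable_truncated_rhs.
- by move=> T _; exists (bnd T); first exact: bnd_ge0; move=> s u x sT mu; exact: truncated_rhs_bound.
- move=> T _; exists (lip T); first exact: lip_gt0; move=> s u v del /andP[_ sT] mu mv del0 uv x.
  by apply: truncated_rhs_diff => // y; rewrite subrr normr0 addr0.
pose rho t x := sig (t, x).
have mrho t : measurable_fun setT (rho t).
  by apply: (measurableT_comp msig); exact: measurable_fun_pair.
have rhoE t x : rho t x = picard_step truncated_rhs rho0 sig (t, x) by rewrite /rho sigE.
have rho_lip T s t x : 0 <= s <= T -> 0 <= t <= T -> `|rho s x - rho t x| <= `|s - t| * bnd T.
  have le u v : 0 <= u <= T -> 0 <= v <= T -> u <= v ->
      `|rho v x - rho u x| <= `|v - u| * bnd T.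
    move=> /andP[u0 _] /andP[_ vT] uv; rewrite !rhoE.
    have -> : `|v - u| = v - u by rewrite ger0_norm ?subr_ge0.
    apply: (picard_step_lipschitz rho0 measurable_truncated_rhs x msig _ u0 uv vT).
    by move=> r w y rT mw; exact: truncated_rhs_bound.
  move=> sT tT; have [st|ts] := leP s t; last by apply: le => //; exact: ltW.
  by rewrite distrC (distrC s); exact: le.
have V_cont t e : 0 <= t -> 0 < e -> exists2 del, 0 < del & forall s, 0 <= s ->
    `|s - t| < del -> forall x,
    `|rho s x - rho t x| <= e /\
    `|truncated_rhs s (rho s) x - truncated_rhs t (rho t) x| <= e.
  move=> t0 e0; pose T := t + 1.
  (* [eta] pays for the drift of the solution and of the band edge, one half each. *)
  pose eta := Num.min e (e / lip T).
  have eta0 : 0 < eta by rewrite lt_min e0 divr_gt0.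
  have [d1 d10 H1] := is_derive_eps_continuous
    (is_derive_expR_affine c alpha 0 0 t) (divr_gt0 eta0 (ltr0n R 2)).
  have b1 : 0 < bnd T + 1 by rewrite ltr_wpDl.
  exists (Num.min 1 (Num.min d1 (eta / 2 / (bnd T + 1)))).
    by rewrite !lt_min ltr01 d10 !divr_gt0.
  move=> s s0; rewrite !lt_min => /and3P[st1 st2 st3] x.
  have sT : s <= T by move: st1; rewrite ltr_norml => /andP[_]; rewrite /T; lra.
  have tT : t <= T by rewrite /T; lra.
  have rho_eta y : `|rho s y - rho t y| <= eta / 2.
    apply: le_trans (rho_lip T s t y _ _) _; rewrite ?s0 ?t0//.
    apply: (@le_trans _ _ (`|s - t| * (bnd T + 1))); first by rewrite ler_wpM2l// lerDl.
    by rewrite -ler_pdivlMr// ltW.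
  have etae : eta <= e by rewrite /eta ge_min lexx.
  split; first by rewrite (le_trans (rho_eta x))//; lra.
  apply: (@le_trans _ _ (lip T * eta)).
    apply: truncated_rhs_diff => //; first exact: ltW.
    by move=> y; have := rho_eta y; have := H1 s st2; rewrite -/(envelope s) -/(envelope t); lra.
  by rewrite mulrC -ler_pdivlMr// /eta ge_min lexx orbT.
have V_diff t e : 0 <= t -> 0 < e -> exists2 del, 0 < del & forall h, `|h| < del ->
    0 <= t + h -> forall x,
    `|rho (t + h) x - rho t x - h * truncated_rhs t (rho t) x| <= `|h| * e.
  move=> t0 e0; have [del del0 H] := V_cont t e t0 e0; exists del => // h hd th0 x.
  have [h0|h0] := leP 0 h.
    rewrite !rhoE (ger0_norm h0).
    have := picard_step_diff rho0 measurable_truncated_rhs (x := x) (T := t + h)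
      (B := bnd (t + h)) (c := truncated_rhs t (rho t) x) (e := e) (t := t) (t' := t + h) msig.
    rewrite (_ : t + h - t = h); last by ring.
    apply => //; first by move=> r w y rT mw; exact: truncated_rhs_bound.
      by rewrite lerDl.
    move=> s /andP[ts sth]; apply: (H s _ _ x).2; first exact: le_trans ts.
    rewrite ger0_norm ?subr_ge0//; move: hd; rewrite ger0_norm//; lra.
  rewrite !rhoE (ltr0_norm h0).
  have G := picard_step_diff rho0 measurable_truncated_rhs (x := x) (T := t)
    (B := bnd t) (c := truncated_rhs t (rho t) x) (e := e) (t := t + h) (t' := t) msig.
  have e1 : t - (t + h) = - h by ring.
  rewrite e1 in G.
  set A := picard_step _ _ _ (t, x) in G *; set B := picard_step _ _ _ (t + h, x) in G *.
  have -> : B - A - h * truncated_rhs t (rho t) x =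
    - (A - B - - h * truncated_rhs t (rho t) x) by ring.
  rewrite normrN.
  apply: G => //; first by move=> r w y rT mw; exact: truncated_rhs_bound.
    by rewrite gerDl ltW.
  move=> s /andP[ths st]; apply: (H s _ _ x).2; first exact: le_trans ths.
  rewrite distrC ger0_norm ?subr_ge0//; move: hd; rewrite ltr0_norm//; lra.
(* Along the truncation the gain term is at most the slope of the upper edge. *)
have V_up s u x : measurable_fun setT u -> truncated_rhs s u x <= alpha * envelope s.
  move=> mu; have mw := measurable_truncate s mu.
  have wb y : `|truncate s u y| <= envelope s by exact: truncate_norm.
  have w0 y : 0 <= truncate s u y by case/andP: (truncate_bound s u y).
  have h1 : conv a (truncate s u) x <= alpha * envelope s.
    apply: le_trans (ler_norm _) _.
    exact: (conv_a_bound ma a_ge0 a_int x mw (envelope_ge0 s) (aeW _ wb)).2.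
  have h2 : 0 <= conv a (truncate s u) x by apply: Rintegral_ge0 => y _; rewrite mulr_ge0.
  have h3 : expR (- conv (truncate s u) phi x) <= 1.
    by rewrite -expR0 ler_expR oppr_le0; apply: Rintegral_ge0 => y _; rewrite mulr_ge0.
  have h4 : 0 <= truncate s u x * conv a (fun y => expR (- conv (truncate s u) phi y)) x.
    by rewrite mulr_ge0//; apply: Rintegral_ge0 => y _; rewrite mulr_ge0 ?expR_ge0.
  have h5 := le_trans (ler_piMr h2 h3) h1.
  by rewrite /truncated_rhs /kinetic_rhs; lra.
(* Below zero the truncated value is zero, so there is no loss. *)
have V_lo s (u : Rd -> R) x : u x <= 0 -> 0 <= truncated_rhs s u x.
  move=> ux; rewrite /truncated_rhs /kinetic_rhs.
  have -> : truncate s u x = 0.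
    by rewrite /truncate max_l// ge_min ux.
  rewrite mul0r subr0 mulr_ge0 ?expR_ge0//; apply: Rintegral_ge0 => y _.
  by rewrite mulr_ge0//; case/andP: (truncate_bound s u y).
have rho_cont T x : 0 <= T -> eps_continuous_on 0 T (rho ^~ x).
  move=> T0 t /andP[t0 tT] e e0; have b1 : 0 < bnd T + 1 by rewrite ltr_wpDl.
  exists (e / (bnd T + 1)); first exact: divr_gt0.
  move=> s /andP[s0 sT]; rewrite ltr_pdivlMr// => st.
  apply: le_trans (rho_lip T s t x _ _) _; rewrite ?s0 ?t0 ?ltW//.
  by apply: le_lt_trans st; rewrite ler_wpM2l// lerDl.
have rho_up t x : 0 <= t -> rho t x <= envelope t.
  suff H T : 0 <= T -> forall t, 0 <= t < T -> rho t x <= envelope t.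
    by move=> t0; apply: (H (t + 1)); rewrite ?addr_ge0// t0 ltrDl ltr01.
  move=> T0; apply: (barrier (rho_cont _ x T0)
    (fun t => is_derive_expR_affine c alpha 0 0 t)); last first.
    rewrite rhoE picard_step0 subr0 mulr0 addr0 expR0 mulr1.
    by case/andP: (rho0_bound x).
  move=> r /andP[r0 rT] _ e e0; have [del del0 H] := V_diff r e (ltW r0) e0.
  exists del => // h /andP[h0 hd] _.
  have rh0 : 0 <= r + h by rewrite addr_ge0 ?ltW.
  have := H h; rewrite gtr0_norm// => /(_ hd rh0 x).
  rewrite ler_norml => /andP[_ h1].
  have h2 : h * truncated_rhs r (rho r) x <= h * (alpha * envelope r).
    by rewrite ler_pM2l// V_up.
  have -> : c * alpha * expR (alpha * (r - 0) + 0) = alpha * envelope r.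
    by rewrite /envelope; ring.
  by rewrite mulrDr; lra.
have rho_lo t x : 0 <= t -> 0 <= rho t x.
  suff H T : 0 <= T -> forall t, 0 <= t < T -> - rho t x <= 0.
    by move=> t0; rewrite -oppr_le0; apply: (H (t + 1)); rewrite ?addr_ge0// t0 ltrDl ltr01.
  move=> T0; apply: (barrier (g := fun t => - rho t x) (f := cst 0) (f' := cst 0)).
  - move=> r rT e e0; have [del del0 H] := rho_cont T x T0 r rT e e0.
    exists del => // s sT sr; rewrite -opprD normrN; exact: H.
  - move=> r /andP[r0 rT]; rewrite /= oppr_gt0 => rneg e e0.
    have [del del0 H] := V_diff r e (ltW r0) e0.
    exists del => // h /andP[h0 hd] _.
    have rh0 : 0 <= r + h by rewrite addr_ge0 ?ltW.
    have := H h; rewrite gtr0_norm// => /(_ hd rh0 x).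
    rewrite ler_norml => /andP[h1 _].
    have h2 : 0 <= h * truncated_rhs r (rho r) x.
      by rewrite mulr_ge0 ?(ltW h0)// V_lo// ltW.
    by rewrite add0r; lra.
  - rewrite /= oppr_le0 rhoE picard_step0.
    by case/andP: (rho0_bound x).
have VE t x : 0 <= t -> truncated_rhs t (rho t) x = rhs (rho t) x.
  move=> t0; congr kinetic_rhs; apply/funext => y; apply: truncate_id.
  by rewrite rho_lo// rho_up.
exists rho; split => //.
- by apply/funext => x; rewrite rhoE picard_step0.
- by move=> t x t0; rewrite rho_lo//= (le_trans (rho_up t x t0))// /envelope subr0 addr0.
- move=> t t0 e e0; have [del del0 H] := V_cont t e t0 e0.
  exists del; first exact: del0.
  move=> s s0 st x; rewrite -(VE s x s0) -(VE t x t0); exact: H.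
- move=> t t0 e e0; have [del del0 H] := V_diff t e (ltW t0) e0.
  exists (Num.min del t); first by rewrite lt_min del0.
  move=> h; rewrite lt_min => /andP[hd ht].
  have th0 : 0 <= t + h by move: ht; rewrite ltr_norml => /andP[]; lra.
  split; first exact: th0.
  move=> x; rewrite -(VE t x (ltW t0)); exact: H.
Qed.

End kinetic_existence.

Section kinetic_uniqueness.
Context (R : realType) (d : nat).
Local Notation Rd := (Rvec R d).
Variables (a phi : Rd -> R) (alpha Phi : R).
Hypothesis (ma : measurable_fun setT a) (mphi : measurable_fun setT phi).
Hypothesis (a_ge0 : forall x, 0 <= a x) (phi_ge0 : forall x, 0 <= phi x).
Hypothesis a_int : (\int[leb R d]_x (a x)%:E = alpha%:E)%E.
Hypothesis phi_int : (\int[leb R d]_x (phi x)%:E = Phi%:E)%E.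
Local Notation rhs := (kinetic_rhs a phi).

Lemma LinftyP (f : Rd -> R) : Linfty f <-> measurable_fun setT f /\
  exists2 M, 0 <= M & {ae leb R d, forall x, `|f x| <= M}.
Proof.
rewrite /Linfty /mkset; split.
  rewrite inE => /andP[]; rewrite inE => mf; rewrite inE => ff.
  by split => //; exact: Linfty_ae_bounded.
move=> [mf [M M0 fM]]; rewrite inE; apply/andP; split; rewrite inE//.
rewrite /= /finite_norm; apply: le_lt_trans (ltry M).
exact/Lnorm_inftyP.
Qed.

Lemma kinetic_solution_extract rho0 rho T : kinetic_solution a phi rho0 rho ->
  [/\ forall t, 0 <= t < T -> measurable_fun setT (rho t) /\
        exists2 M, 0 <= M & {ae leb R d, forall x, `|rho t x| <= M},
      ess_continuous (leb R d) 0 T rho,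
      ess_derivative (leb R d) 0 T rho (fun t => rhs (rho t)) &
      {ae leb R d, forall x, rho 0 x = rho0 x}].
Proof.
move=> [[D C [v [_ dv _ vE]]] r0].
have N0 (f : Rd -> R) : (0 <= 'N[leb R d]_+oo[EFin \o f])%E by exact: Lnorm_ge0.
have inI (t : R) : 0 <= t -> [set` `[0, +oo[ : interval R] t.
  by move=> t0; rewrite /= in_itv /= t0.
split.
- by move=> t /andP[t0 _]; apply/LinftyP; exact: D (inI t t0).
- move=> t /andP[t0 tT] e e0.
  have [del del0 H] := (continuous_onP N0 _ _).1 C t (inI t t0) e e0.
  exists del => // s /andP[s0 sT] st; apply/(Lnorm_inftyP _ _ (ltW e0)).
  exact: H (inI s s0) st.
- move=> t /andP[t0 tT] e e0.
  have It : ([set` `[0, +oo[ : interval R])° t.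
    by rewrite interior_itv_bndy /= in_itv /= t0.
  have [del del0 H] := (derivative_onP N0 _ _ _).1 dv t It e e0.
  exists del => // h /andP[h0 hd] thT.
  have := H h; rewrite gt_eqF// gtr0_norm// => /(_ isT hd).
  move=> /(Lnorm_inftyP _ _ (ltW e0)) h1.
  move: h1 (vE t It); apply: filterS2 => x h1 h2; rewrite -[rhs _ _]h2//.
- by apply: filterS r0 => x; exact.
Qed.

(** Near each time both solutions are bounded, so the field is Lipschitz along them
and [ess_gronwall] extends the agreement a little further. *)
Lemma kinetic_unique rho0 rho1 rho2 : kinetic_solution a phi rho0 rho1 ->
  kinetic_solution a phi rho0 rho2 ->
  forall t, 0 <= t -> rho1 t = rho2 t %[ae leb R d].
Proof.
move=> k1 k2.
suff H T : forall t, 0 <= t < T -> {ae leb R d, forall x, `|rho1 t x - rho2 t x| <= 0}.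
  move=> t t0; have tT : 0 <= t < t + 1 by rewrite t0 ltrDl ltr01.
  by apply: filterS (H _ _ tT) => x; rewrite normr_le0 subr_eq0 => /eqP.
have [B1 C1 D1 I1] := kinetic_solution_extract T k1.
have [B2 C2 D2 I2] := kinetic_solution_extract T k2.
have C := ess_continuous_sub C1 C2; have D := ess_derivative_sub D1 D2.
apply: real_induction.
- move: I1 I2; apply: filterS2 => x -> ->; by rewrite subrr normr0.
- move=> t tT Pt; have /andP[t0 tT'] := tT.
  have [m1 [M1 M10 H1]] := B1 t tT; have [m2 [M2 M20 H2]] := B2 t tT.
  have [d1 d10 E1] := C1 t tT 1 ltr01; have [d2 d20 E2] := C2 t tT 1 ltr01.
  pose M := M1 + M2 + 1; have M0 : 0 <= M by rewrite /M; lra.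
  (* On [[t, T')] both solutions stay within distance 1 of their values at [t]. *)
  pose T' := Num.min T (t + Num.min d1 d2).
  have d0 : 0 < Num.min d1 d2 by rewrite lt_min d10.
  have bd s : t <= s < T' -> [/\ 0 <= s < T,
      {ae leb R d, forall x, `|rho1 s x| <= M} & {ae leb R d, forall x, `|rho2 s x| <= M}].
    rewrite lt_min => /and3P[ts sT sd].
    have sT' : 0 <= s < T by rewrite (le_trans t0).
    have : `|s - t| < Num.min d1 d2 by rewrite ger0_norm ?subr_ge0//; lra.
    rewrite lt_min => /andP[s1 s2]; split => //.
    + move: H1 (E1 s sT' s1); apply: filterS2 => x h1 h2.
      rewrite -[rho1 s x](subrK (rho1 t x)) (le_trans (ler_normD _ _))// /M; lra.
    + move: H2 (E2 s sT' s2); apply: filterS2 => x h1 h2.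
      rewrite -[rho2 s x](subrK (rho2 t x)) (le_trans (ler_normD _ _))// /M; lra.
  exists (Num.min d1 d2) => // s /andP[ts sd] sT.
  have TT : T' <= T by rewrite /T' ge_min lexx.
  pose u r x := rho1 r x - rho2 r x.
  apply: (@ess_gronwall _ _ _ _ u (fun r x => rhs (rho1 r) x - rhs (rho2 r) x)
    t T' (M + M) (kinetic_lip alpha Phi M)) => //.
  + by rewrite addr_ge0.
  + exact: (kinetic_lip_ge0 a_ge0 phi_ge0 a_int phi_int M0).
  + move=> r rT; have [_ h1 h2] := bd r rT; move: h1 h2; apply: filterS2 => x h1 h2.
    by apply: le_trans (ler_normB _ _) _; exact: lerD.
  + exact: ess_continuous_sub_itv t0 TT C.
  + exact: ess_derivative_sub_itv t0 TT D.
  + move=> r N /andP[tr rT'] N0 rN.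
    have rT : t <= r < T' by rewrite (ltW tr).
    have [r0T h1 h2] := bd r rT.
    move: (h1) (rN); apply: filterS2 => x h3 h4.
    apply: kinetic_rhs_lipschitz => //.
    * by have [] := B1 r r0T.
    * by have [] := B2 r r0T.
  + by apply: Pt; rewrite lexx t0.
  + by rewrite (ltW ts) lt_min sT.
- move=> t /andP[t0 tT] Pt.
  by apply: (ess_vanish_left (a := 0) (T := T) (u := fun t x => rho1 t x - rho2 t x)) => //; rewrite t0.
Qed.

End kinetic_uniqueness.

(** * Uniqueness for the hierarchy *)

Section level_norms.
Context (R : realType) (d : nat).
Hypothesis d_gt0 : (0 < d)%N.
Local Notation mun n := (tuple_measure (leb R d) n).
Local Notation LP := (lebesgue_poisson R d).
Implicit Types (k : config R d -> R) (c q theta : R).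

Definition level_bounded k c q : Prop :=
  forall n, {ae mun n, forall t, `|k (cfg t)| <= c * q ^+ n}.

Lemma nu_leP n k c : 0 <= c ->
  (nu n k <= c%:E)%E <-> {ae mun n, forall t, `|k (cfg t)| <= c}.
Proof.
move=> c0; rewrite /nu Lnorm_inftyP//; have U := ae_uniq R d_gt0 n.
by split; move: U; apply: filterS2 => t ut /=; rewrite cfgE.
Qed.

Lemma level_bounded_le k c q q' : 0 <= c -> 0 <= q -> q <= q' ->
  level_bounded k c q -> level_bounded k c q'.
Proof.
move=> c0 q0 qq' H n; apply: filterS (H n) => t /le_trans; apply.
by rewrite ler_wpM2l// lerXn2r// nnegrE (le_trans q0).
Qed.

Lemma KnormP theta k c : 0 <= c ->
  (Knorm theta k <= c%:E)%E <-> level_bounded k c (expR (- theta)).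
Proof.
move=> c0.
have E n : (((expR (theta * n%:R))%:E * nu n k <= c%:E)%E <->
    {ae mun n, forall t, `|k (cfg t)| <= c * expR (- theta) ^+ n}).
  rewrite -nu_leP ?mulr_ge0 ?exprn_ge0 ?expR_ge0//.
  rewrite -lee_pdivlMl ?expR_gt0// -EFinM.
  by rewrite mulrC -expRN -expRM_natl mulrN (mulrC theta).
split => [H n|H].
  by apply/E; apply: le_trans H; apply: ereal_sup_ubound; exists n.
by apply: ge_ereal_sup => _ [n _ <-]; apply/E; exact: H.
Qed.

Lemma Knorm_ge0 theta k : (0 <= Knorm theta k)%E.
Proof.
apply: (@le_trans _ _ ((expR (theta * 0%:R))%:E * nu 0 k)%E).
  by rewrite mule_ge0// ?lee_fin ?expR_ge0// /nu Lnorm_ge0.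
by apply: ereal_sup_ubound; exists 0%N.
Qed.

Lemma KspaceP theta k : Kspace theta k <-> measurable_fun setT k /\
  exists2 c, 0 <= c & level_bounded k c (expR (- theta)).
Proof.
split=> [[mk koo]|[mk [c c0 kc]]]; split => //.
  have k0 := Knorm_ge0 theta k.
  have kfin : Knorm theta k \is a fin_num by rewrite ge0_fin_numE.
  exists (fine (Knorm theta k)); first exact: fine_ge0.
  by apply/KnormP; [exact: fine_ge0|rewrite fineK].
by apply: le_lt_trans (ltry c); apply/KnormP.
Qed.

End level_norms.

Section vlasov_uniqueness.
Context (R : realType) (d : nat).
Hypothesis d_gt0 : (0 < d)%N.
Local Notation mun n := (tuple_measure (leb R d) n).
Local Notation LP := (lebesgue_poisson R d).
Local Notation Rd := (Rvec R d).
Variables (a phi : Rd -> R) (alpha Phi : R).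
Hypothesis (ma : measurable_fun setT a) (mphi : measurable_fun setT phi).
Hypothesis (a_ge0 : forall x, 0 <= a x) (phi_ge0 : forall x, 0 <= phi x).
Hypothesis a_sym : forall x, a x = a (vopp x).
Hypothesis a_int : (\int[leb R d]_x (a x)%:E = alpha%:E)%E.
Hypothesis phi_int : (\int[leb R d]_x (phi x)%:E = Phi%:E)%E.
Local Notation LV := (vlasov_op a phi).
Implicit Types (q T : R).

Let alpha0 : 0 <= alpha. Proof. exact: alpha_ge0 a_ge0 a_int. Qed.
Let Phi0 : 0 <= Phi. Proof. exact: Phi_ge0 phi_ge0 phi_int. Qed.

(** What uniqueness uses of a classical solution, with [q] at least
[exp(- theta)]: this allows solutions in spaces with different [theta] to be
compared with a common [q]. *)
Definition hierarchy_solution q T (r : R -> config R d -> R) : Prop :=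
  [/\ forall t, 0 <= t < T -> measurable_fun setT (r t) /\
        exists2 G, 0 <= G & level_bounded (r t) G q,
      forall t, 0 <= t < T -> forall e, 0 < e -> exists2 del, 0 < del &
        forall s, 0 <= s < T -> `|s - t| < del ->
          level_bounded (fun eta => r s eta - r t eta) e q &
      forall t, 0 < t < T -> forall e, 0 < e -> exists2 del, 0 < del &
        forall h, 0 < h < del -> t + h < T ->
          level_bounded (fun eta => (r (t + h) eta - r t eta) / h - LV (r t) eta) e q].

Lemma vlasov_solution_on_hierarchy theta q T r : expR (- theta) <= q ->
  vlasov_solution_on a phi theta `[0, T[ r -> hierarchy_solution q T r.
Proof.
move=> qt [D C [v [_ dv _ vE]]].
have le (k : config R d -> R) c : 0 <= c -> level_bounded k c (expR (- theta)) -> level_bounded k c q.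
  by move=> c0; apply: level_bounded_le => //; exact: expR_ge0.
have N0 (f : config R d -> R) : (0 <= Knorm theta f)%E by exact: Knorm_ge0.
have inI (t : R) : 0 <= t < T -> [set` `[0, T[ : interval R] t.
  by move=> t0; rewrite /= in_itv /= t0.
split.
- move=> t tT; have [/(KspaceP d_gt0)[mk [c c0 kc]] _] := D t (inI t tT).
  by split => //; exists c => //; exact: le.
- move=> t tT e e0.
  have [del del0 H] := (continuous_onP N0 _ _).1 C t (inI t tT) e e0.
  exists del => // s sT st; apply: le (ltW e0) _.
  by apply/(KnormP d_gt0 _ _ (ltW e0)); exact: H (inI s sT) st.
- move=> t tT e e0.
  have It : ([set` `[0, T[ : interval R])° t.
    by rewrite interior_itv_bnd /= in_itv /= tT.
  have [del del0 H] := (derivative_onP N0 _ _ _).1 dv t It e e0.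
  exists del => // h /andP[h0 hd] thT.
  have := H h; rewrite gt_eqF// gtr0_norm// => /(_ isT hd).
  move=> /(KnormP d_gt0 _ _ (ltW e0)) /(le _ _ (ltW e0)) h1 n.
  by move: (h1 n) (ae_LP d_gt0 (vE t It) n); apply: filterS2 => x h2 h3; rewrite -[LV _ _]h3.
Qed.

Lemma hierarchy_ess_continuous n q T r : 0 < q -> hierarchy_solution q T r ->
  ess_continuous (mun n) 0 T (fun t s => r t (cfg s)).
Proof.
move=> q0 [_ C _] t tT e e0; have qn : 0 < q ^+ n by rewrite exprn_gt0.
have [del del0 H] := C t tT (e / q ^+ n) (divr_gt0 e0 qn).
exists del => // s sT st; apply: filterS (H s sT st n) => x.
by rewrite divfK ?gt_eqF.
Qed.

Lemma hierarchy_ess_derivative n q T r : 0 < q -> hierarchy_solution q T r ->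
  ess_derivative (mun n) 0 T (fun t s => r t (cfg s)) (fun t s => LV (r t) (cfg s)).
Proof.
move=> q0 [_ _ D] t tT e e0; have qn : 0 < q ^+ n by rewrite exprn_gt0.
have [del del0 H] := D t tT (e / q ^+ n) (divr_gt0 e0 qn).
exists del => // h hd thT; apply: filterS (H h hd thT n) => x.
by rewrite divfK ?gt_eqF.
Qed.

(** The rate [q] of the two functions serves only for integrability; the bound is in
terms of the rate [p] of their difference, which varies in time below. *)
Lemma vlasov_op_diff_bound (k1 k2 : config R d -> R) (q G1 G2 G p : R) : measurable_fun setT k1 ->
  measurable_fun setT k2 -> 0 <= q -> 0 <= p -> 0 <= G1 -> 0 <= G2 -> 0 <= G ->
  level_bounded k1 G1 q -> level_bounded k2 G2 q -> level_bounded (k1 \- k2) G p ->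
  forall n, {ae mun n, forall t, `|LV k1 (cfg t) - LV k2 (cfg t)| <=
    n%:R * (2 * alpha * (G * p ^+ n) * expR (Phi * p))}.
Proof.
move=> m1 m2 q0 p0 G10 G20 G0 b1 b2 b n.
have V1 := ae_adjoin_bounded d_gt0 n m1 b1; have V2 := ae_adjoin_bounded d_gt0 n m2 b2.
have m := measurable_funB m1 m2; have V := ae_adjoin_bounded d_gt0 n m b.
have U := ae_uniq R d_gt0 n.
have VV : {ae mun n, forall t, vlasov_integrable a phi k1 (cfg t) /\ vlasov_integrable a phi k2 (cfg t)}.
  move: V1 V2; apply: filterS2 => t h1 h2; split.
  - by have [] := adjoin_bounded_vlasov_op d_gt0 ma mphi a_ge0 phi_ge0 a_sym a_int phi_int m1
      (mulr_ge0 G10 (exprn_ge0 n q0)) q0 h1.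
  - by have [] := adjoin_bounded_vlasov_op d_gt0 ma mphi a_ge0 phi_ge0 a_sym a_int phi_int m2
      (mulr_ge0 G20 (exprn_ge0 n q0)) q0 h2.
move: U VV V; apply: filterS3 => t ut [g1 g2] h.
rewrite -vlasov_op_sub// -[X in X%:R](card_cfg ut).
by apply: (adjoin_bounded_vlasov_op d_gt0 ma mphi a_ge0 phi_ge0 a_sym a_int phi_int m
      (mulr_ge0 G0 (exprn_ge0 n p0)) p0 h).2.
Qed.

(** On an interval of length [1 / K] the rate [Q s = q * exp(K (s - t0))] stays below
[q * exp 1].  If the difference is at most [2^-j * Q s ^ n] on all levels, its
time derivative is at most [n * 2 alpha C * 2^-j * Q s ^ n], where [C] bounds
[exp(Phi * Q s)]; as [K > 4 alpha C] this is below the derivative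
[n * K * 2^-(j + 1) * Q s ^ n] of the next bound. *)
Lemma hierarchy_local_unique q T r1 r2 (t0 T' : R) : 0 < q -> 0 <= t0 -> T' <= T ->
  hierarchy_solution q T r1 -> hierarchy_solution q T r2 ->
  (T' - t0) * (4 * alpha * expR (Phi * (q * expR 1)) + 1) <= 1 ->
  (forall s, t0 <= s < T' -> level_bounded (r1 s \- r2 s) 1 q) ->
  (forall n, {ae mun n, forall t, `|r1 t0 (cfg t) - r2 t0 (cfg t)| <= 0}) ->
  forall s, t0 <= s < T' -> forall n,
    {ae mun n, forall t, `|r1 s (cfg t) - r2 s (cfg t)| <= 0}.
Proof.
move=> q0 t00 TT H1 H2.
set C := expR _; set K := _ + 1 => TK wb w0 s sT n.
have C0 : 0 <= C by exact: expR_ge0.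
have K0 : 0 < K by rewrite /K ltr_wpDl// !mulr_ge0.
(* [f j n s] is [2^-j * Q s ^ n]; this form is the one that can be differentiated. *)
pose f j n s := (q ^+ n / 2 ^+ j) * expR ((n%:R * K) * (s - t0) + 0).
have f0 j m u : 0 <= f j m u.
  by rewrite mulr_ge0 ?expR_ge0// divr_ge0// exprn_ge0// ltW.
pose Q u := q * expR (K * (u - t0)).
have fE j m u : f j m u = (2 ^+ j)^-1 * Q u ^+ m.
  rewrite /f /Q exprMn -expRM_natl addr0 mulrA; ring.
have [[B1 _ _] [B2 _ _]] := (H1, H2).
have claim j : forall m u, t0 <= u < T' ->
    {ae mun m, forall t, `|r1 u (cfg t) - r2 u (cfg t)| <= f j m u}.
  elim: j => [|j IH] m u uT.
    apply: filterS (wb u uT m) => t /le_trans; apply.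
    rewrite mul1r /f expr0 divr1 addr0 ler_peMr ?exprn_ge0 ?(ltW q0)//.
    rewrite -[leLHS]expR0 ler_expR.
    by rewrite !mulr_ge0 ?(ltW K0)// subr_ge0; case/andP: uT.
  apply: (@ess_growth _ _ _ (mun m) (fun u t => r1 u (cfg t) - r2 u (cfg t))
    (fun u t => LV (r1 u) (cfg t) - LV (r2 u) (cfg t)) t0 T' (f j.+1 m)
    (fun u => (m%:R * K) * f j.+1 m u)) uT => //.
  - move=> u' uT'; exists (f j m u') => //; exact: IH.
  - exact: ess_continuous_sub_itv t00 TT
      (ess_continuous_sub (hierarchy_ess_continuous m q0 H1) (hierarchy_ess_continuous m q0 H2)).
  - exact: ess_derivative_sub_itv t00 TT
      (ess_derivative_sub (hierarchy_ess_derivative m q0 H1) (hierarchy_ess_derivative m q0 H2)).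
  - move=> u' /andP[tu uT'].
    have uI : t0 <= u' < T' by rewrite (ltW tu).
    have uI0 : 0 <= u' < T by rewrite (le_trans t00 (ltW tu)) (lt_le_trans uT').
    have [m1 [G1 G10 b1]] := B1 u' uI0; have [m2 [G2 G20 b2]] := B2 u' uI0.
    have Q0 : 0 <= Q u' by rewrite mulr_ge0 ?expR_ge0// ltW.
    have i0 : 0 <= (2 ^+ j)^-1 :> R by rewrite invr_ge0 exprn_ge0.
    have b : level_bounded (r1 u' \- r2 u') (2 ^+ j)^-1 (Q u').
      by move=> l; apply: filterS (IH l u' uI) => t; rewrite fE.
    apply: filterS (vlasov_op_diff_bound m1 m2 (ltW q0) Q0 G10 G20 i0 b1 b2 b m) => t.
    move=> /le_trans; apply; rewrite -[leRHS]mulrA ler_wpM2l// fE exprS invfM.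
    have QC : expR (Phi * Q u') <= C.
      rewrite ler_expR ler_wpM2l// ler_wpM2l ?(ltW q0)// ler_expR.
      apply: le_trans TK; rewrite mulrC ler_wpM2r ?(ltW K0)//; lra.
    have X0 : 0 <= (2 ^+ j)^-1 * Q u' ^+ m by rewrite mulr_ge0// exprn_ge0.
    have -> : K * (2^-1 * (2 ^+ j)^-1 * Q u' ^+ m) =
       (2 * alpha * C + 2^-1) * ((2 ^+ j)^-1 * Q u' ^+ m) by rewrite /K; field.
    apply: (@le_trans _ _ (2 * alpha * ((2 ^+ j)^-1 * Q u' ^+ m) * C)).
      by rewrite ler_wpM2l// !mulr_ge0// exprn_ge0.
    have -> : 2 * alpha * ((2 ^+ j)^-1 * Q u' ^+ m) * C =
      2 * alpha * C * ((2 ^+ j)^-1 * Q u' ^+ m) by ring.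
    by rewrite ler_wpM2r// lerDl.
  - move=> u'; apply: (is_derive_eq (is_derive_expR_affine _ _ _ _ _)).
    by rewrite /f; ring.
  - by move=> u'; apply: mulr_ge0; [rewrite mulr_ge0// ltW|exact: f0].
  - by apply: filterS (w0 m) => t /le_trans; apply.
apply: (ae_le0 (C := q ^+ n * expR ((n%:R * K) * (s - t0) + 0))) => [|j].
  by rewrite mulr_ge0 ?expR_ge0// exprn_ge0// ltW.
by apply: filterS (claim j n s sT) => t; rewrite /f mulrAC.
Qed.

Lemma hierarchy_unique q T r1 r2 : 0 < q ->
  hierarchy_solution q T r1 -> hierarchy_solution q T r2 ->
  (forall n, {ae mun n, forall t, r1 0 (cfg t) = r2 0 (cfg t)}) ->
  forall t, 0 <= t < T -> forall n,
    {ae mun n, forall s, `|r1 t (cfg s) - r2 t (cfg s)| <= 0}.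
Proof.
move=> q0 H1 H2 I0; have [B1 C1 D1] := H1; have [B2 C2 D2] := H2.
pose K := 4 * alpha * expR (Phi * (q * expR 1)) + 1.
have K0 : 0 < K by rewrite /K ltr_wpDl// !mulr_ge0// expR_ge0.
apply: real_induction.
- by move=> n; apply: filterS (I0 n) => t ->; rewrite subrr normr0.
- move=> t tT Pt; have /andP[t0 tT'] := tT.
  have h0 : 0 < 1 / 2 :> R by rewrite divr_gt0.
  have [d1 d10 E1] := C1 t tT _ h0; have [d2 d20 E2] := C2 t tT _ h0.
  pose del := Num.min (Num.min d1 d2) K^-1.
  have del0 : 0 < del by rewrite !lt_min d10 d20 invr_gt0.
  exists del => // s /andP[ts sd] sT.
  have P0 : forall n, {ae mun n, forall x, `|r1 t (cfg x) - r2 t (cfg x)| <= 0}.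
    by apply: Pt; rewrite lexx t0.
  apply: (@hierarchy_local_unique q T r1 r2 t (Num.min T (t + del))) => //.
  + by rewrite ge_min lexx.
  + rewrite -/K -ler_pdivlMr// mul1r.
    have : Num.min T (t + del) <= t + del by rewrite ge_min lexx orbT.
    have : del <= K^-1 by rewrite /del ge_min lexx orbT.
    by lra.
  + move=> u; rewrite lt_min => /and3P[tu uT ud] n.
    have uT' : 0 <= u < T by rewrite (le_trans t0).
    have : `|u - t| < del by rewrite ger0_norm ?subr_ge0//; lra.
    rewrite !lt_min -andbA => /and3P[u1 u2 _].
    move: (P0 n) (E1 u uT' u1 n) (E2 u uT' u2 n); apply: filterS3 => x.
    rewrite normr_le0 subr_eq0 => /eqP h1 h2 h3; rewrite mul1r.
    have -> : (r1 u \- r2 u) (cfg x) = (r1 u (cfg x) - r1 t (cfg x)) -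
       (r2 u (cfg x) - r2 t (cfg x)) by rewrite h1 /=; ring.
    by apply: le_trans (ler_normB _ _) _; lra.
  + by rewrite (ltW ts) lt_min sT.
- move=> t /andP[t0 tT] Pt n.
  apply: (ess_vanish_left (a := 0) (T := T)
    (u := fun t x => r1 t (cfg x) - r2 t (cfg x))) => //.
  + by rewrite t0.
  + exact: ess_continuous_sub (hierarchy_ess_continuous n q0 H1)
      (hierarchy_ess_continuous n q0 H2).
  + by move=> s sT; exact: Pt.
Qed.

(** The smaller of the two [theta] gives a norm in which both solutions are
classical. *)
Lemma vlasov_unique r0 r1 r2 : vlasov_solution a phi r0 r1 ->
  vlasov_solution a phi r0 r2 ->
  forall t, 0 <= t -> r1 t = r2 t %[ae LP].
Proof.
move=> [S1 I1] [S2 I2] t t0.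
have tau0 : 0 < t + 1 by rewrite ltr_wpDl.
have [th1 s1] := S1 _ tau0; have [th2 s2] := S2 _ tau0.
pose q := Num.max (expR (- th1)) (expR (- th2)).
have q0 : 0 < q by rewrite lt_max expR_gt0.
have h1 : hierarchy_solution q (t + 1) r1.
  by apply: vlasov_solution_on_hierarchy s1; rewrite le_max lexx.
have h2 : hierarchy_solution q (t + 1) r2.
  by apply: vlasov_solution_on_hierarchy s2; rewrite le_max lexx orbT.
have tT : 0 <= t < t + 1 by rewrite t0 ltrDl ltr01.
have [[m1 _] [m2 _]] : (measurable_fun setT (r1 t) /\ True) /\
    (measurable_fun setT (r2 t) /\ True).
  by have [/(_ t tT)[? _] _ _] := h1; have [/(_ t tT)[? _] _ _] := h2.
have I0 n : {ae mun n, forall x, r1 0 (cfg x) = r2 0 (cfg x)}.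
  move: (ae_LP d_gt0 I1 n) (ae_LP d_gt0 I2 n); apply: filterS2 => x e1 e2.
  by rewrite (e1 Logic.I) (e2 Logic.I).
apply: (LP_ae_eq d_gt0 m1 m2) => n.
apply: filterS (hierarchy_unique q0 h1 h2 I0 tT n) => x.
by rewrite normr_le0 subr_eq0 => /eqP.
Qed.

End vlasov_uniqueness.

(** * Product rule with quadratic error *)

Section product_rule.
Context (R : realType) (T : eqType).
Implicit Types (p q w : T -> R) (s : seq T).

(** The derivative of the product over [s] at [q] in the direction [w], in a form
suited to induction on [s]. *)
Fixpoint dprod w q s : R :=
  if s is x :: s' then w x * (\prod_(y <- s') q y) + q x * dprod w q s' else 0.

Lemma dprodE w q s : uniq s ->
  dprod w q s = \sum_(y <- s) w y * \prod_(x <- s | x != y) q x.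
Proof.
elim: s => [_|x s IH /= /andP[xs us]]; first by rewrite big_nil.
rewrite big_cons big_cons eqxx /= IH//; congr (w x * _ + _).
  rewrite big_seq [RHS]big_seq_cond; apply: eq_bigl => y.
  by case: (boolP (y \in s)) => //= ys; rewrite (memPn xs).
rewrite big_distrr /= big_seq [RHS]big_seq; apply: eq_bigr => y ys.
by rewrite big_cons (memPnC xs)//= mulrCA.
Qed.

Section bounds.
Variables (M : R) (M1 : 1 <= M).

Let M0 : 0 <= M. Proof. exact: le_trans M1. Qed.
Let MX n : 0 <= M ^+ n. Proof. exact: exprn_ge0. Qed.
Let MXS n : M ^+ n <= M ^+ n.+1. Proof. by rewrite exprS ler_peMl. Qed.

Lemma normr_prod_le q s : (forall x, `|q x| <= M) ->
  `|\prod_(x <- s) q x| <= M ^+ size s.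
Proof.
move=> qM; elim: s => [|x s IH]; first by rewrite big_nil normr1.
by rewrite big_cons normrM exprS ler_pM.
Qed.

Lemma normr_prod_sub_le p q e s : (forall x, `|p x| <= M) -> (forall x, `|q x| <= M) ->
  0 <= e -> (forall x, `|p x - q x| <= e) ->
  `|\prod_(x <- s) p x - \prod_(x <- s) q x| <= (size s)%:R * M ^+ size s * e.
Proof.
move=> pM qM e0 pq; elim: s => [|x s IH].
  by rewrite !big_nil subrr normr0 !mul0r.
rewrite !big_cons; set P := \prod_(_ <- _) _; set Q := \prod_(_ <- _) _.
have -> : p x * P - q x * Q = (p x - q x) * P + q x * (P - Q) by ring.
have h1 : `|(p x - q x) * P| <= e * M ^+ size s.
  by rewrite normrM ler_pM// normr_prod_le.
have h2 : `|q x * (P - Q)| <= M * ((size s)%:R * M ^+ size s * e).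
  by rewrite normrM ler_pM.
apply: le_trans (ler_normD _ _) _; apply: le_trans (lerD h1 h2) _.
have := ler_wpM2l e0 (MXS (size s)); rewrite /= -natr1 exprS; lra.
Qed.

Lemma normr_dprod_le w q s : (forall x, `|w x| <= M) -> (forall x, `|q x| <= M) ->
  `|dprod w q s| <= (size s)%:R * M ^+ size s.
Proof.
move=> wM qM; elim: s => [|x s IH] /=; first by rewrite normr0 mul0r.
apply: le_trans (ler_normD _ _) _; rewrite !normrM.
apply: (@le_trans _ _ (M * M ^+ size s + M * ((size s)%:R * M ^+ size s))).
  by apply: lerD; apply: ler_pM => //; exact: normr_prod_le.
by rewrite -natr1 exprS le_eqVlt; apply/orP; left; apply/eqP; ring.
Qed.

Lemma normr_dprod_sub_le w w' q q' e s :
  (forall x, `|w x| <= M) -> (forall x, `|w' x| <= M) ->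
  (forall x, `|q x| <= M) -> (forall x, `|q' x| <= M) -> 0 <= e ->
  (forall x, `|w x - w' x| <= e) -> (forall x, `|q x - q' x| <= e) ->
  `|dprod w q s - dprod w' q' s| <= (size s)%:R ^+ 2 * M ^+ size s * e.
Proof.
move=> wM w'M qM q'M e0 ww qq; elim: s => [|x s IH] /=.
  by rewrite subrr normr0 expr0n !mul0r.
set P := \prod_(_ <- _) _; set Q := \prod_(_ <- _) _.
set D := dprod _ _ _; set D' := dprod _ _ _; set n := size s.
have -> : w x * P + q x * D - (w' x * Q + q' x * D') =
  (w x - w' x) * P + w' x * (P - Q) + ((q x - q' x) * D + q' x * (D - D')) by ring.
have h1 : `|(w x - w' x) * P| <= e * M ^+ n.
  by rewrite normrM ler_pM// normr_prod_le.
have h2 : `|w' x * (P - Q)| <= M * (n%:R * M ^+ n * e).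
  by rewrite normrM ler_pM//; exact: normr_prod_sub_le.
have h3 : `|(q x - q' x) * D| <= e * (n%:R * M ^+ n).
  by rewrite normrM ler_pM//; exact: normr_dprod_le.
have h4 : `|q' x * (D - D')| <= M * (n%:R ^+ 2 * M ^+ n * e).
  by rewrite normrM ler_pM.
apply: le_trans (ler_normD _ _) _.
apply: le_trans (lerD (ler_normD _ _) (ler_normD _ _)) _.
apply: le_trans (lerD (lerD h1 h2) (lerD h3 h4)) _.
have k1 := ler_wpM2l e0 (MXS n).
have k2 : n%:R * (e * M ^+ n) <= n%:R * (e * M ^+ n.+1) by rewrite ler_wpM2l.
move: k1 k2; rewrite -(@natr1 _ n) exprS; lra.
Qed.

(** Adding a factor to a product of [n] factors adds at most [n + 1] remainders,
whence the square. *)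
Lemma normr_prod_taylor p q w e h s :
  (forall x, `|p x| <= M) -> (forall x, `|q x| <= M) -> (forall x, `|w x| <= M) ->
  0 <= e -> (forall x, `|p x - q x| <= e) ->
  (forall x, `|p x - q x - h * w x| <= `|h| * e) ->
  `|\prod_(x <- s) p x - \prod_(x <- s) q x - h * dprod w q s| <=
    (size s)%:R ^+ 2 * M ^+ size s * (`|h| * e).
Proof.
move=> pM qM wM e0 pq pqw; elim: s => [|x s IH].
  by rewrite !big_nil /= mulr0 !subrr normr0 expr0n !mul0r.
rewrite !big_cons /=; set P := \prod_(_ <- _) _; set Q := \prod_(_ <- _) _.
set D := dprod _ _ _; set n := size s.
have -> : p x * P - q x * Q - h * (w x * Q + q x * D) =
  (p x - q x - h * w x) * P + h * w x * (P - Q) + q x * (P - Q - h * D) by ring.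
have h1 : `|(p x - q x - h * w x) * P| <= `|h| * e * M ^+ n.
  by rewrite normrM ler_pM// normr_prod_le.
have h2 : `|h * w x * (P - Q)| <= `|h| * M * (n%:R * M ^+ n * e).
  by rewrite !normrM ler_pM ?mulr_ge0// ?ler_wpM2l//; exact: normr_prod_sub_le.
have h3 : `|q x * (P - Q - h * D)| <= M * (n%:R ^+ 2 * M ^+ n * (`|h| * e)).
  by rewrite normrM ler_pM.
apply: le_trans (ler_normD _ _) _.
apply: le_trans (lerD (ler_normD _ _) h3) _.
apply: le_trans (lerD (lerD h1 h2) (lexx _)) _.
have he0 : 0 <= `|h| * e by rewrite mulr_ge0.
have k1 := ler_wpM2l he0 (MXS n).
have k2 : 0 <= n%:R * (`|h| * e * M ^+ n.+1) by rewrite !mulr_ge0.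
move: k1 k2; rewrite -(@natr1 _ n) exprS; lra.
Qed.

End bounds.
End product_rule.

Lemma sqr_natr_le4X (R : realType) n : n%:R ^+ 2 <= 4 ^+ n :> R.
Proof.
rewrite -!natrX ler_nat (_ : 4 = 2 ^ 2)%N// -expnM mulnC expnM leq_exp2r//.
by rewrite ltnW// ltn_expl.
Qed.

(** * Product functions on configurations *)

Section config_product.
Context (R : realType) (d : nat).
Hypothesis d_gt0 : (0 < d)%N.
Local Notation mun n := (tuple_measure (leb R d) n).
Local Notation Rd := (Rvec R d).
Implicit Types (f w q : Rd -> R) (eta : config R d).

Lemma sum_config_exp_dprod w q eta :
  \sum_(y <- eta) w y * config_exp q (eta `\ y)%fset = dprod w q (enum_fset eta).
Proof.
rewrite dprodE ?fset_uniq//; apply: eq_bigr => y _; congr (_ * _).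
rewrite /config_exp -[RHS]big_filter; apply: perm_big; apply: uniq_perm.
- exact: fset_uniq.
- by rewrite filter_uniq// fset_uniq.
- by move=> x; rewrite mem_filter in_fsetD1.
Qed.

Lemma measurable_fun_sum_config_exp w q : measurable_fun setT w -> measurable_fun setT q ->
  measurable_fun setT (fun eta : config R d =>
    \sum_(y <- eta) w y * config_exp q (eta `\ y)%fset).
Proof.
move=> mw mq; apply: measurable_config_fun => -[|n].
  rewrite (_ : (fun t => _) = cst 0); first exact: measurable_cst.
  apply/funext => t; rewrite (tuple0_eq t) cfgE//= big1_seq// => y.
  by rewrite /= mem_config_of.
rewrite (_ : (fun t => _) = (fun t : n.+1.-tuple Rd => if uniq t then
    \sum_(i < n.+1) w (tnth t i) * \prod_(j < n) q (tnth (tdel i t) j) else 0)).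
  apply: measurable_fun_ifT; [exact: measurable_uniq| |exact: measurable_cst].
  apply: measurable_sum => i; apply: measurable_funM.
    exact: (measurableT_comp mw (@measurable_tnth _ _ _ i)).
  apply: (measurable_fun_prod_tnth (f := fun=> q) (t := tdel i)) => j.
  apply: (measurableT_comp mq).
  exact: (measurableT_comp (@measurable_tnth _ _ _ j) (@measurable_tdel _ _ _ i)).
apply/funext => t; case: ifP => ut; last first.
  by rewrite /cfg ut big_seq_fset0.
rewrite {1}cfgE// (perm_big _ (perm_config_of ut))/= big_tuple.
apply: eq_bigr => i _; have [ud ->] := cfg_tdel i ut.
by rewrite config_exp_cfg.
Qed.

Lemma level_bounded_card (k : config R d -> R) (c q : R) :
  (forall eta, `|k eta| <= c * q ^+ #|` eta|) -> level_bounded k c q.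
Proof.
move=> H n; have := ae_uniq R d_gt0 n; apply: filterS => t ut.
by rewrite -{2}(card_cfg ut).
Qed.

Section ess_sup_product.
Variables (rho0 : Rd -> R) (c : R).
Hypothesis c0 : 0 <= c.
Hypothesis cE : 'N[leb R d]_+oo[EFin \o rho0]%E = c%:E.

(** If a set meets every conull set, then so do its powers: a conull set of tuples
has conull slices. *)
Lemma ae_tuple_witness (A : set Rd) n (P : n.-tuple Rd -> Prop) :
  ((0 < n)%N -> forall Q : Rd -> Prop, {ae leb R d, forall x, Q x} ->
    exists2 x, A x & Q x) ->
  {ae mun n, forall t, P t} -> exists2 t, (forall i, A (tnth t i)) & P t.
Proof.
elim: n P => [|n IH] P HA.
  move=> [N [mN N0 sN]]; exists [tuple]; first by case.
  apply: contrapT => /sN N1; move: N0; rewrite /= diracE mem_set// => /eqP.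
  by rewrite onee_eq0.
move=> /ae_tcons1 H; have [x Ax /(IH _ (fun=> HA isT))[t At Pt]] := HA isT _ H.
exists (tcons (x, t)) => // i; have [j ->|->] := unliftP ord0 i.
  by rewrite tnthS.
by rewrite tnth0.
Qed.

(** Tuples with all entries in [|rho0| >= c'] have products of size at least
[c' ^ n] for any [c' < c], and they cannot be avoided by a conull set.  The level
[n = 0] needs no entries, which matters if [c = 0]. *)
Lemma nu_config_exp_ge n : ((c ^+ n)%:E <= nu n (config_exp rho0))%E.
Proof.
have nu0 : (0 <= nu n (config_exp rho0))%E by exact: Lnorm_ge0.
rewrite leNgt; apply/negP => lt.
have nufin : nu n (config_exp rho0) \is a fin_num.
  by rewrite ge0_fin_numE// (lt_trans lt) ?ltry.
pose b := fine (nu n (config_exp rho0)).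
have b0 : 0 <= b by exact: fine_ge0.
have bE : nu n (config_exp rho0) = b%:E by rewrite fineK.
have bn : {ae mun n, forall t, `|config_exp rho0 (cfg t)| <= b}.
  by apply/(nu_leP d_gt0) => //; rewrite bE.
move: lt; rewrite bE lte_fin => lt.
have bU : {ae mun n, forall t : n.-tuple Rd, `|\prod_(i < n) rho0 (tnth t i)| <= b}.
  have U := ae_uniq R d_gt0 n.
  by move: U bn; apply: filterS2 => t ut; rewrite config_exp_cfg.
have [c' c'0 [bc' c'c]] : exists2 c', 0 <= c' & b < c' ^+ n /\ ((0 < n)%N -> c' < c).
  have [n00|n0] := posnP n.
    by exists 0 => //; split; move: lt; rewrite n00// !expr0.
  have c_gt0 : 0 < c.
    rewrite lt_neqAle c0 andbT eq_sym; apply: contraTneq lt => ->.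
    by rewrite expr0n gtn_eqF// -leNgt.
  have e0 : 0 < c ^+ n - b by rewrite subr_gt0.
  have /cvgrPdist_lt/(_ _ e0)[del /= del0 H] := @exprn_continuous R n c.
  (* [c' = c - h] is nonnegative, below [c], and close enough that [b < c' ^ n]. *)
  pose h := Num.min (del / 2) (c / 2).
  have h0 : 0 < h by rewrite lt_min !divr_gt0.
  have hd : h <= del / 2 by rewrite /h ge_min lexx.
  have hdel : h < del by lra.
  have hc : h <= c / 2 by rewrite /h ge_min lexx orbT.
  exists (c - h); first by lra.
  split; last by move=> _; lra.
  have := H (c - h); rewrite /= subKr gtr0_norm// => /(_ _)/(le_lt_trans (ler_norm _)).
  by move=> /(_ hdel); lra.
have [t tc] : exists2 t : n.-tuple Rd, (forall i, c' <= `|rho0 (tnth t i)|) &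
    `|\prod_(i < n) rho0 (tnth t i)| <= b.
  apply: (ae_tuple_witness (A := [set x | c' <= `|rho0 x|])) bU => /c'c lt' Q HQ.
  apply: contrapT => nex.
  have : ('N[leb R d]_+oo[EFin \o rho0] <= c'%:E)%E.
    apply/Lnorm_inftyP => //; apply: filterS HQ => x Qx.
    by rewrite leNgt; apply/negP => xc; apply: nex; exists x => //; exact: ltW.
  by rewrite cE lee_fin leNgt lt'.
apply/negP; rewrite -ltNge; apply: lt_le_trans bc' _.
rewrite normr_prod -[X in c' ^+ X]card_ord -prodr_const.
by apply: ler_prod => i _; rewrite c'0 tc.
Qed.

End ess_sup_product.
End config_product.

(** * Product functions of kinetic solutions *)

Section vlasov_existence.
Context (R : realType) (d : nat).
Hypothesis d_gt0 : (0 < d)%N.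
Local Notation Rd := (Rvec R d).
Local Notation LP := (lebesgue_poisson R d).
Variables (a phi : Rd -> R) (alpha Phi : R).
Hypothesis (ma : measurable_fun setT a) (mphi : measurable_fun setT phi).
Hypothesis (a_ge0 : forall x, 0 <= a x) (phi_ge0 : forall x, 0 <= phi x).
Hypothesis a_sym : forall x, a x = a (vopp x).
Hypothesis a_int : (\int[leb R d]_x (a x)%:E = alpha%:E)%E.
Hypothesis phi_int : (\int[leb R d]_x (phi x)%:E = Phi%:E)%E.
Local Notation rhs := (kinetic_rhs a phi).
Variables (c : R) (rho : R -> Rd -> R).
Hypothesis c0 : 0 <= c.
Hypothesis mrho : forall t, measurable_fun setT (rho t).
Hypothesis rho_bd : forall t x, 0 <= t -> 0 <= rho t x <= c * expR (alpha * t).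
Hypothesis rho_cont : forall t, 0 <= t -> forall e, 0 < e ->
  exists2 del, 0 < del & forall s, 0 <= s -> `|s - t| < del -> forall x,
    `|rho s x - rho t x| <= e /\ `|rhs (rho s) x - rhs (rho t) x| <= e.
Hypothesis rho_der : forall t, 0 < t -> forall e, 0 < e ->
  exists2 del, 0 < del & forall h, `|h| < del -> 0 <= t + h /\ forall x,
    `|rho (t + h) x - rho t x - h * rhs (rho t) x| <= `|h| * e.

Let alpha0 : 0 <= alpha. Proof. exact: alpha_ge0 a_ge0 a_int. Qed.

(** One constant for the solution and its time derivative, at least [1] so that its
powers increase with the number of factors. *)
Lemma kinetic_orbit_bound tau : 0 <= tau -> exists2 M, 1 <= M & forall t x, 0 <= t <= tau ->
  `|rho t x| <= M /\ `|rhs (rho t) x| <= M.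
Proof.
move=> tau0; pose m := c * expR (alpha * tau).
have m0 : 0 <= m by rewrite mulr_ge0// expR_ge0.
pose m' := 2 * alpha * m * expR (Phi * m).
have m'0 : 0 <= m' by rewrite !mulr_ge0// expR_ge0.
have rm t x : 0 <= t <= tau -> `|rho t x| <= m.
  move=> /andP[t0 tt]; have /andP[r0 r1] := rho_bd x t0.
  rewrite ger0_norm// (le_trans r1)// ler_wpM2l// ler_expR ler_wpM2l//.
exists (1 + m + m') => [|t x tt]; first by rewrite -addrA lerDl addr_ge0.
have h1 := rm t x tt; split; first by lra.
have : `|rhs (rho t) x| <= m'.
  by apply: (kinetic_rhs_bound ma mphi a_ge0 phi_ge0 a_int phi_int m0) => //; apply: aeW => y; exact: rm.
lra.
Qed.

Lemma kinetic_solution_of_uniform rho0 : {ae leb R d, forall x, rho 0 x = rho0 x} ->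
  kinetic_solution a phi rho0 rho.
Proof.
move=> r0; split; last by apply: filterS r0.
have N0 (f : Rd -> R) : (0 <= 'N[leb R d]_+oo[EFin \o f])%E by exact: Lnorm_ge0.
have inI (t : R) : [set` `[0, +oo[ : interval R] t -> 0 <= t.
  by rewrite /= in_itv /= andbT.
have inI' (t : R) : ([set` `[0, +oo[ : interval R])° t -> 0 < t.
  by rewrite interior_itv_bndy /= in_itv /= andbT.
have LI (t : R) : 0 <= t -> Linfty (rho t) /\ Linfty (rhs (rho t)).
  move=> t0; have [M M1 H] := kinetic_orbit_bound t0.
  have M0 : 0 <= M by exact: le_trans M1.
  have tt : 0 <= t <= t by rewrite t0 lexx.
  split; apply/LinftyP; split.
  - exact: mrho.
  - by exists M => //; apply: aeW => x; have [] := H t x tt.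
  - exact: measurable_kinetic_rhs.
  - by exists M => //; apply: aeW => x; have [] := H t x tt.
split.
- by move=> t /inI/LI[].
- apply/(continuous_onP N0) => t /inI t0 e e0.
  have [del del0 H] := rho_cont t0 e0; exists del => // s /inI s0 st.
  by apply/(Lnorm_inftyP _ _ (ltW e0)); apply: aeW => x; have [] := H s s0 st x.
exists (fun t => rhs (rho t)); split.
- by move=> t /inI'/ltW/LI[].
- apply/(derivative_onP N0) => t /inI' t0 e e0.
  have [del del0 H] := rho_der t0 e0; exists del => // h h0 hd.
  apply/(Lnorm_inftyP _ _ (ltW e0)); apply: aeW => x; have [_ /(_ x)] := H h hd.
  have -> : (rho (t + h) x - rho t x) / h - rhs (rho t) x =
    (rho (t + h) x - rho t x - h * rhs (rho t) x) / h by field.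
  by rewrite normrM normfV ler_pdivrMr ?normr_gt0// (mulrC e).
- apply/(continuous_onP N0) => t /inI'/ltW t0 e e0.
  have [del del0 H] := rho_cont t0 e0; exists del => // s /inI'/ltW s0 st.
  by apply/(Lnorm_inftyP _ _ (ltW e0)); apply: aeW => x; have [] := H s s0 st x.
- by move=> t _; apply: aeW.
Qed.

Lemma vlasov_op_rho t eta : 0 <= t -> vlasov_op a phi (config_exp (rho t)) eta =
  dprod (rhs (rho t)) (rho t) (enum_fset eta).
Proof.
move=> t0; rewrite -sum_config_exp_dprod.
by apply: (vlasov_op_config_exp d_gt0 ma mphi a_ge0 phi_ge0 a_sym a_int phi_int (M := c * expR (alpha * t))) => // x; have /andP[] := rho_bd x t0.
Qed.

(** Continuity costs a factor [n], differentiability and the continuity of the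
derivative a factor [n ^ 2], on top of [M ^ n]. *)
Lemma vlasov_solution_config_exp (r0 : config R d -> R) :
  config_exp (rho 0) = r0 %[ae LP] ->
  vlasov_solution a phi r0 (fun t => config_exp (rho t)).
Proof.
move=> I0; split => // tau tau0.
have [M M1 H] := kinetic_orbit_bound (ltW tau0).
have M0 : 0 <= M by exact: le_trans M1.
have M4 : 0 < 4 * M by rewrite mulr_gt0// (lt_le_trans _ M1).
(* Then [exp(- theta) = 4 M], and [4 ^ n] dominates [n ^ 2]. *)
exists (- ln (4 * M)).
have qE : expR (- - ln (4 * M)) = 4 * M by rewrite opprK lnK.
have N0 (f : config R d -> R) : (0 <= Knorm (- ln (4 * M)) f)%E by exact: Knorm_ge0.
have inI (t : R) : [set` `[0, tau[ : interval R] t -> 0 <= t <= tau.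
  by rewrite /= in_itv /= => /andP[-> /ltW].
have inI' (t : R) : ([set` `[0, tau[ : interval R])° t -> 0 < t < tau.
  by rewrite interior_itv_bnd /= in_itv /=.
have lt_le (t : R) : 0 < t < tau -> 0 <= t <= tau by case/andP => /ltW -> /ltW.
have MX (m n : nat) (e : R) : 0 <= e -> m%:R <= 4 ^+ n :> R -> m%:R * M ^+ n * e <= e * (4 * M) ^+ n.
  by move=> e0 mn; rewrite mulrC ler_wpM2l// exprMn ler_wpM2r// exprn_ge0.
have n4 n : n%:R <= 4 ^+ n :> R.
  by apply: le_trans (sqr_natr_le4X R n); rewrite -natrX ler_nat; case: n => // n; rewrite -mulnn leq_pmull.
have n24 n : (n ^ 2)%:R <= 4 ^+ n :> R by rewrite natrX sqr_natr_le4X.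
have bd t x : 0 <= t <= tau -> `|rho t x| <= M by move=> tt; have [] := H t x tt.
have bdr t x : 0 <= t <= tau -> `|rhs (rho t) x| <= M by move=> tt; have [] := H t x tt.
have Kle e k : 0 < e -> (forall eta : config R d, `|k eta| <= e * (4 * M) ^+ #|` eta|) ->
    (Knorm (- ln (4 * M)) k <= e%:E)%E.
  move=> e0 ke; apply/(KnormP d_gt0); first exact: ltW.
  by rewrite qE; exact: level_bounded_card.
have KV t : 0 <= t <= tau -> Kspace (- ln (4 * M)) (vlasov_op a phi (config_exp (rho t))).
  move=> tt; have /andP[t0 _] := tt.
  have VE : vlasov_op a phi (config_exp (rho t)) = (fun eta : config R d =>
      \sum_(y <- eta) rhs (rho t) y * config_exp (rho t) (eta `\ y)%fset).
    by apply/funext => eta; rewrite vlasov_op_rho// sum_config_exp_dprod.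
  apply/(KspaceP d_gt0); split.
    by rewrite VE; apply: measurable_fun_sum_config_exp => //; exact: measurable_kinetic_rhs.
  exists 1 => //; rewrite qE; apply: level_bounded_card => // eta.
  rewrite vlasov_op_rho//.
  have le1 := normr_dprod_le (enum_fset eta) (fun x => bdr t x tt) (fun x => bd t x tt).
  apply: (le_trans le1).
  by rewrite -[leLHS]mulr1; exact: MX.
have K t : 0 <= t <= tau -> Kspace (- ln (4 * M)) (config_exp (rho t)).
  move=> tt; apply/(KspaceP d_gt0); split; first exact: measurable_fun_config_exp.
  exists 1 => //; rewrite qE; apply: level_bounded_card => // eta.
  apply: le_trans (normr_prod_le _ _) _; first by move=> x; exact: bd.
  by rewrite mul1r lerXn2r ?nnegrE// ?(ltW M4)// ler_peMl// ler1n.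
split.
- by move=> t /inI tt; split; [exact: K|exact: KV].
- apply/(continuous_onP N0) => t /inI tt e e0; have /andP[t0 _] := tt.
  have [del del0 C] := rho_cont t0 e0; exists del => // s /inI ss st.
  have /andP[s0 _] := ss; apply: Kle => // eta.
  apply: le_trans (normr_prod_sub_le M1 (e := e) _ _ _ _ _) _.
  + by move=> x; exact: bd.
  + by move=> x; exact: bd.
  + exact: ltW.
  + by move=> x; have [] := C s s0 st x.
  + by apply: MX; [exact: ltW|exact: n4].
exists (fun t => vlasov_op a phi (config_exp (rho t))); split.
- by move=> t /inI'/lt_le/KV.
- apply/(derivative_onP N0) => t /inI' tt e e0; have /andP[t0 ttau] := tt.
  have [d1 d10 D] := rho_der t0 e0; have [d2 d20 C] := rho_cont (ltW t0) e0.
  exists (Num.min (Num.min d1 d2) (tau - t)); first by rewrite !lt_min d10 d20 subr_gt0.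
  move=> h h0; rewrite !lt_min -andbA => /and3P[hd1 hd2 hd3].
  have [th0 Dh] := D h hd1.
  have thtau : t + h <= tau by have := ler_norm h; lra.
  have tth : 0 <= t + h <= tau by rewrite th0.
  have tE : t + h - t = h by ring.
  apply: Kle => // eta.
  have -> : (config_exp (rho (t + h)) eta - config_exp (rho t) eta) / h -
      vlasov_op a phi (config_exp (rho t)) eta =
    (config_exp (rho (t + h)) eta - config_exp (rho t) eta -
      h * vlasov_op a phi (config_exp (rho t)) eta) / h by field.
  rewrite normrM normfV ler_pdivrMr ?normr_gt0// vlasov_op_rho ?(ltW t0)//.
  apply: le_trans (normr_prod_taylor M1 (e := e) _ _ _ _ _ _ _) _.
  + by move=> x; exact: bd.
  + by move=> x; apply: bd; exact: lt_le.
  + by move=> x; apply: bdr; exact: lt_le.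
  + exact: ltW.
  + by move=> x; have := C (t + h) th0; rewrite tE => /(_ hd2 x)[].
  + exact: Dh.
  + rewrite -natrX (mulrC `|h|) mulrA ler_wpM2r//.
    by apply: MX; [exact: ltW|exact: n24].
- apply/(continuous_onP N0) => t /inI'/lt_le tt e e0; have /andP[t0 _] := tt.
  have [del del0 C] := rho_cont t0 e0; exists del => // s /inI'/lt_le ss st.
  have /andP[s0 _] := ss; apply: Kle => // eta; rewrite !vlasov_op_rho//.
  apply: le_trans (normr_dprod_sub_le M1 (e := e) _ _ _ _ _ _ _ _) _.
  + by move=> x; exact: bdr.
  + by move=> x; exact: bdr.
  + by move=> x; exact: bd.
  + by move=> x; exact: bd.
  + exact: ltW.
  + by move=> x; have [] := C s s0 st x.
  + by move=> x; have [] := C s s0 st x.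
  + by rewrite -natrX; apply: MX; [exact: ltW|exact: n24].
- by move=> t _; apply: aeW.
Qed.

(** Each factor is at most [c * exp(alpha * t)], and [c ^ n] is the norm of the n-th
level of the initial datum. *)
Lemma level_bound_config_exp (rho0 : Rd -> R) t : 0 <= t ->
  'N[leb R d]_+oo[EFin \o rho0]%E = c%:E ->
  level_bound alpha t (config_exp rho0) (config_exp (rho t)).
Proof.
move=> t0 cE; apply: aeW => eta.
apply: (@le_trans _ _ ((c ^+ #|` eta|)%:E * (expR (alpha * #|` eta|%:R * t))%:E)%E); last first.
  apply: lee_wpmul2r; first by rewrite lee_fin expR_ge0.
  exact: nu_config_exp_ge.
rewrite -EFinM lee_fin (mulrC alpha) -mulrA expRM_natl -exprMn.
rewrite -[X in _ ^+ X]/(size (enum_fset eta)) /config_exp.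
elim: (enum_fset eta) => [|x s IH]; first by rewrite big_nil.
rewrite big_cons exprS; have /andP[r0 r1] := rho_bd x t0; apply: ler_pM => //.
by apply: prodr_ge0 => y _; have /andP[] := rho_bd y t0.
Qed.

End vlasov_existence.

(** * The theorem *)

(** Clipping to [[0, c]] changes [f] on a null set only. *)
Lemma ess_sup_representative d (X : measurableType d) (R : realType)
    (mu : {measure set X -> \bar R}) (f : X -> R) c : measurable_fun setT f ->
  0 <= c -> {ae mu, forall x, 0 <= f x} -> 'N[mu]_+oo[EFin \o f]%E = c%:E ->
  exists g : X -> R, [/\ measurable_fun setT g, forall x, 0 <= g x <= c &
    {ae mu, forall x, g x = f x}].
Proof.
move=> mf c0 f0 fc; exists (fun x => Num.max 0 (Num.min (f x) c)); split.
- by apply: measurable_maxr => //; exact: measurable_minr.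
- by move=> x; rewrite le_max lexx ge_max c0 /= ge_min lexx orbT.
have : {ae mu, forall x, `|f x| <= c} by apply/Lnorm_inftyP; rewrite ?fc.
move: f0; apply: filterS2 => x f0; rewrite ger0_norm// => fc'.
by rewrite min_l// max_r.
Qed.

Theorem theorem4p5 (R : realType) (d : nat) (d_gt0 : (0 < d)%N)
    (a phi : Rvec R d -> R)
    (ma : measurable_fun [set: Rvec R d] a)
    (mphi : measurable_fun [set: Rvec R d] phi)
    (a_ge0 : forall x, 0 <= a x) (phi_ge0 : forall x, 0 <= phi x)
    (a_sym : forall x, a x = a (vopp x))
    (phi_sym : forall x, phi x = phi (vopp x))
    (a_int : (\int[leb R d]_x (a x)%:E < +oo)%E)
    (phi_L1 : phi \in Lfun (leb R d) 1%E)
    (rho0 : Rvec R d -> R) (rho0_ge0 : Delta_plus rho0) :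
  let alpha := \int[leb R d]_x a x in
  let r0 := config_exp rho0 in
  exists (r : R -> config R d -> R) (rho : R -> Rvec R d -> R),
    [/\ vlasov_solution a phi r0 r,
        forall r' : R -> config R d -> R, vlasov_solution a phi r0 r' ->
          forall t, 0 <= t -> r' t = r t %[ae lebesgue_poisson R d],
        [/\ kinetic_solution a phi rho0 rho,
            forall t, 0 <= t -> Delta_plus (rho t) &
            forall rho' : R -> Rvec R d -> R,
              kinetic_solution a phi rho0 rho' ->
              forall t, 0 <= t -> rho' t = rho t %[ae leb R d]],
        forall t, 0 <= t -> r t = config_exp (rho t) %[ae lebesgue_poisson R d] &
        forall t, 0 <= t -> level_bound alpha t r0 (r t)].
Proof.
move=> alpha r0.
have a_intE : (\int[leb R d]_x (a x)%:E = alpha%:E)%E.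
  rewrite /alpha /Rintegral fineK// ge0_fin_numE//.
  by apply: integral_ge0 => x _; rewrite lee_fin.
have [Phi phi_intE] : exists Phi, (\int[leb R d]_x (phi x)%:E = Phi%:E)%E.
  have /integrable_fin_num H := (Lfun1_integrable _ _).1 phi_L1.
  exists (fine (\int[leb R d]_x (phi x)%:E)%E); rewrite fineK//.
  exact: H.
have [/LinftyP[mrho0 [M M0 rho0M]] rho0_pos] := rho0_ge0.
have Nfin : 'N[leb R d]_+oo[EFin \o rho0]%E \is a fin_num by exact: Lnorm_infty_fin rho0M M0.
pose c := fine 'N[leb R d]_+oo[EFin \o rho0]%E.
have cE : 'N[leb R d]_+oo[EFin \o rho0]%E = c%:E by rewrite fineK.
have c0 : 0 <= c by apply: fine_ge0; exact: Lnorm_ge0.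
have [g [mg gc gE]] := ess_sup_representative mrho0 c0 rho0_pos cE.
have [rho [rho_0 mrho rho_bd rho_cont rho_der]] :=
  kinetic_exists ma mphi a_ge0 phi_ge0 a_intE phi_intE mg c0 gc.
have I0 : {ae leb R d, forall x, rho 0 x = rho0 x} by rewrite rho_0.
have kin : kinetic_solution a phi rho0 rho.
  exact: (kinetic_solution_of_uniform ma mphi a_ge0 phi_ge0 a_intE phi_intE c0 mrho rho_bd rho_cont rho_der).
have J0 : config_exp (rho 0) = r0 %[ae lebesgue_poisson R d].
  apply: (LP_ae_eq d_gt0) => [||n]; [exact: measurable_fun_config_exp|exact: measurable_fun_config_exp|].
  have U := ae_uniq R d_gt0 n; have J := ae_all_tuple n I0.
  by move: U J; apply: filterS2 => t ut tE; rewrite /r0 !config_exp_cfg//; apply: eq_bigr.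
have vl : vlasov_solution a phi r0 (fun t => config_exp (rho t)).
  exact: (vlasov_solution_config_exp d_gt0 ma mphi a_ge0 phi_ge0 a_sym a_intE phi_intE c0 mrho rho_bd rho_cont rho_der J0).
exists (fun t => config_exp (rho t)), rho; split => //.
- move=> r' vl'; exact: (vlasov_unique d_gt0 ma mphi a_ge0 phi_ge0 a_sym a_intE phi_intE vl' vl).
- split => //.
  + move=> t t0; split; last by apply: aeW => x; have /andP[] := rho_bd t x t0.
    apply/LinftyP; split => //; exists (c * expR (alpha * t)).
      by rewrite mulr_ge0// expR_ge0.
    by apply: aeW => x; have /andP[r1 r2] := rho_bd t x t0; rewrite ger0_norm.
  + move=> rho' kin'.
    exact: (kinetic_unique ma mphi a_ge0 phi_ge0 a_intE phi_intE kin' kin).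
- by move=> t t0; apply: aeW.
- by move=> t t0; exact: (level_bound_config_exp d_gt0 c0 rho_bd t0 cE).
Qed.
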